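(* There is an algorithm that, given a connected graph $G$ with $n$ vertices, $m$ edges and maximum degree $\Delta(G)$ such that $G$ does not admit a pseudo-$1$-join, in $O(nm(\Delta(G)+\alpha(m,\Delta(G))))$ time either finds a pseudo-$2$-join of $G$ or reports that $G$ has no pseudo-$2$-join.
   Context: $\alpha(\cdot,\cdot)$ is the inverse Ackermann function. A pseudo-$1$-join of $G$ is a partition $(V_1,V_2)$ of $V(G)$ with sets $A_1\subseteq V_1$, $A_2\subseteq V_2$ such that $A_1\cup A_2$ is a clique, $V_1\setminus A_1$ has no neighbor in $V_2$, $V_2\setminus A_2$ has no neighbor in $V_1$, and neither $V_1$ nor $V_2$ is a stable set (each contains an edge of $G$). A pseudo-$2$-join of $G$ is a partition $(V_0,V_1,V_2)$ of $V(G)$ together with, for $i=1,2$, disjoint sets $A_i,B_i\subseteq V_i$ such that $V_0\cup A_1\cup A_2$ and $V_0\cup B_1\cup B_2$ are cliques, every edge of $G$ whose endpoints lie in two different sets among $V_0,V_1,V_2$ has both endpoints in $V_0\cup A_1\cup A_2$ or both in $V_0\cup B_1\cup B_2$, and neither $V_1$ nor $V_2$ is a stable set. *)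

(* Defs.v *)
From mathcomp Require Import all_boot.

Set Implicit Arguments.
Unset Strict Implicit.
Unset Printing Implicit Defensive.

(** * Graphs *)

Record graph (T : finType) := Graph {
  adj :> rel T;
  adj_sym : symmetric adj;
  adj_irrefl : irreflexive adj
}.

Section Graphs.
Variables (T : finType) (G : graph T).
Implicit Types (A B V K S : {set T}).

Definition edges : {set {set T}} :=
  [set [set p.1; p.2] | p in [pred p : T * T | G p.1 p.2]].

Definition num_edges : nat := #|edges|.

Definition max_degree : nat := \max_(x : T) #|[set y | G x y]|.

(* The null graph is not connected. *)
Definition connected : Prop := 0 < #|T| /\ forall x y : T, connect G x y.

Definition clique K : Prop := {in K &, forall x y, x != y -> G x y}.

Definition stable S : Prop := {in S &, forall x y, ~~ G x y}.

Definition anticomplete A B : Prop :=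
  forall x y, x \in A -> y \in B -> ~~ G x y.

Definition is_pseudo_1_join V1 V2 A1 A2 : Prop :=
  [/\ [disjoint V1 & V2] /\ V1 :|: V2 = [set: T],
      A1 \subset V1 /\ A2 \subset V2,
      clique (A1 :|: A2),
      anticomplete (V1 :\: A1) V2 /\ anticomplete (V2 :\: A2) V1
    & ~ stable V1 /\ ~ stable V2].

Definition has_pseudo_1_join : Prop :=
  exists V1 V2 A1 A2, is_pseudo_1_join V1 V2 A1 A2.

(* Any of V0, A1, A2, B1, B2 may be empty, so [finset.partition], which
   excludes empty blocks, does not apply. *)
Definition is_pseudo_2_join V0 V1 V2 A1 B1 A2 B2 : Prop :=
  [/\ [/\ [disjoint V0 & V1], [disjoint V0 & V2], [disjoint V1 & V2]
        & V0 :|: V1 :|: V2 = [set: T]],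
      [/\ A1 \subset V1, B1 \subset V1 & [disjoint A1 & B1]] /\
      [/\ A2 \subset V2, B2 \subset V2 & [disjoint A2 & B2]],
      clique (V0 :|: A1 :|: A2) /\ clique (V0 :|: B1 :|: B2),
      forall x y, G x y ->
        ~ [\/ x \in V0 /\ y \in V0, x \in V1 /\ y \in V1
            | x \in V2 /\ y \in V2] ->
        (x \in V0 :|: A1 :|: A2 /\ y \in V0 :|: A1 :|: A2) \/
        (x \in V0 :|: B1 :|: B2 /\ y \in V0 :|: B1 :|: B2)
    & ~ stable V1 /\ ~ stable V2].

Definition has_pseudo_2_join : Prop :=
  exists V0 V1 V2 A1 B1 A2 B2, is_pseudo_2_join V0 V1 V2 A1 B1 A2 B2.

End Graphs.

(** * The inverse Ackermann function *)

Fixpoint ackermann (i : nat) : nat -> nat :=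
  fix ack_i (j : nat) : nat :=
    match i, j with
    | 0, _ => j.+1
    | i'.+1, 0 => ackermann i' 1
    | i'.+1, j'.+1 => ackermann i' (ack_i j')
    end.

Lemma ackermann_gt (i j : nat) : i + j < ackermann i j.
Proof.
elim: i j => [|i IHi] j; first by case: j.
elim: j => [|j IHj]; first by have := IHi 1; rewrite addn1 addn0.
have := leq_ltn_trans (leq_addl i _) (IHi (ackermann i.+1 j)).
by rewrite addnS; apply: leq_ltn_trans.
Qed.

Lemma inv_ackermann_subproof (m n : nat) :
  exists i, (0 < i) && (n <= 2 ^ ackermann i (m %/ n)).
Proof.
exists n.+1; rewrite andTb; apply: (leq_trans (ltnW (ltn_expl n (ltnSn 1)))).
rewrite leq_exp2l //; apply: (leq_trans _ (ltnW (ackermann_gt _ _))).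
by rewrite addSn leqW // leq_addr.
Qed.

(* The least i >= 1 with A(i, floor(m / n)) >= log_2 n, where A is the
   Ackermann-Peter function. *)
Definition inv_ackermann (m n : nat) : nat :=
  ex_minn (inv_ackermann_subproof m n).

(** * Word RAM *)

(* A machine with w-bit words, finitely many registers per program, and a
   memory addressed by words. Programs are structured; every arithmetic
   operation, comparison, operand, memory access, assignment and branch costs
   one time unit. Arithmetic is modulo 2 ^ w, except that subtraction is
   truncated at 0; comparisons return 0 or 1; a test succeeds when its value is nonzero. *)

Inductive binop := Add | Sub | Mul | Eqb | Ltb.

Inductive expr :=
  | Cst of nat
  | Reg of nat
  | Read of expr
  | Op of binop & expr & expr.

Inductive cmd :=
  | Skip
  | Assign of nat & expr
  | Write of expr & expr
  | Seq of cmd & cmd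
  | If of expr & cmd & cmd
  | While of expr & cmd.

Record state := State { regs : nat -> nat; mem : nat -> nat }.

Definition set_reg (s : state) (r v : nat) : state :=
  State [eta regs s with r |-> v] (mem s).

Definition set_mem (s : state) (a v : nat) : state :=
  State (regs s) [eta mem s with a |-> v].

Definition eval_op (o : binop) (a b : nat) : nat :=
  match o with
  | Add => a + b
  | Sub => a - b
  | Mul => a * b
  | Eqb => (a == b) : nat
  | Ltb => (a < b) : nat
  end.

Fixpoint eval (w : nat) (s : state) (e : expr) : nat :=
  match e with
  | Cst c => c %% 2 ^ w
  | Reg r => regs s r
  | Read e1 => mem s (eval w s e1)
  | Op o e1 e2 => eval_op o (eval w s e1) (eval w s e2) %% 2 ^ w
  end.

Fixpoint cost (e : expr) : nat :=
  match e with
  | Cst _ | Reg _ => 1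
  | Read e1 => (cost e1).+1
  | Op _ e1 e2 => (cost e1 + cost e2).+1
  end.

(* [exec w c s t s']: started in state s, c halts in state s' after t time
   units. *)
Inductive exec (w : nat) : cmd -> state -> nat -> state -> Prop :=
  | exec_skip s : exec w Skip s 1 s
  | exec_assign s r e :
      exec w (Assign r e) s (cost e).+1 (set_reg s r (eval w s e))
  | exec_write s e1 e2 :
      exec w (Write e1 e2) s (cost e1 + cost e2).+1
        (set_mem s (eval w s e1) (eval w s e2))
  | exec_seq s s1 s2 c1 c2 t1 t2 :
      exec w c1 s t1 s1 -> exec w c2 s1 t2 s2 ->
      exec w (Seq c1 c2) s (t1 + t2) s2
  | exec_if_true s s1 e c1 c2 t :
      eval w s e != 0 -> exec w c1 s t s1 ->
      exec w (If e c1 c2) s ((cost e).+1 + t) s1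
  | exec_if_false s s1 e c1 c2 t :
      eval w s e = 0 -> exec w c2 s t s1 ->
      exec w (If e c1 c2) s ((cost e).+1 + t) s1
  | exec_while_true s s1 s2 e c t1 t2 :
      eval w s e != 0 -> exec w c s t1 s1 -> exec w (While e c) s1 t2 s2 ->
      exec w (While e c) s ((cost e).+1 + t1 + t2) s2
  | exec_while_false s e c :
      eval w s e = 0 -> exec w (While e c) s (cost e).+1 s.

(** * Input and output conventions *)

(* [l] lists every edge exactly once, in any order and with either endpoint
   first. *)
Definition edge_list (n : nat) (G : graph 'I_n) (l : seq ('I_n * 'I_n)) : Prop :=
  perm_eq [seq [set p.1; p.2] | p <- l] (enum (edges G)).

(* Registers 0 and 1 hold n and m, memory holds the endpoints of the edges
   consecutively from address 0; everything else is 0. *)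
Definition input_state (n : nat) (l : seq ('I_n * 'I_n)) : state :=
  State (nth 0 [:: n; size l])
        (nth 0 (flatten [seq [:: val p.1; val p.2] | p <- l])).

(* A pseudo-2-join is written as one label per vertex: 0 for V0; 1, 2, 3 for
   A1, B1 and the rest of V1; 4, 5, 6 for A2, B2 and the rest of V2. *)
Definition labels_pseudo_2_join (T : finType) (G : graph T) (lab : T -> nat) :
    Prop :=
  is_pseudo_2_join G
    [set v | lab v == 0]
    [set v | lab v \in [:: 1; 2; 3]] [set v | lab v \in [:: 4; 5; 6]]
    [set v | lab v == 1] [set v | lab v == 2]
    [set v | lab v == 4] [set v | lab v == 5].

(* Register 0 holds 1 if a pseudo-2-join is found, whose label array then
   starts at the address in register 1, and 0 if there is none. *)
Definition correct_output (n : nat) (G : graph 'I_n) (s : state) : Prop :=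
  (regs s 0 = 1 /\
   labels_pseudo_2_join G (fun v : 'I_n => mem s (regs s 1 + v))) \/
  (regs s 0 = 0 /\ ~ has_pseudo_2_join G).

(* Main.v *)
(** Write N[x] for the closed neighbourhood of x. If a in A1 and b in A2 then
N[a] and N[b] meet exactly in K = V0 :|: A1 :|: A2, and likewise an edge between
B1 and B2 determines L = V0 :|: B1 :|: B2. Without pseudo-1-joins, A1 and A2 are
nonempty and some such a and b are joined by a path avoiding the edges of K.
So fix an edge ab whose K is a clique, and take an induced path p_0, ..., p_len
from a to b in the graph without the edges of K. The path crosses from V1 to V2
exactly once, along some p_i p_(i+1), and then L = L_i, the intersection of
N[p_i] and N[p_(i+1)]. Moreover L_j avoids V1 for j > i and lies in V1 :|: V0
for j < i.
Hence a single sweep over i = 0, 1, ... tests all candidates: a growing set S is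
closed at stage i under the edges outside K and L_i, and remains inside the V1
of every join crossed at stage i or later. If S meets no L_j with j > i, then it
can serve as V1 as soon as K and L_i are cliques, p_i and p_(i+1) are outside K,
and every vertex of K :&: L_i is outside S and has closed neighbourhood K :|: L_i.
Each vertex is scanned once per edge ab, so the total time is O(n m Delta). *)

Require Import Defs.
From mathcomp Require Import all_boot zify.

Set Implicit Arguments.
Unset Strict Implicit.
Unset Printing Implicit Defensive.

(** * Cliques spanned by edges and pseudo-2-joins *)

Section CliqueCuts.
Variables (T : finType) (G : graph T).

Definition cl (x y : T) : bool := (x == y) || G x y.
Definition nbhd (x : T) : {set T} := [set y | cl y x].
Definition K (u v : T) : {set T} := [set x | cl x u && cl x v].
Definition good (u v : T) : bool := [forall x in K u v, forall y in K u v, cl x y].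
Definition gk (a b x y : T) : bool :=
  cl x y && ~~ ((x \in K a b) && (y \in K a b)).

Lemma cl_refl x : cl x x. Proof. by rewrite /cl eqxx. Qed.
Lemma cl_sym x y : cl x y = cl y x.
Proof. by rewrite /cl eq_sym adj_sym. Qed.
Lemma gk_sym a b x y : gk a b x y = gk a b y x.
Proof. by rewrite /gk cl_sym andbC [in RHS]andbC [(x \in _) && _]andbC. Qed.
Lemma K_sym u v : K u v = K v u.
Proof. by apply/setP => x; rewrite !inE andbC. Qed.

Lemma good_sym u v : good u v = good v u.
Proof. by rewrite /good K_sym. Qed.

Lemma goodP u v : reflect (forall x y, x \in K u v -> y \in K u v -> cl x y) (good u v).
Proof.
apply: (iffP forallP) => [H x y xK yK|H x].
  by have /implyP/(_ xK)/forallP/(_ y)/implyP/(_ yK) := H x.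
by apply/implyP => xK; apply/forallP => y; apply/implyP; apply: H.
Qed.

Lemma good_clique u v : good u v -> clique G (K u v).
Proof. by move/goodP=> H x y xK yK xy; have := H x y xK yK; rewrite /cl (negPf xy). Qed.

Lemma pseudo_2_join_swap V0 V1 V2 A1 B1 A2 B2 :
  is_pseudo_2_join G V0 V1 V2 A1 B1 A2 B2 ->
  is_pseudo_2_join G V0 V2 V1 A2 B2 A1 B1.
Proof.
case=> [[d1 d2 d3 dU]] [sA sB] [cA cB] cr [n1 n2]; split=> //.
- by split=> //; [rewrite disjoint_sym | rewrite setUAC].
- by rewrite setUAC [_ :|: B2 :|: B1]setUAC.
- move=> x y xy Hn; rewrite ![V0 :|: A2 :|: A1]setUAC ![V0 :|: B2 :|: B1]setUAC.
  by apply: cr => // -[] H; apply: Hn; [apply: Or31|apply: Or33|apply: Or32].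
Qed.

Section Chordless.
Variables (a b : T) (p : nat -> T) (len : nat).

Definition L i := K (p i) (p i.+1).

Definition chordless :=
  [/\ p 0 = a, p len = b, forall i, i < len -> gk a b (p i) (p i.+1),
      forall i, i < len -> G (p i) (p i.+1)
    & forall i j, i.+1 < j -> j <= len -> ~~ gk a b (p i) (p j)].

(* When K and L_i are cliques, the inequality forces N[x] = K :|: L_i. *)
Definition hub_ok i := forall x, x \in K a b -> x \in L i ->
   #|nbhd x| <= #|K a b :|: L i|.

(* The conditions under which [S] is V1 of a pseudo-2-join crossed by the edge
   p_i p_(i+1). *)
Definition accepts i (S : {set T}) :=
  [/\ [/\ i < len, good a b, good (p i) (p i.+1), p i \notin K a b & p i.+1 \notin K a b],
      (forall j, j <= i -> p j \in S),
      (forall x j, x \in S -> i < j -> j < len -> x \notin L j),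
      (forall x, x \in K a b -> x \in L i -> x \notin S) /\ hub_ok i
    & forall x y, y \in S -> gk a b x y ->
        x \in S \/ x \in L i /\ (x \in K a b \/ y \in L i)].

Lemma accepts_pseudo_2_join i S : G a b -> chordless -> accepts i S ->
  let V0 := K a b :&: L i in let V2 := ~: (S :|: V0) in
  is_pseudo_2_join G V0 S V2 (S :&: K a b) (S :&: L i) (V2 :&: K a b) (V2 :&: L i).
Proof.
move=> Gab [p0 pl pg pe pc] [[il gab gi piK pi1K] pS SL [SV0 hub] Scl] V0 V2.
have aK : a \in K a b by rewrite inE cl_refl /cl Gab orbT.
have bK : b \in K a b by rewrite inE cl_refl /cl adj_sym Gab orbT.
have i0 : 0 < i by case: i piK {il gi pi1K pS SL SV0 hub Scl V0 V2} => //; rewrite p0 aK.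
have i1 : i.+1 < len.
  by rewrite ltn_neqAle il andbT; apply/eqP => e; rewrite e pl bK in pi1K.
have L1 : p i.+1 \in L i.+1.
  by rewrite inE cl_refl /cl (pe _ i1) orbT.
have L2 : p i.+2 \in L i.+1.
  by rewrite inE cl_refl /cl adj_sym (pe _ i1) orbT.
have hubE x : x \in V0 -> nbhd x = K a b :|: L i.
  move=> /setIP [xK xL]; apply/eqP; rewrite eq_sym eqEcard hub // andbT.
  apply/subsetP => y; rewrite in_setU => /orP[] yI; rewrite inE.
    exact: (elimT (goodP _ _) gab).
  exact: (elimT (goodP _ _) gi).
have VK : V0 :|: S :&: K a b :|: V2 :&: K a b = K a b.
  apply/setP => x; rewrite /V2 /V0 !in_setU !in_setI in_setC !in_setU in_setI.
  by case: (x \in K a b); case: (x \in L i); case: (x \in S).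
have VL : V0 :|: S :&: L i :|: V2 :&: L i = L i.
  apply/setP => x; rewrite /V2 /V0 !in_setU !in_setI in_setC !in_setU in_setI.
  by case: (x \in K a b); case: (x \in L i); case: (x \in S).
have key x y : G x y -> x \in V0 \/ x \in S /\ y \in V2 ->
    (x \in K a b /\ y \in K a b) \/ (x \in L i /\ y \in L i).
  move=> xy [xV|[xS yV]].
    have /setIP[xK xL] := xV.
    have : y \in nbhd x by rewrite inE /cl adj_sym xy orbT.
    by rewrite hubE // in_setU => /orP[] yI; [left|right].
  have [|/negP ng] := boolP (gk a b y x).
    move: yV; rewrite inE in_setU in_setI => /norP[/negPf ySn yV] /(Scl _ _ xS).
    rewrite ySn => -[] // [yL [yK|xL]]; last by right.
    by rewrite yL yK in yV.
  by move: ng; rewrite /gk /cl adj_sym xy orbT /= => /negP/negPn/andP[? ?]; left.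
split.
- split.
  + by rewrite disjoints_subset; apply/subsetP => x /setIP[xK xL]; rewrite inE SV0.
  + by rewrite disjoints_subset; apply/subsetP => x xV; rewrite !in_setC in_setU xV orbT.
  + by rewrite disjoints_subset; apply/subsetP => x xV; rewrite !in_setC in_setU xV.
  + by rewrite [V0 :|: S]setUC setUCr.
- split; split; rewrite ?subsetIl //.
    rewrite disjoints_subset; apply/subsetP => x /setIP[xS xK]; rewrite inE in_setI xS /=.
    by apply/negP => xL; have := SV0 _ xK xL; rewrite xS.
  rewrite disjoints_subset; apply/subsetP => x /setIP[xV xK]; rewrite inE in_setI xV /=.
  by apply/negP => xL; move: xV; rewrite inE in_setU in_setI xK xL orbT.
- by rewrite VK VL; split; apply: good_clique.
- move=> x y xy Hn; rewrite VK VL.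
  have Vc z : [\/ z \in V0, z \in S | z \in V2].
    rewrite /V2 in_setC in_setU.
    by case zV: (z \in V0); [apply: Or31|case zS: (z \in S); [apply: Or32|apply: Or33]].
  have yx : G y x by rewrite adj_sym.
  have key' : (y \in K a b /\ x \in K a b) \/ (y \in L i /\ x \in L i) ->
     (x \in K a b /\ y \in K a b) \/ (x \in L i /\ y \in L i).
    by case=> -[? ?]; [left|right].
  case: (Vc x) => xV; first by apply: key => //; left.
    case: (Vc y) => yV; first by apply/key'/key => //; left.
      by case: Hn; apply: Or32.
    by apply: key => //; right.
  case: (Vc y) => yV; first by apply/key'/key => //; left.
    by apply/key'/key => //; right.
  by case: Hn; apply: Or33.
split=> st.
  have e : i.-1.+1 = i by rewrite prednK.
  have := st (p i.-1) (p i.-1.+1).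
  by rewrite pe ?e ?(ltnW il) // !pS ?leq_pred // => /(_ isT isT).
have := st (p i.+1) (p i.+2); rewrite /V2 !in_setC !in_setU !in_setI (negPf pi1K) /= pe // orbF.
have n1 : p i.+1 \notin S by apply/negP => H; have := SL _ _ H (ltnSn i) i1; rewrite L1.
have n2 : p i.+2 \notin S by apply/negP => H; have := SL _ _ H (ltnSn i) i1; rewrite L2.
have n3 : p i.+2 \notin L i.
  apply/negP; rewrite inE => /andP[H _].
  have := pc i i.+2 (ltnSn _) i1; rewrite /gk cl_sym H /=.
  by rewrite (negPf piK).
by rewrite (negPf n1) (negPf n2) (negPf n3) andbF => /(_ isT isT).
Qed.

(* What remains of a pseudo-2-join with V1 = [V] whose crossing edge is
   p_i p_(i+1): enough to keep the swept set inside [V] up to stage [i], and to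
   make the test succeed there. *)
Definition sep i (V : {set T}) :=
  [/\ [/\ i < len, good (p i) (p i.+1), p i \notin K a b & p i.+1 \notin K a b],
      (forall j, j <= i -> p j \in V) /\
      (forall j x, j < i -> x \in L j -> ~~ ((x \in K a b) && (x \in L j.+1)) -> x \in V),
      (forall x j, x \in V -> i < j -> j < len -> x \notin L j),
      (forall x, x \in K a b -> x \in L i -> x \notin V) /\ hub_ok i
    & forall x y, y \in V -> gk a b x y -> x \in V \/ x \in L i /\ y \in L i].

End Chordless.

Section JoinParts.
Variables V0 V1 V2 A1 B1 A2 B2 : {set T}.
Hypothesis J : is_pseudo_2_join G V0 V1 V2 A1 B1 A2 B2.

Lemma join_cover x : [\/ x \in V0, x \in V1 | x \in V2].
Proof.
case: J => -[_ _ _ dU] _ _ _ _; have : x \in [set: T] by rewrite inE.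
by rewrite -dU !in_setU -orbA => /or3P.
Qed.

Lemma join_disj01 x : x \in V0 -> x \in V1 -> False.
Proof. by case: J => -[d _ _ _] _ _ _ _ x0; rewrite (disjointFr d x0). Qed.
Lemma join_disj02 x : x \in V0 -> x \in V2 -> False.
Proof. by case: J => -[_ d _ _] _ _ _ _ x0; rewrite (disjointFr d x0). Qed.
Lemma join_disj12 x : x \in V1 -> x \in V2 -> False.
Proof. by case: J => -[_ _ d _] _ _ _ _ x0; rewrite (disjointFr d x0). Qed.
Lemma join_disjA x : x \in A1 -> x \in B1 -> False.
Proof. by case: J => _ [[_ _ d] _] _ _ _ x0; rewrite (disjointFr d x0). Qed.
Lemma join_subA x : x \in A1 -> x \in V1.
Proof. by case: J => _ [[/subsetP H _ _] _] _ _ _ /H. Qed.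
Lemma join_subB x : x \in B1 -> x \in V1.
Proof. by case: J => _ [[_ /subsetP H _] _] _ _ _ /H. Qed.

Lemma join_clA x y : x \in V0 :|: A1 :|: A2 -> y \in V0 :|: A1 :|: A2 -> cl x y.
Proof.
case: J => _ _ [c _] _ _ xI yI; rewrite /cl.
by case: eqVneq => //= xy; apply: c.
Qed.

End JoinParts.

Lemma pseudo_2_join_flip V0 V1 V2 A1 B1 A2 B2 :
  is_pseudo_2_join G V0 V1 V2 A1 B1 A2 B2 ->
  is_pseudo_2_join G V0 V1 V2 B1 A1 B2 A2.
Proof.
case=> [d [[a1 a2 a3] [b1 b2 b3]] [cA cB] cr n]; split=> //.
- by split; split=> //; rewrite disjoint_sym.
- by move=> x y xy Hn; case: (cr x y xy Hn); [right|left].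
Qed.

Section JoinCrossing.
Variables V0 V1 V2 A1 B1 A2 B2 : {set T}.
Hypothesis J : is_pseudo_2_join G V0 V1 V2 A1 B1 A2 B2.
Let J' := pseudo_2_join_swap J.
Let JB := pseudo_2_join_flip J.
Let JB' := pseudo_2_join_swap JB.

Lemma join_cross12 x y : x \in V1 -> y \in V2 -> G x y ->
  (x \in A1 /\ y \in A2) \/ (x \in B1 /\ y \in B2).
Proof.
move=> x1 y2 xy; case: (J) => _ _ _ cr _.
have x0 : x \in V0 = false by apply/negP => /(join_disj01 J); apply.
have y0 : y \in V0 = false by apply/negP => /(join_disj02 J); apply.
have xA : x \in A2 = false by apply/negP => /(join_subA J') /(join_disj12 J x1).
have xB : x \in B2 = false by apply/negP => /(join_subB J') /(join_disj12 J x1).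
have yA : y \in A1 = false by apply/negP => /(join_subA J) /(join_disj12 J); apply.
have yB : y \in B1 = false by apply/negP => /(join_subB J) /(join_disj12 J); apply.
case: (cr x y xy).
- move=> [] [] p q; first by rewrite p in x0.
    exact: (join_disj12 J q y2).
  exact: (join_disj12 J x1 p).
- by rewrite !in_setU x0 y0 xA yA /= orbF => -[]; left.
- by rewrite !in_setU x0 y0 xB yB /= orbF => -[]; right.
Qed.

Lemma join_cross01 x y : x \in V0 -> y \in V1 -> G x y -> y \in A1 \/ y \in B1.
Proof.
move=> x0 y1 xy; case: (J) => _ _ _ cr _.
have y0 : y \in V0 = false by apply/negP => /(join_disj01 J); apply.
have yA : y \in A2 = false by apply/negP => /(join_subA J') /(join_disj12 J y1).
have yB : y \in B2 = false by apply/negP => /(join_subB J') /(join_disj12 J y1).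
case: (cr x y xy).
- move=> [] [] p q; first by rewrite q in y0.
    by case: (join_disj01 J x0 p).
  by case: (join_disj02 J x0 p).
- by rewrite !in_setU y0 yA /= orbF => -[]; left.
- by rewrite !in_setU y0 yB /= orbF => -[]; right.
Qed.

End JoinCrossing.

Section JoinCliques.
Variables V0 V1 V2 A1 B1 A2 B2 : {set T}.
Hypothesis J : is_pseudo_2_join G V0 V1 V2 A1 B1 A2 B2.
Let J' := pseudo_2_join_swap J.
Let JB := pseudo_2_join_flip J.

Lemma cl_neq x y : cl x y -> x != y -> G x y.
Proof. by rewrite /cl => /orP[->|]. Qed.

Lemma join_K a b : a \in A1 -> b \in A2 -> K a b = V0 :|: A1 :|: A2.
Proof.
move=> aA bA; apply/setP => x; apply/idP/idP => [|xI]; last first.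
  by rewrite inE !(join_clA J) // !in_setU ?aA ?bA ?orbT.
have a1 := join_subA J aA; have b2 := join_subA J' bA.
rewrite inE => /andP[xa xb]; rewrite !in_setU.
case: (join_cover J x) => xV; first by rewrite xV.
  case: (join_cross12 J xV b2) => [|[-> _]|[_ bB]]; rewrite ?orbT //.
    by apply: (cl_neq xb); apply/eqP => e; apply: (join_disj12 J xV); rewrite e.
  by case: (join_disjA J' bA bB).
case: (join_cross12 J a1 xV) => [|[_ ->]|[aB _]]; rewrite ?orbT //.
  by rewrite adj_sym; apply: (cl_neq xa); apply/eqP => e; apply: (join_disj12 J _ xV); rewrite e.
by case: (join_disjA J aA aB).
Qed.

Lemma join_good a b : a \in A1 -> b \in A2 -> good a b.
Proof. by move=> aA bA; apply/goodP => x y; rewrite (join_K aA bA); apply: (join_clA J). Qed.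

End JoinCliques.

Section Separation.
Variables V0 V1 V2 A1 B1 A2 B2 : {set T}.
Hypothesis J : is_pseudo_2_join G V0 V1 V2 A1 B1 A2 B2.
Let J' := pseudo_2_join_swap J.
Let JB := pseudo_2_join_flip J.
Let JB' := pseudo_2_join_swap JB.
Variables (a b : T) (p : nat -> T) (len : nat).
Hypotheses (aA : a \in A1) (bA : b \in A2) (P : chordless a b p len).

Let KE := join_K J aA bA.
Lemma in_K x : (x \in K a b) = [|| x \in V0, x \in A1 | x \in A2].
Proof. by rewrite KE !in_setU orbA. Qed.

Lemma B1_notK x : x \in B1 -> x \notin K a b.
Proof.
move=> xB; have x1 := join_subB J xB; rewrite in_K; apply/or3P => -[] xI.
- exact: (join_disj01 J xI x1).
- exact: (join_disjA J xI xB).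
- exact: (join_disj12 J x1 (join_subA J' xI)).
Qed.
Lemma B2_notK x : x \in B2 -> x \notin K a b.
Proof.
move=> xB; have x1 := join_subB J' xB; rewrite in_K; apply/or3P => -[] xI.
- exact: (join_disj02 J xI x1).
- exact: (join_disj12 J (join_subA J xI) x1).
- exact: (join_disjA J' xI xB).
Qed.

Lemma cl_B x y : x \in V0 :|: B1 :|: B2 -> y \in V0 :|: B1 :|: B2 -> cl x y.
Proof. exact: (join_clA JB). Qed.

Lemma gk_neq x y : gk a b x y -> x != y -> G x y.
Proof. by case/andP=> H _; apply: cl_neq. Qed.

Lemma gk_cross x y : x \in V1 -> y \in V2 -> gk a b x y -> x \in B1 /\ y \in B2.
Proof.
move=> x1 y2 g; have xy : x != y.
  by apply/eqP => e; apply: (join_disj12 J x1); rewrite e.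
case: (join_cross12 J x1 y2 (gk_neq g xy)) => // -[xA yA].
by case/andP: g => _; rewrite !in_K xA yA !orbT.
Qed.

Lemma gk_hub x y : x \in V0 -> gk a b x y -> x != y -> y \in B1 :|: B2.
Proof.
move=> x0 g xy; have e := gk_neq g xy; rewrite in_setU.
have yK : y \notin K a b.
  by move/andP: g => [_]; rewrite in_K x0.
move: yK; rewrite in_K => /norP[y0 /norP[/negPf yA /negPf yA']].
case: (join_cover J y) => yV; first by rewrite yV in y0.
  by case: (join_cross01 J x0 yV e) => yB; rewrite yB ?orbT // in yA *.
by case: (join_cross01 J' x0 yV e) => yB; rewrite yB ?orbT // in yA' *.
Qed.

Lemma B_notK x : x \in B1 :|: B2 -> x \notin K a b.
Proof. by rewrite in_setU => /orP[/B1_notK|/B2_notK]. Qed.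

Lemma path_notV0 i : i <= len -> p i \notin V0.
Proof.
case: (P) => p0 pl pg pe pc il; apply/negP => iV.
have i0 : 0 < i.
  by case: (i) iV => // H; case: (join_disj01 J H); rewrite p0; apply: (join_subA J aA).
have i1 : i < len.
  rewrite ltn_neqAle il andbT; apply/eqP => e; apply: (join_disj02 J iV).
  by rewrite e pl; apply: (join_subA J' bA).
have h := pe i i1; have ne : p i != p i.+1.
  by apply/eqP => e; rewrite -e adj_irrefl in h.
have il' : i.-1 < len by rewrite prednK.
have h' := pe _ il'; have ne' : p i != p i.-1.
  by apply/eqP => e; rewrite prednK // e adj_irrefl in h'.
have q : p i.+1 \in B1 :|: B2 by apply: gk_hub iV (pg _ i1) ne.
have q' : p i.-1 \in B1 :|: B2.
  by apply: gk_hub iV _ ne'; rewrite gk_sym; have := pg _ il'; rewrite prednK.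
have := pc i.-1 i.+1; rewrite prednK // ltnSn => /(_ isT i1).
by rewrite /gk (negPf (B_notK q)) andbF andbT cl_B // -setUA in_setU ?q ?q' orbT.
Qed.

Lemma sep_exists : exists i V, sep a b p len i V.
Proof.
case: (P) => p0 pl pg pe pc.
have exk : exists k, (k <= len) && (p k \in V2).
  by exists len; rewrite leqnn pl (join_subA J').
case: (ex_minnP exk) => k /andP[kl kV] kmin.
have side j : j <= len -> p j \in V1 \/ p j \in V2.
  by move=> /path_notV0 /negPf jl; case: (join_cover J (p j)); rewrite ?jl; auto.
have k0 : 0 < k.
  case: (k) kV => // H; case: (join_disj12 J _ H).
  by rewrite p0 (join_subA J).
have kk : k.-1.+1 = k by rewrite prednK.
pose i := k.-1; rewrite -kk -/i in kl kV kmin.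
have iV : p i \in V1.
  case: (side i (ltnW kl)) => // H; have := kmin i.
  by rewrite H (ltnW kl) ltnn => /(_ isT).
have [iB i1B] := gk_cross iV kV (pg _ kl).
have iK := B1_notK iB; have i1K := B2_notK i1B.
have LE : L p i = V0 :|: B1 :|: B2 by rewrite /L (join_K JB iB i1B).
have pB j : j <= len -> p j \in B1 :|: B2 -> j = i \/ j = i.+1.
  move=> jl jB; case: (ltngtP j i) => ji; [|case: (ltngtP i.+1 j) => ij|by left].
  - have := pc j i.+1 ji kl; rewrite /gk (negPf i1K) andbF andbT cl_B // -setUA !in_setU ?i1B ?orbT //.
    by rewrite in_setU in jB; rewrite jB orbT.
  - have := pc i j ij jl; rewrite /gk (negPf iK) /= andbT cl_B // -setUA !in_setU ?iB ?orbT //.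
    by rewrite in_setU in jB; rewrite jB orbT.
  - by move: ij; rewrite ltnS leqNgt ji.
  - by right.
have inB1 x : x \in B1 -> x \in B1 :|: B2 by move=> H; rewrite in_setU H.
have inB2 x : x \in B2 -> x \in B1 :|: B2 by move=> H; rewrite in_setU H orbT.
have pV1 j : j <= i -> p j \in V1.
  move=> ji; rewrite -(subKn ji); move: (i - j) (leq_subr j i) => {j ji}.
  elim=> [|d IH] di; first by rewrite subn0.
  move: (IH (ltnW di)); rewrite -(subnSK di).
  have jl : (i - d.+1).+1 <= len by rewrite subnSK // (leq_trans (leq_subr _ _)) // ltnW.
  have ji : i - d.+1 < i by rewrite subnSK // leq_subr.
  move: (i - d.+1) jl ji => j jl ji H1; case: (side j (ltnW jl)) => // H2.
  have := pg _ jl; rewrite gk_sym => /(gk_cross H1 H2)[_ /inB2 /(pB _ (ltnW jl))].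
  by case=> E; move: ji; rewrite E ?ltnn // ltnNge leqnSn.
have pV2 j : i < j -> j <= len -> p j \in V2.
  elim: j => // j IH; rewrite ltnS leq_eqVlt => /orP[/eqP <- //|ij] jl.
  case: (side _ jl) => // H; have := pg _ jl; rewrite gk_sym.
  move=> /(gk_cross H (IH ij (ltnW jl)))[/inB1 /(pB _ jl) E _].
  by case: E => [E|[E]]; move: ij; rewrite -E ?ltnn // ltnNge leqnSn.
have VneqG x y : x \in V1 -> y \notin V1 -> cl x y -> G x y.
  by move=> x1 y1 c; apply: (cl_neq c); apply: contraNneq y1 => <-.
exists i, V1; split.
- split=> //; exact: (join_good JB).
- split=> // j x ji xL nths.
  have jl : j < len by apply: ltn_trans ji kl.
  have pj := pV1 j (ltnW ji); have pj1 := pV1 j.+1 ji.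
  have nB : p j \notin B1.
    apply/negP => /inB1 /(pB _ (ltnW jl)) E.
    by case: E => E; move: ji; rewrite E ?ltnn // ltnNge leqnSn.
  have nK : ~ (p j \in A1 /\ p j.+1 \in A1).
    move=> [u v]; have := pg _ jl.
    by rewrite /gk !in_K u v !orbT andbF.
  move: xL; rewrite inE => /andP[c c1].
  case: (join_cover J x) => // xV.
    have x1 : x \notin V1 by apply/negP => /(join_disj01 J xV).
    rewrite cl_sym in c; rewrite cl_sym in c1.
    have := VneqG _ _ pj x1 c; rewrite adj_sym => e.
    have := VneqG _ _ pj1 x1 c1; rewrite adj_sym => e1.
    case: (join_cross01 J xV pj e) => [pA|]; last by rewrite (negPf nB).
    case: (join_cross01 J xV pj1 e1) => [pA1|pB1]; first by case: nK.
    have E : j.+1 = i.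
      case: (pB _ jl (inB1 _ pB1)) => // -[E].
      by rewrite E ltnn in ji.
    by case/negP: nths; rewrite E LE in_K !in_setU xV.
  have x1 : x \notin V1 by apply/negP => H; apply: (join_disj12 J H xV).
  rewrite cl_sym in c; rewrite cl_sym in c1.
  have e := VneqG _ _ pj x1 c; have e1 := VneqG _ _ pj1 x1 c1.
  case: (join_cross12 J pj xV e) => [[pA xA]|[H]]; last by rewrite H in nB.
  case: (join_cross12 J pj1 xV e1) => [[pA1 _]|[_ xB]]; first by case: nK.
  by case: (join_disjA J' xA xB).
- move=> x j x1 ij jl; apply/negP; rewrite inE => /andP[c c1].
  have nths z : z \in V2 -> z \notin V1 by move=> z2; apply/negP => z1; apply: (join_disj12 J z1 z2).
  have q := pV2 _ ij (ltnW jl); have q1 := pV2 j.+1 (ltnW ij) jl.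
  have e := VneqG _ _ x1 (nths _ q) c; have e1 := VneqG _ _ x1 (nths _ q1) c1.
  case: (join_cross12 J x1 q1 e1) => [[xA pA1]|[_ /inB2 /(pB _ jl)]].
    case: (join_cross12 J x1 q e) => [[_ pA]|[xB _]]; last by apply: (join_disjA J xA xB).
    by have := pg _ jl; rewrite /gk !in_K pA pA1 !orbT andbF.
  by case=> [E|[E]]; move: ij; rewrite -E ?ltnn // ltnNge leqnSn.
- have LV0 x : x \in K a b -> x \in L p i -> x \in V0.
    rewrite LE !in_setU => xK /orP[/orP[]|] //.
      by move/B1_notK; rewrite xK.
    by move/B2_notK; rewrite xK.
  split=> x xK xL; have x0 := LV0 x xK xL.
    by apply/negP; apply: (join_disj01 J x0).
  apply: subset_leq_card; apply/subsetP => y; rewrite inE in_setU => c.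
  have [->|yx] := eqVneq y x; first by rewrite xK.
  have e : G x y by rewrite adj_sym; apply: (cl_neq c).
  case: (join_cover J y) => yV; first by rewrite in_K yV.
    by case: (join_cross01 J x0 yV e) => H; rewrite LE in_K !in_setU H !orbT.
  by case: (join_cross01 J' x0 yV e) => H; rewrite LE in_K !in_setU H !orbT.
- move=> x y y1 g; case: (join_cover J x) => xV; [right|by left|right].
    have xy : x != y by apply/eqP => E; apply: (join_disj01 J xV); rewrite E.
    have := gk_hub xV g xy; rewrite LE !in_setU xV => /orP[->|/(join_subB J')]; first by rewrite orbT.
    by move/(join_disj12 J y1).
  rewrite gk_sym in g; have [yB xB] := gk_cross y1 xV g.
  by rewrite LE !in_setU yB xB !orbT.
Qed.
End Separation.

Lemma stableP S : reflect (stable G S) [forall x in S, forall y in S, ~~ G x y].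
Proof.
apply: (iffP forallP) => [H x y xK yK|H x].
  by have /implyP/(_ xK)/forallP/(_ y)/implyP/(_ yK) := H x.
by apply/implyP => xK; apply/forallP => y; apply/implyP; apply: H.
Qed.

Lemma pseudo_1_joinI (W Q : {set T}) :
  (forall x y, x \in Q -> y \in Q -> cl x y) ->
  (forall x y, x \in W -> y \notin W -> G x y -> x \in Q /\ y \in Q) ->
  ~ stable G W -> ~ stable G (~: W) -> has_pseudo_1_join G.
Proof.
move=> cQ cr n1 n2; exists W, (~: W), (W :&: Q), (~: W :&: Q); split=> //.
- by rewrite setUCr disjoints_subset setCK.
- by rewrite !subsetIl.
- move=> x y; rewrite -setIUl setUCr setTI => xQ yQ xy.
  exact: cl_neq (cQ _ _ xQ yQ) xy.
- split=> x y; rewrite in_setD in_setI negb_and in_setC.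
    by case xW: (x \in W); rewrite ?andbF //= andbT => xQ yW; apply: contra xQ => /(cr _ _ xW yW)[].
  move=> xQ yW; apply/negP => xy.
  case/andP: xQ => xQ xW; rewrite xW /= in xQ.
  by move: xy xQ; rewrite adj_sym => /(cr _ _ yW xW)[_ ->].
Qed.

Lemma edge_not_stable (S : {set T}) : ~ stable G S -> exists x y, [/\ x \in S, y \in S & G x y].
Proof.
move/stableP; rewrite negb_forall => /existsP[x]; rewrite negb_imply => /andP[xS].
rewrite negb_forall => /existsP[y]; rewrite negb_imply negbK => /andP[yS xy].
by exists x, y.
Qed.

Lemma subset_not_stable (S S' : {set T}) : S \subset S' -> ~ stable G S -> ~ stable G S'.
Proof. by move=> /subsetP sub ns st; apply: ns => x y /sub xS /sub; apply: st. Qed.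

Lemma join_isolated V0 V1 V2 A1 B1 A2 B2 a :
  is_pseudo_2_join G V0 V1 V2 A1 B1 A2 B2 -> a \in A1 ->
  (forall x, x \in V1 -> ~~ G a x) -> has_pseudo_1_join G.
Proof.
move=> J aA ni; have J' := pseudo_2_join_swap J; have JB := pseudo_2_join_flip J.
have nA x : x \in A1 -> x != a -> False.
  move=> xA xa; have := ni x (join_subA J xA); rewrite adj_sym.
  by rewrite (cl_neq _ xa) // (join_clA J) // !in_setU ?aA ?xA ?orbT.
apply: (@pseudo_1_joinI (V1 :\ a) (V0 :|: B1 :|: B2)); first exact: (join_clA JB).
- move=> x y; rewrite !in_setD1 => /andP[xa x1] y1 xy; rewrite !in_setU.
  case: (join_cover J y) => yV.
  + case: (join_cross01 J yV x1); rewrite 1?adj_sym // => xI; first by case: (nA _ xI xa).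
    by rewrite yV xI orbT.
  + have /eqP ya : y == a by rewrite yV andbT negbK in y1.
    by have := ni x x1; rewrite adj_sym -ya xy.
  + case: (join_cross12 J x1 yV xy) => -[xI yI]; first by case: (nA _ xI xa).
    by rewrite xI yI !orbT.
- case: (J) => _ _ _ _ [n1 _]; have [x [y [xV yV xy]]] := edge_not_stable n1 => st.
  have xa : x != a by apply: contraL xy => /eqP->; apply: ni.
  have ya : y != a by rewrite adj_sym in xy; apply: contraL xy => /eqP->; apply: ni.
  by have := st x y; rewrite !in_setD1 xa ya xV yV xy => /(_ isT isT).
case: (J) => _ _ _ _ [_]; apply: subset_not_stable; apply/subsetP => x x2.
by rewrite inE in_setD1 negb_and; apply/orP; right; apply/negP => /(join_disj12 J); apply.
Qed.

Lemma join_noA V0 V1 V2 A1 B1 A2 B2 :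
  is_pseudo_2_join G V0 V1 V2 A1 B1 A2 B2 -> A2 = set0 -> has_pseudo_1_join G.
Proof.
move=> J A20; have J' := pseudo_2_join_swap J; have JB := pseudo_2_join_flip J.
apply: (@pseudo_1_joinI V2 (V0 :|: B1 :|: B2)); first exact: (join_clA JB).
- move=> x y x2 y2 xy; rewrite !in_setU; case: (join_cover J y) => yV.
  + case: (join_cross01 J' yV x2); rewrite 1?adj_sym // ?A20 ?inE // => xI.
    by rewrite yV xI !orbT.
  + case: (join_cross12 J' x2 yV xy) => -[xI yI]; first by rewrite A20 inE in xI.
    by rewrite xI yI !orbT.
  + by rewrite yV in y2.
- by case: (J) => _ _ _ _ [].
case: (J) => _ _ _ _ [+ _]; apply: subset_not_stable; apply/subsetP => x x2.
by rewrite inE; apply/negP => /(join_disj12 J x2).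
Qed.

Lemma join_edge V0 V1 V2 A1 B1 A2 B2 :
  ~ has_pseudo_1_join G -> is_pseudo_2_join G V0 V1 V2 A1 B1 A2 B2 ->
  exists a b, [/\ a \in A1, b \in A2, G a b & connect (gk a b) b a].
Proof.
move=> no1 J; have J' := pseudo_2_join_swap J.
have [A10|/set0Pn[a aA]] := eqVneq A1 set0; first by case: no1; apply: join_noA J' A10.
have [A20|/set0Pn[b bA]] := eqVneq A2 set0; first by case: no1; apply: join_noA J A20.
have gE a' b' : a' \in A1 -> b' \in A2 -> gk a' b' =2 gk a b.
  by move=> aA' bA' x y; rewrite /gk (join_K J aA bA) (join_K J aA' bA').
have symc : connect_sym (gk a b).
  by apply: sym_connect_sym => x y; rewrite gk_sym.
have [/existsP[a' /andP[aA' /existsP[b' /andP[bA' c]]]]|no] :=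
    boolP [exists a' in A1, exists b' in A2, connect (gk a b) b' a'].
  exists a', b'; split=> //; last by rewrite (eq_connect (gE _ _ aA' bA')).
  apply: cl_neq; first by rewrite (join_clA J) // !in_setU ?aA' ?bA' ?orbT.
  by apply/eqP => e; apply: (join_disj12 J (join_subA J aA')); rewrite e (join_subA J').
have nc a' b' : a' \in A1 -> b' \in A2 -> ~~ connect (gk a b) a' b'.
  move=> aA' bA'; rewrite symc; apply: contra no => c.
  by apply/existsP; exists a'; rewrite aA'; apply/existsP; exists b'; rewrite bA'.
pose S := [set x | [exists a' in A1, connect (gk a b) a' x]].
have SP x y : x \in S -> gk a b x y -> y \in S.
  rewrite !inE => /existsP[a' /andP[aA' c]] g; apply/existsP; exists a'; rewrite aA' /=.
  exact: connect_trans c (connect1 g).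
have SA x : x \in A1 -> x \in S.
  by move=> xA; rewrite inE; apply/existsP; exists x; rewrite xA connect0.
have nSA x : x \in A2 -> x \notin S.
  move=> xA; rewrite inE; apply/negP => /existsP[a' /andP[aA' c]].
  by have := nc _ _ aA' xA; rewrite c.
have inK x : (x \in K a b) = [|| x \in V0, x \in A1 | x \in A2] by rewrite (in_K J aA bA).
case: no1; have [st|ns] := stableP S.
  apply: (join_isolated J aA) => x x1; apply/negP => ax.
  have [xK|xK] := boolP (x \in K a b).
    move: xK; rewrite inK => /or3P[/(join_disj01 J)|xA|/(join_subA J')/(join_disj12 J)]; auto.
    by have := st a x (SA _ aA) (SA _ xA); rewrite ax.
  have := st a x (SA _ aA); rewrite ax => /(_ (SP _ _ (SA _ aA) _)).
  by rewrite /gk (negPf xK) andbF /= andbT /cl ax orbT => /(_ isT).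
have [st|ns'] := stableP (~: S).
  apply: (join_isolated J' bA) => x x2; apply/negP => ax.
  have bS : b \in ~: S by rewrite inE nSA.
  have [xK|xK] := boolP (x \in K a b).
    move: xK; rewrite inK => /or3P[/(join_disj02 J)|/(join_subA J)/(join_disj12 J)|xA]; auto.
    by have := st b x bS; rewrite inE (nSA _ xA) ax => /(_ isT).
  have := st b x bS; rewrite ax inE => H; have [xS|/H//] := boolP (x \in S).
  have := SP x b xS; rewrite /gk (negPf xK) /= andbT /cl adj_sym ax orbT => /(_ isT).
  by apply/negP; apply: nSA.
apply: (@pseudo_1_joinI S (K a b)) => //; first exact: (elimT (goodP _ _) (join_good J aA bA)).
move=> x y xS yS xy; apply/andP; apply: contraR yS => n; apply: SP xS _.
by rewrite /gk n /cl xy orbT.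
Qed.
End CliqueCuts.

(** * A language with separate arrays and unbounded numbers *)

Inductive hexpr :=
  | HC of nat
  | HR of nat
  | HA of nat & hexpr
  | HO of binop & hexpr & hexpr.

Inductive hcmd :=
  | HAssign of nat & hexpr
  | HLoad of nat & hexpr
  | HStore of nat & hexpr & hexpr
  | HOut of hexpr & hexpr
  | HSkip
  | HSeq of hcmd & hcmd
  | HIf of hexpr & hcmd & hcmd
  | HWhile of hexpr & hcmd.

Record hstate := HState {
  hreg : nat -> nat;
  harr : nat -> nat -> nat;
  hio : nat -> nat
}.

Definition set_hreg (h : hstate) r v :=
  HState (fun r' => if eqn r' r then v else hreg h r') (harr h) (hio h).
Definition set_harr (h : hstate) a i v :=
  HState (hreg h) (fun b => if eqn b a then (fun j => if j == i then v else harr h a j) else harr h b) (hio h).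
Definition set_hio (h : hstate) i v :=
  HState (hreg h) (harr h) (fun j => if j == i then v else hio h j).

Fixpoint heval (h : hstate) (e : hexpr) : nat :=
  match e with
  | HC c => c
  | HR r => hreg h r
  | HA a i => harr h a (heval h i)
  | HO o e1 e2 => eval_op o (heval h e1) (heval h e2)
  end.

(* The arrays are interleaved above the n + 2m cells reserved for input and
   output: entry [i] of array [a < 16] has address n + 2m + 16 i + a. *)
Definition low : expr := Op Add (Reg 0) (Op Add (Reg 1) (Reg 1)).
Definition addr (a : nat) (e : expr) : expr :=
  Op Add low (Op Add (Op Mul e (Cst 16)) (Cst a)).

Arguments addr : simpl never.

Fixpoint compile_expr (e : hexpr) : expr :=
  match e with
  | HC c => Cst c
  | HR r => Reg r
  | HA a i => Read (addr a (compile_expr i))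
  | HO o e1 e2 => Op o (compile_expr e1) (compile_expr e2)
  end.

Fixpoint compile (c : hcmd) : cmd :=
  match c with
  | HAssign r e => Assign r (compile_expr e)
  | HLoad r i => Assign r (Read (compile_expr i))
  | HStore a i e => Write (addr a (compile_expr i)) (compile_expr e)
  | HOut i e => Write (compile_expr i) (compile_expr e)
  | HSkip => Skip
  | HSeq c1 c2 => Seq (compile c1) (compile c2)
  | HIf e c1 c2 => If (compile_expr e) (compile c1) (compile c2)
  | HWhile e c => While (compile_expr e) (compile c)
  end.

Definition hlow (h : hstate) := hreg h 0 + (hreg h 1 + hreg h 1).

Inductive hexec : hcmd -> hstate -> nat -> hstate -> Prop :=
  | hexec_assign h r e :
      hexec (HAssign r e) h (cost (compile_expr e)).+1 (set_hreg h r (heval h e))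
  | hexec_load h r i : heval h i < hlow h ->
      hexec (HLoad r i) h (cost (compile_expr i)).+2 (set_hreg h r (hio h (heval h i)))
  | hexec_store h a i e :
      hexec (HStore a i e) h (cost (addr a (compile_expr i)) + cost (compile_expr e)).+1
        (set_harr h a (heval h i) (heval h e))
  | hexec_out h i e : heval h i < hlow h ->
      hexec (HOut i e) h (cost (compile_expr i) + cost (compile_expr e)).+1
        (set_hio h (heval h i) (heval h e))
  | hexec_skip h : hexec HSkip h 1 h
  | hexec_seq h h1 h2 c1 c2 t1 t2 :
      hexec c1 h t1 h1 -> hexec c2 h1 t2 h2 -> hexec (HSeq c1 c2) h (t1 + t2) h2
  | hexec_if_true h h1 e c1 c2 t : heval h e != 0 -> hexec c1 h t h1 ->
      hexec (HIf e c1 c2) h ((cost (compile_expr e)).+1 + t) h1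
  | hexec_if_false h h1 e c1 c2 t : heval h e = 0 -> hexec c2 h t h1 ->
      hexec (HIf e c1 c2) h ((cost (compile_expr e)).+1 + t) h1
  | hexec_while_true h h1 h2 e c t1 t2 :
      heval h e != 0 -> hexec c h t1 h1 -> hexec (HWhile e c) h1 t2 h2 ->
      hexec (HWhile e c) h ((cost (compile_expr e)).+1 + t1 + t2) h2
  | hexec_while_false h e c : heval h e = 0 ->
      hexec (HWhile e c) h (cost (compile_expr e)).+1 h.

Fixpoint expr_size (e : hexpr) : nat :=
  match e with
  | HC _ | HR _ => 1
  | HA _ i => expr_size i + 2
  | HO _ e1 e2 => (expr_size e1 + expr_size e2).+1
  end.

Fixpoint cmd_size (c : hcmd) : nat :=
  match c with
  | HAssign _ e => expr_size e
  | HLoad _ i => expr_size i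
  | HStore _ i e => expr_size i + expr_size e + 2
  | HOut i e => expr_size i + expr_size e
  | HSkip => 0
  | HSeq c1 c2 => cmd_size c1 + cmd_size c2
  | HIf e c1 c2 => expr_size e + cmd_size c1 + cmd_size c2
  | HWhile e c => expr_size e + cmd_size c
  end.

Fixpoint wf_expr (e : hexpr) : bool :=
  match e with
  | HC c => c < 16
  | HR _ => true
  | HA a i => (a < 16) && wf_expr i
  | HO _ e1 e2 => wf_expr e1 && wf_expr e2
  end.

(* The values of these expressions exceed the largest value in the state by at
   most one. *)
Definition flat (e : hexpr) : bool :=
  match e with HC _ | HR _ | HA _ _ => true | _ => false end.
Definition slow (e : hexpr) : bool :=
  match e with
  | HO Add e1 (HC 1) => flat e1
  | HO Defs.Sub e1 _ => flat e1
  | HO Mul _ _ | HO Add _ _ => false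
  | _ => true
  end.

Fixpoint wf_cmd (c : hcmd) : bool :=
  match c with
  | HAssign r e => [&& 1 < r, slow e & wf_expr e]
  | HLoad r i => (1 < r) && wf_expr i
  | HStore a i e => [&& a < 16, wf_expr i, slow e & wf_expr e]
  | HOut i e => [&& wf_expr i, slow e & wf_expr e]
  | HSkip => true
  | HSeq c1 c2 => wf_cmd c1 && wf_cmd c2
  | HIf e c1 c2 => [&& wf_expr e, wf_cmd c1 & wf_cmd c2]
  | HWhile e c => wf_expr e && wf_cmd c
  end.

Definition bounded (U : nat) (h : hstate) : Prop :=
  [/\ forall r, hreg h r <= U, forall a i, a < 16 -> harr h a i <= U
    & forall i, i < hlow h -> hio h i <= U].

Definition sim (h : hstate) (s : state) : Prop :=
  [/\ forall r, regs s r = hreg h r,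
      forall a i, a < 16 -> Defs.mem s (hlow h + (i * 16 + a)) = harr h a i
    & forall i, i < hlow h -> Defs.mem s i = hio h i].

Lemma expr_size_gt0 e : 0 < expr_size e. Proof. by case: e => //= *; rewrite addn2. Qed.

Lemma heval_le U h e : 16 <= U -> bounded U h -> wf_expr e -> heval h e <= U ^ expr_size e.
Proof.
move=> U16 [br ba _]; have U1 : 0 < U by apply: leq_trans U16.
have up k : 0 < k -> U <= U ^ k by move=> k0; rewrite -[X in X <= _]expn1 leq_pexp2l.
elim: e => [c|r|a i IH|o e1 IH1 e2 IH2] /=.
- by rewrite expn1 => /ltnW/leq_trans; apply.
- by rewrite expn1.
- by case/andP=> a16 wi; apply: leq_trans (ba _ _ a16) (up _ _); rewrite addn2.
case/andP=> /IH1 {}IH1 /IH2 {}IH2.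
have p1 : 0 < U ^ expr_size e1 by rewrite expn_gt0 U1.
have p2 : 0 < U ^ expr_size e2 by rewrite expn_gt0 U1.
rewrite expnS expnD; move: (U ^ expr_size e1) (U ^ expr_size e2) p1 p2 IH1 IH2 => x y p1 p2 H1 H2.
move: (heval h e1) (heval h e2) H1 H2 => u v H1 H2.
have xy : x <= x * y by rewrite leq_pmulr.
have yx : y <= x * y by rewrite leq_pmull.
have U2 : 16 * (x * y) <= U * (x * y) by rewrite leq_mul2r U16 orbT.
have uv : u * v <= x * y by rewrite leq_mul.
have b1 (b : bool) : b <= 1 by case: b.
case: o => /=; [| | |have := b1 (u == v)|have := b1 (u < v)]; lia.
Qed.

Lemma heval_slow U h e : 16 <= U -> bounded U h -> wf_expr e -> slow e -> heval h e <= U.+1.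
Proof.
move=> U16 [br ba _].
have fl e' : wf_expr e' -> flat e' -> heval h e' <= U.
  case: e' => //= [c /ltnW/leq_trans|a i /andP[a16 _] _]; auto.
have b1 (b : bool) : b <= U.+1 by case: b.
case: e => [c|r|a i|[] e1 e2] /=.
- by move=> c16 _; rewrite leqW // (leq_trans (ltnW c16)).
- by rewrite leqW.
- by case/andP=> a16 _ _; rewrite leqW // ba.
- case: e2 => // -[|[]] // /andP[w _] f /=; rewrite addn1 ltnS; exact: fl.
- by case/andP=> w _ f; rewrite leqW // (leq_trans (leq_subr _ _)) // fl.
- by [].
- by move=> _ _; apply: b1.
- by move=> _ _; apply: b1.
Qed.

Section Transfer.
Variables (w : nat).

Lemma low_eval U h s : 16 <= U -> bounded U h -> sim h s -> U ^ 2 < 2 ^ w ->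
  eval w s low = hlow h.
Proof.
move=> U16 [br _ _] [sr _ _] Uw /=; rewrite !sr.
have := br 0; have := br 1; rewrite /hlow; move: (hreg h 0) (hreg h 1) => n m n0 m0.
have : 16 * U <= U ^ 2 by rewrite -mulnn leq_mul2r U16 orbT.
by move=> H; rewrite !modn_small //; lia.
Qed.

Lemma addr_eval U h s a i e : 16 <= U -> bounded U h -> sim h s -> a < 16 ->
  U ^ (expr_size i + 2) < 2 ^ w -> wf_expr i -> eval w s e = heval h i ->
  eval w s (addr a e) = hlow h + (heval h i * 16 + a).
Proof.
move=> U16 bh sh a16 Uw wi ei.
have U1 : 0 < U by apply: leq_trans U16.
have sz := expr_size_gt0 i.
have U2 : U ^ 2 < 2 ^ w.
  by apply: leq_ltn_trans Uw; rewrite leq_pexp2l // addn2 !ltnS.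
have := low_eval U16 bh sh U2; rewrite /addr.
rewrite -/(eval w s _); move: low => l le.
rewrite /= le ei; have := heval_le U16 bh wi; case: (bh) => br _ _.
have := br 0; have := br 1; rewrite /hlow; move: (hreg h 0) (hreg h 1) => n m n0 m0.
have : U ^ 1 <= U ^ expr_size i by rewrite leq_pexp2l.
rewrite expn1; move: Uw; rewrite expnD; move: (U ^ expr_size i) (heval h i) => x y Uw Ux yx.
have UU : 16 * U <= U ^ 2 by rewrite -mulnn leq_mul2r U16 orbT.
have xU : x * (16 * U) <= x * U ^ 2 by rewrite leq_mul2l UU orbT.
have xU' : x * 16 <= x * U by rewrite leq_mul2l U16 orbT.
by rewrite !modn_small //; lia.
Qed.

Lemma compile_expr_eval U h s e : 16 <= U -> bounded U h -> sim h s ->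
  U ^ expr_size e < 2 ^ w -> wf_expr e -> eval w s (compile_expr e) = heval h e.
Proof.
move=> U16 bh sh; have U1 : 0 < U by apply: leq_trans U16.
have := sh; case=> sr sa si.
elim: e => [c|r|a i IH|o e1 IH1 e2 IH2] Uw.
- move=> /= c16; rewrite modn_small //; apply: leq_ltn_trans Uw.
  by rewrite expn1 (leq_trans (ltnW c16)).
- by rewrite /= sr.
- move=> /andP[a16 wi]; rewrite -[LHS]/(Defs.mem s (eval w s (addr a (compile_expr i)))).
  rewrite (@addr_eval U h s a i) ?sa //= IH //.
  by apply: leq_ltn_trans Uw; rewrite leq_pexp2l ?leq_addr.
move=> we; have := heval_le U16 bh we; move: we => /= /andP[w1 w2] ev.
rewrite IH1 ?IH2 ?(leq_ltn_trans _ Uw) ?leq_pexp2l //=; try by clear; lia.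
by rewrite modn_small // (leq_ltn_trans ev).
Qed.

Lemma bounded_mono U U' h : U <= U' -> bounded U h -> bounded U' h.
Proof.
by move=> UU [br ba bi]; split=> [r|a i Ha|i Hi]; apply: leq_trans UU; auto.
Qed.

(* Stored values grow by at most one per time unit, so after [t] steps they are
   at most [U + t] and an expression of size [z] is at most [(U + t) ^ z]: for
   long enough words no operation overflows. *)
Lemma transfer c h t h' : hexec c h t h' -> forall s U, wf_cmd c -> 16 <= U ->
  (U + t) ^ (cmd_size c) < 2 ^ w -> sim h s -> bounded U h ->
  exists s', [/\ exec w (compile c) s t s', sim h' s' & bounded (U + t) h'].
Proof.
have pw U U' k k' : 16 <= U -> U <= U' -> k <= k' -> U' ^ k' < 2 ^ w -> U ^ k < 2 ^ w.
  move=> U16 UU kk; apply: leq_ltn_trans.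
  apply: (@leq_trans (U ^ k')); last by case: (k') => [|m]; rewrite ?expn0 ?leq_exp2r.
  by rewrite leq_pexp2l // (leq_trans _ U16).
have pw' U t0 k k' : 16 <= U -> k <= k' -> (U + t0) ^ k' < 2 ^ w -> U ^ k < 2 ^ w.
  by move=> U16 kk; apply: pw; rewrite // leq_addr.
elim => {c h t h'}.
- move=> h r e s U /= /and3P[r1 se we] U16 Uw sh bh.
  exists (set_reg s r (eval w s (compile_expr e))).
  rewrite (compile_expr_eval U16 bh sh) //; last by apply: pw' Uw.
  split; first by rewrite -[X in set_reg s r X](compile_expr_eval U16 bh sh) //; [exact: exec_assign|apply: pw' Uw].
    case: sh => sr sa si; case: r r1 => [|[|r]] // _.
    by split=> //= r'; case: eqP; case: eqnP => // _; rewrite sr.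
  have ev := heval_slow U16 bh we se; case: bh => br ba bi; case: r r1 => [|[|r]] // _.
  split=> /= [r'|a i a16|i i0].
  + case: eqnP => _; first by rewrite (leq_trans ev) // addnS ltnS leq_addr.
    by rewrite (leq_trans (br _)) // leq_addr.
  + by rewrite (leq_trans (ba _ _ a16)) // leq_addr.
  + by rewrite (leq_trans (bi _ i0)) // leq_addr.
- move=> h r e lt s U /= /andP[r1 we] U16 Uw sh bh.
  have ce : eval w s (compile_expr e) = heval h e by apply: compile_expr_eval bh sh _ we; rewrite //; apply: pw' Uw.
  exists (set_reg s r (eval w s (Read (compile_expr e)))); split; first exact: exec_assign.
    case: sh => sr sa si; case: r r1 => [|[|r]] // _.
    split=> //= r'; case: eqP; case: eqnP => // _ _.
    by rewrite ce si.
  case: bh => br ba bi; case: r r1 => [|[|r]] // _.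
  split=> /= [r'|a i a16|i i0].
  + by case: eqnP => _; rewrite (@leq_trans U) ?leq_addr ?bi.
  + by rewrite (leq_trans (ba _ _ a16)) // leq_addr.
  + by rewrite (leq_trans (bi _ i0)) // leq_addr.
- move=> h a i e s U /= /and4P[a16 wi se we] U16 Uw sh bh.
  have ei : eval w s (compile_expr i) = heval h i.
    by apply: compile_expr_eval bh sh _ wi; rewrite //; apply: pw' Uw => //; rewrite -addnA leq_addr.
  have ee : eval w s (compile_expr e) = heval h e.
    by apply: compile_expr_eval bh sh _ we; rewrite //; apply: pw' Uw => //; lia.
  have ea := addr_eval U16 bh sh a16 (pw' _ _ _ _ U16 (_ : expr_size i + 2 <= _) Uw) wi ei.
  rewrite -addnA [expr_size e + _]addnC addnA leq_addr in ea; move: (ea isT) => {}ea.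
  eexists; split; first exact: exec_write.
    rewrite ea ee; case: sh => sr sa si; split=> //=.
      move=> b j b16; rewrite /hlow /=; rewrite -/(hlow h) eqn_add2l.
      have [/eqP E|ne] := boolP (j * 16 + b == heval h i * 16 + a).
        have [-> ->] : j = heval h i /\ b = a by lia.
        by case: eqnP => //; rewrite eqxx.
      rewrite sa //; case: eqnP => //= E; case: eqP => // E'; last by rewrite E.
      by case/eqP: ne; rewrite E E'.
    move=> j jl; rewrite -/(hlow h) in jl *; rewrite -si //.
    by case: eqP => // E; move: jl; rewrite E ltnNge leq_addr.
  have ev := heval_slow U16 bh we se; case: bh => br ba bi.
  have ev' : heval h e <= U + (cost (addr a (compile_expr i)) + cost (compile_expr e)).+1.
    by rewrite (leq_trans ev) // addnS ltnS leq_addr.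
  split=> /= [r'|b j b16|j i0].
  + by rewrite (leq_trans (br _)) // leq_addr.
  + case: eqnP => [_|_]; last by rewrite (leq_trans (ba _ _ b16)) // leq_addr.
    by case: eqP => // _; rewrite (leq_trans (ba _ _ a16)) // leq_addr.
  + by rewrite (leq_trans (bi _ i0)) // leq_addr.
- move=> h i e lt s U /= /and3P[wi se we] U16 Uw sh bh.
  have ei : eval w s (compile_expr i) = heval h i.
    by apply: compile_expr_eval bh sh _ wi; rewrite //; apply: pw' Uw => //; rewrite leq_addr.
  have ee : eval w s (compile_expr e) = heval h e.
    by apply: compile_expr_eval bh sh _ we; rewrite //; apply: pw' Uw => //; rewrite leq_addl.
  eexists; split; first exact: exec_write.
    rewrite ei ee; case: sh => sr sa si; split=> //=.
      move=> b j b16; rewrite -/(hlow h) -sa //.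
      by case: eqP => // E; move: lt; rewrite -E ltnNge leq_addr.
    by move=> j jl; rewrite -/(hlow h) in jl *; case: eqP => // _; rewrite si.
  have ev := heval_slow U16 bh we se; case: bh => br ba bi.
  have ev' : heval h e <= U + (cost (compile_expr i) + cost (compile_expr e)).+1.
    by rewrite (leq_trans ev) // addnS ltnS leq_addr.
  split=> /= [r'|b j b16|j i0].
  + by rewrite (leq_trans (br _)) // leq_addr.
  + by rewrite (leq_trans (ba _ _ b16)) // leq_addr.
  + by case: eqP => // _; rewrite (leq_trans (bi _ i0)) // leq_addr.
- move=> h s U _ U16 _ sh bh; exists s; split=> //; first exact: exec_skip.
  by apply: bounded_mono bh; rewrite leq_addr.
- move=> h h1 h2 c1 c2 t1 t2 _ IH1 _ IH2 s U /= /andP[w1 w2] U16 Uw sh bh.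
  have [|s1 [e1 sh1 bh1]] := IH1 s U w1 U16 _ sh bh.
    by apply: pw Uw; lia.
  have [||s2 [e2 sh2 bh2]] := IH2 s1 (U + t1) w2 _ _ sh1 bh1; first by lia.
    by apply: pw Uw; lia.
  exists s2; split=> //; first exact: exec_seq e1 e2.
  by rewrite addnA.
- move=> h h1 e c1 c2 t ne _ IH s U /= /and3P[we w1 w2] U16 Uw sh bh.
  have ee : eval w s (compile_expr e) = heval h e.
    by apply: compile_expr_eval bh sh _ we; rewrite //; apply: pw Uw => //; lia.
  have [|s1 [e1 sh1 bh1]] := IH s U w1 U16 _ sh bh.
    by apply: pw Uw; lia.
  exists s1; split=> //; first by apply: exec_if_true e1; rewrite ee.
  by apply: bounded_mono bh1; lia.
- move=> h h1 e c1 c2 t ne _ IH s U /= /and3P[we w1 w2] U16 Uw sh bh.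
  have ee : eval w s (compile_expr e) = heval h e.
    by apply: compile_expr_eval bh sh _ we; rewrite //; apply: pw Uw => //; lia.
  have [|s1 [e1 sh1 bh1]] := IH s U w2 U16 _ sh bh.
    by apply: pw Uw; lia.
  exists s1; split=> //; first by apply: exec_if_false e1; rewrite ee.
  by apply: bounded_mono bh1; lia.
- move=> h h1 h2 e c t1 t2 ne _ IH1 _ IH2 s U wc U16 Uw sh bh.
  have /= /andP[we w1] := wc.
  have ee : eval w s (compile_expr e) = heval h e.
    by apply: compile_expr_eval bh sh _ we; rewrite //; apply: pw Uw => //=; lia.
  have [|s1 [e1 sh1 bh1]] := IH1 s U w1 U16 _ sh bh.
    by apply: pw Uw => /=; lia.
  have [||s2 [e2 sh2 bh2]] := IH2 s1 (U + t1) wc _ _ sh1 bh1; first by lia.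
    by apply: pw Uw; lia.
  exists s2; split=> //; first by apply: exec_while_true e1 e2; rewrite ee.
  by apply: bounded_mono bh2; lia.
- move=> h e c ne s U /= /andP[we wc] U16 Uw sh bh.
  have ee : eval w s (compile_expr e) = heval h e.
    by apply: compile_expr_eval bh sh _ we; rewrite //; apply: pw Uw => //; lia.
  exists s; split=> //; first by apply: exec_while_false; rewrite ee.
  by apply: bounded_mono bh; lia.
Qed.
End Transfer.

(* The cost of executing every instruction of [c] once. All running times are
   stated as multiples of it, so that no constant is ever computed. *)
Fixpoint pass_cost (c : hcmd) : nat :=
  match c with
  | HAssign _ e => (cost (compile_expr e)).+1
  | HLoad _ i => (cost (compile_expr i)).+2
  | HStore a i e => (cost (addr a (compile_expr i)) + cost (compile_expr e)).+1
  | HOut i e => (cost (compile_expr i) + cost (compile_expr e)).+1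
  | HSkip => 1
  | HSeq c1 c2 => pass_cost c1 + pass_cost c2
  | HIf e c1 c2 => (cost (compile_expr e)).+1 + (pass_cost c1 + pass_cost c2)
  | HWhile e c => (cost (compile_expr e)).+1 + pass_cost c
  end.

Definition run (c : hcmd) (h : hstate) (Q : nat -> hstate -> Prop) : Prop :=
  exists t h' X, [/\ hexec c h t h', t <= pass_cost c * X, 0 < X & Q X h'].

Definition run_within c h Y (Q : hstate -> Prop) := run c h (fun X h' => X <= Y /\ Q h').

Fixpoint keepr (c : hcmd) (r : nat) : bool :=
  match c with
  | HAssign r' _ | HLoad r' _ => ~~ eqn r r'
  | HStore _ _ _ | HOut _ _ | HSkip => true
  | HSeq c1 c2 | HIf _ c1 c2 => keepr c1 r && keepr c2 r
  | HWhile _ c => keepr c r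
  end.
Fixpoint keepa (c : hcmd) (a : nat) : bool :=
  match c with
  | HStore a' _ _ => ~~ eqn a a'
  | HAssign _ _ | HLoad _ _ | HOut _ _ | HSkip => true
  | HSeq c1 c2 | HIf _ c1 c2 => keepa c1 a && keepa c2 a
  | HWhile _ c => keepa c a
  end.
Fixpoint keepio (c : hcmd) : bool :=
  match c with
  | HOut _ _ => false
  | HStore _ _ _ | HAssign _ _ | HLoad _ _ | HSkip => true
  | HSeq c1 c2 | HIf _ c1 c2 => keepio c1 && keepio c2
  | HWhile _ c => keepio c
  end.

Definition frame c h h' :=
  [/\ forall r, keepr c r -> hreg h' r = hreg h r,
      forall a, keepa c a -> harr h' a = harr h a
    & keepio c -> hio h' = hio h].

Lemma frame_refl c h : frame c h h. Proof. by []. Qed.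
Lemma frame_trans c h1 h2 h3 : frame c h1 h2 -> frame c h2 h3 -> frame c h1 h3.
Proof.
case=> r1 a1 i1 [r2 a2 i2]; split=> *.
- by rewrite r2 ?r1.
- by rewrite a2 ?a1.
- by rewrite i2 ?i1.
Qed.
Lemma frame_sub c c' h h' : (forall r, keepr c' r -> keepr c r) ->
  (forall a, keepa c' a -> keepa c a) -> (keepio c' -> keepio c) ->
  frame c h h' -> frame c' h h'.
Proof. by move=> sr sa si [r a i]; split=> *; auto. Qed.

Lemma hexec_frame c h t h' : hexec c h t h' -> frame c h h'.
Proof.
elim=> {c h t h'}.
- by move=> h r e; split=> //= r'; case: eqn.
- by move=> h r e _; split=> //= r'; case: eqn.
- by move=> h a i e; split=> //= b; case: eqn.
- by [].
- by [].
- move=> h h1 h2 c1 c2 t1 t2 _ f1 _ f2; apply: (@frame_trans _ _ h1).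
    by apply: frame_sub f1 => [r|a|] /andP[].
  by apply: frame_sub f2 => [r|a|] /andP[].
- by move=> h h1 e c1 c2 t _ _; apply: frame_sub => [r|a|] /andP[].
- by move=> h h1 e c1 c2 t _ _; apply: frame_sub => [r|a|] /andP[].
- by move=> h h1 h2 e c t1 t2 _ _ f1 _; apply: frame_trans.
- by [].
Qed.

Lemma run_frame c h Q : run c h Q -> run c h (fun X h' => frame c h h' /\ Q X h').
Proof.
case=> t [h' [X [e tX X0 q]]]; exists t, h', X; split=> //; split=> //.
exact: hexec_frame e.
Qed.

Lemma run_conseq c h (Q Q' : nat -> hstate -> Prop) :
  (forall X h', Q X h' -> Q' X h') -> run c h Q -> run c h Q'.
Proof. by move=> QQ [t [h' [X [e tX X0 q]]]]; exists t, h', X; split; auto. Qed.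

Lemma run_within_conseq c h X X' (Q Q' : hstate -> Prop) : X <= X' ->
  (forall h', frame c h h' -> Q h' -> Q' h') -> run_within c h X Q -> run_within c h X' Q'.
Proof.
move=> XX QQ /run_frame; apply: run_conseq => Y h' [f [YX q]].
by split; [apply: leq_trans XX|apply: QQ].
Qed.

Lemma run_seq c1 c2 h Q :
  run c1 h (fun X1 h1 => run c2 h1 (fun X2 h2 => Q (maxn X1 X2) h2)) ->
  run (HSeq c1 c2) h Q.
Proof.
case=> t1 [h1 [X1 [e1 l1 p1 [t2 [h2 [X2 [e2 l2 p2 q]]]]]]].
exists (t1 + t2), h2, (maxn X1 X2); split=> //; first exact: hexec_seq e1 e2.
  rewrite /= mulnDl leq_add //.
    by apply: leq_trans l1 _; rewrite leq_mul2l leq_maxl orbT.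
  by apply: leq_trans l2 _; rewrite leq_mul2l leq_maxr orbT.
by rewrite leq_max p1.
Qed.

Lemma run_within_seq c1 c2 h X Q :
  run_within c1 h X (fun h1 => run_within c2 h1 X Q) -> run_within (HSeq c1 c2) h X Q.
Proof.
move=> H; apply: run_seq; apply: run_conseq H => X1 h1 [l1].
by apply: run_conseq => X2 h2 [l2 q]; rewrite geq_max l1 l2.
Qed.

Lemma run_if e c1 c2 h Q : (if heval h e != 0 then run c1 h Q else run c2 h Q) ->
  run (HIf e c1 c2) h Q.
Proof.
case: ifPn => [ne|/negPn/eqP ne] [t [h' [X [ex l p q]]]].
  exists ((cost (compile_expr e)).+1 + t), h', X; split=> //; first exact: hexec_if_true.
  by rewrite [pass_cost _]/= !mulnDl leq_add ?leq_pmulr // (leq_trans l) // leq_addr.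
exists ((cost (compile_expr e)).+1 + t), h', X; split=> //; first exact: hexec_if_false.
by rewrite [pass_cost _]/= !mulnDl leq_add ?leq_pmulr // (leq_trans l) // leq_addl.
Qed.

Lemma run_within_if e c1 c2 h X Q : (if heval h e != 0 then run_within c1 h X Q else run_within c2 h X Q) ->
  run_within (HIf e c1 c2) h X Q.
Proof. exact: run_if. Qed.

Lemma run_load r i h Q : heval h i < hlow h ->
  Q 1 (set_hreg h r (hio h (heval h i))) -> run (HLoad r i) h Q.
Proof. by move=> l q; eexists _, _, 1; split; [exact: hexec_load|rewrite muln1| |exact: q]. Qed.

Lemma run_out i e h Q : heval h i < hlow h ->
  Q 1 (set_hio h (heval h i) (heval h e)) -> run (HOut i e) h Q.
Proof. by move=> l q; eexists _, _, 1; split; [exact: hexec_out|rewrite muln1| |exact: q]. Qed.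

Fixpoint sexec (c : hcmd) (h : hstate) : hstate :=
  match c with
  | HAssign r e => set_hreg h r (heval h e)
  | HStore a i e => set_harr h a (heval h i) (heval h e)
  | HSeq c1 c2 => sexec c2 (sexec c1 h)
  | HIf e c1 c2 => if heval h e != 0 then sexec c1 h else sexec c2 h
  | _ => h
  end.
Fixpoint straight (c : hcmd) : bool :=
  match c with
  | HAssign _ _ | HStore _ _ _ | HSkip => true
  | HSeq c1 c2 | HIf _ c1 c2 => straight c1 && straight c2
  | _ => false
  end.

Lemma run_straight c h Q : straight c -> Q 1 (sexec c h) -> run c h Q.
Proof.
elim: c h Q => //=.
- by move=> r e h Q _ q; eexists _, _, 1; split; [exact: hexec_assign|rewrite muln1| |exact: q].
- by move=> a i e h Q _ q; eexists _, _, 1; split; [exact: hexec_store|rewrite muln1| |exact: q].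
- by move=> h Q _ q; eexists _, _, 1; split; [exact: hexec_skip|rewrite muln1| |exact: q].
- by move=> c1 IH1 c2 IH2 h Q /andP[s1 s2] q; apply: run_seq; apply: IH1 => //; apply: IH2.
- move=> e c1 IH1 c2 IH2 h Q /andP[s1 s2] q; apply: run_if.
  by case: ifP q => _ q; [apply: IH1|apply: IH2].
Qed.

Lemma run_within_straight c h X (Q : hstate -> Prop) :
  straight c -> 0 < X -> Q (sexec c h) -> run_within c h X Q.
Proof. by move=> s X0 q; apply: run_straight. Qed.

Lemma run_while e c h (I : hstate -> Prop) (phi : hstate -> nat) : I h ->
  (forall h1, I h1 -> frame c h h1 -> heval h1 e != 0 ->
     run c h1 (fun X h2 => I h2 /\ X + phi h2 <= phi h1)) ->
  run (HWhile e c) h (fun X h' => [/\ I h', heval h' e = 0 & X + phi h' <= (phi h).+1]).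
Proof.
move=> Ih step.
suff main h1 : I h1 -> frame c h h1 -> run (HWhile e c) h1 (fun X h' => [/\ I h', heval h' e = 0 & X + phi h' <= (phi h1).+1]).
  exact: main.
move=> Ih1 f; have [n le_n] := ubnP (phi h1); elim: n => // n IHn in h1 Ih1 f le_n *.
have [e0|e0] := eqVneq (heval h1 e) 0.
  by exists (cost (compile_expr e)).+1, h1, 1; split=> //; [exact: hexec_while_false|rewrite muln1 leq_addr].
have /run_frame[t1 [h2 [X1 [ex1 l1 p1 [f1 [I2 ph]]]]]] := step h1 Ih1 f e0.
have [t2 [h3 [X2 [ex2 l2 p2 [I3 e3 ph3]]]]] : run (HWhile e c) h2
    (fun X h' => [/\ I h', heval h' e = 0 & X + phi h' <= (phi h2).+1]).
  by apply: IHn (frame_trans f f1) _ => //; clear -p1 ph le_n; lia.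
exists ((cost (compile_expr e)).+1 + t1 + t2), h3, (X1 + X2); split=> //.
- exact: hexec_while_true ex1 ex2.
- rewrite mulnDr leq_add // [pass_cost _]/= mulnDl leq_add ?leq_pmulr //.
- by rewrite addn_gt0 p1.
by split=> //; clear -ph ph3; lia.
Qed.

Lemma run_within_while e c h (I : hstate -> Prop) (phi : hstate -> nat) Y : I h ->
  (forall h1, I h1 -> frame c h h1 -> heval h1 e != 0 ->
     run_within c h1 Y (fun h2 => I h2 /\ phi h2 < phi h1)) -> 0 < Y ->
  run_within (HWhile e c) h ((phi h).+1 * Y) (fun h' => I h' /\ heval h' e = 0).
Proof.
move=> Ih step Y0; apply: run_conseq (@run_while e c h I (fun h' => phi h' * Y) Ih _).
  move=> X h' [I' e' l]; split=> //; apply: leq_trans (leq_trans (leq_addr _ _) l) _.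
  by rewrite mulSn -addn1 addnC leq_add2r.
move=> h1 I1 f1 e1; apply: run_conseq (step h1 I1 f1 e1) => X h2 [XY [I2 ph]]; split=> //.
by apply: leq_trans (leq_mul ph (leqnn Y)); rewrite mulSn leq_add2r.
Qed.

Definition forn k bnd body :=
  HSeq (HAssign k (HC 0))
    (HWhile (HO Ltb (HR k) bnd) (HSeq body (HAssign k (HO Add (HR k) (HC 1))))).

Lemma run_within_forn k bnd body h N Y (I : nat -> hstate -> Prop) :
  keepr body k ->
  (forall h1, frame (forn k bnd body) h h1 -> heval h1 bnd = N) ->
  I 0 (set_hreg h k 0) ->
  (forall j h1, j < N -> frame (forn k bnd body) h h1 -> hreg h1 k = j -> I j h1 ->
     run_within body h1 Y (fun h2 => I j.+1 (set_hreg h2 k j.+1))) ->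
  0 < Y ->
  run_within (forn k bnd body) h (N.+1 * Y)
    (fun h' => frame (forn k bnd body) h h' /\ I N h').
Proof.
move=> kk hN I0 step Y0; set c := forn _ _ _ in hN step *.
have kfr h1 h2 v : frame body h1 h2 -> frame c h1 (set_hreg h2 k v).
  case=> fr fa fi; split=> /= [r|a|].
  - by case: (eqn r k) => //=; rewrite andbT => /fr.
  - by rewrite andbT => /fa.
  - by rewrite andbT => /fi.
apply: run_seq; apply: run_straight => //=.
pose J h1 := [/\ frame c h h1, hreg h1 k <= N & I (hreg h1 k) h1].
have J0 : J (set_hreg h k 0).
  split; rewrite /= ?eqnE ?eqxx //.
  by have := kfr h h 0 (frame_refl _ _).
have H := @run_while _ (HSeq body (HAssign k (HO Add (HR k) (HC 1)))) _ J (fun h1 => (N - hreg h1 k) * Y) J0.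
apply: run_conseq (H (HO Ltb (HR k) bnd) _) => [X h' [[f l i] e ph]|h1 [f l i] _].
  have E : hreg h' k = N.
    apply/eqP; rewrite eqn_leq l leqNgt /=; apply/negP => lt.
    by move: e => /=; rewrite (hN _ f) lt.
  rewrite E in i; split=> //; rewrite geq_max muln_gt0 Y0 /=.
  apply: leq_trans (leq_trans (leq_addr _ _) ph) _.
  by rewrite /= eqnE eqxx subn0 mulSn -addn1 addnC leq_add2r.
rewrite /= (hN _ f) => lt; have {}lt : hreg h1 k < N by case: (_ < _) lt.
apply: run_seq; have := step _ h1 lt f erefl i => /run_frame; apply: run_conseq.
move=> X h2 [f2 [XY i2]]; apply: run_straight => //=.
have E : hreg h2 k = hreg h1 k by case: f2 => fr _ _; rewrite fr.
rewrite /J /= !eqnE !eqxx E !addn1; split.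
  by split=> //; apply: frame_trans f _; apply: kfr.
rewrite (leq_trans (n := Y + (N - (hreg h1 k).+1) * Y)) //.
  by rewrite leq_add2r geq_max XY Y0.
by rewrite -mulSn subnSK.
Qed.

(** * The algorithm *)

(* Registers 0 and 1 keep n and m. The others: rQ the index of the current edge
   (rA, rB) = (a, b); rF whether a join has been found; rW, rU, rV the path
   vertices p_(i-1), p_i, p_(i+1) and rI = i + 1; rM the largest entry of aHi on
   the swept set; rHd, rTl the ends of the queue aQu; rS = #|K|. *)
Notation rQ := 2 (only parsing).
Notation rA := 3 (only parsing).
Notation rB := 4 (only parsing).
Notation rF := 5 (only parsing).
Notation rK := 6 (only parsing).
Notation rX := 7 (only parsing).
Notation rY := 8 (only parsing).
Notation rHd := 9 (only parsing).
Notation rTl := 10 (only parsing).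
Notation rU := 11 (only parsing).
Notation rV := 12 (only parsing).
Notation rW := 13 (only parsing).
Notation rI := 14 (only parsing).
Notation rM := 15 (only parsing).
Notation rS := 16 (only parsing).
Notation rC := 17 (only parsing).
Notation rD := 18 (only parsing).
Notation rE := 19 (only parsing).
Notation rG := 20 (only parsing).
Notation rJ := 21 (only parsing).
(* Row x of aNbr lists N[x], and aDeg x is its length. aPar stores parents plus
   one, with 0 for unreached vertices. aSt is 0 for vertices outside the swept
   set, 1 for those waiting for stage [aHi x - 1], 2 for those enqueued. *)
Notation aAdj := 0 (only parsing).
Notation aGood := 1 (only parsing).
Notation aNbr := 2 (only parsing).
Notation aDeg := 3 (only parsing).
Notation aPar := 4 (only parsing).
Notation aHi := 5 (only parsing).
Notation aSt := 6 (only parsing).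
Notation aQu := 7 (only parsing).

Notation "x |+| y" := (HO Add x y) (at level 50, left associativity).
Notation "x |*| y" := (HO Mul x y) (at level 40, left associativity).
Notation "x |-| y" := (HO Defs.Sub x y) (at level 50, left associativity).
Notation "x |<| y" := (HO Ltb x y) (at level 70).
Notation "x |=| y" := (HO Eqb x y) (at level 70).
Notation "c1 ;; c2" := (HSeq c1 c2) (at level 90, right associativity).
Definition noe e := HC 1 |-| e.
Definition celle a x y := HA a (x |*| HR 0 |+| y).
Definition cle x y := celle aAdj x y.
Definition inKe x := cle x (HR rA) |*| cle x (HR rB).
Definition inLe x := cle x (HR rU) |*| cle x (HR rV).

Definition forcl k z x body :=
  forn k (HA aDeg (HR z)) (HAssign x (celle aNbr (HR z) (HR k)) ;; body).

Definition c_init : hcmd :=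
  forn rX (HR 0)
    (HStore aAdj (HR rX |*| HR 0 |+| HR rX) (HC 1) ;;
     HStore aNbr (HR rX |*| HR 0) (HR rX) ;;
     HStore aDeg (HR rX) (HC 1)).

Definition c_link x y :=
  HStore aAdj (HR x |*| HR 0 |+| HR y) (HC 1) ;;
  HStore aNbr (HR x |*| HR 0 |+| HA aDeg (HR x)) (HR y) ;;
  HStore aDeg (HR x) (HA aDeg (HR x) |+| HC 1).

Definition c_edges : hcmd :=
  forn rQ (HR 1)
    (HLoad rA (HR rQ |+| HR rQ) ;; HLoad rB (HR rQ |+| HR rQ |+| HC 1) ;;
     c_link rA rB ;; c_link rB rA).

Definition c_good : hcmd :=
  forn rQ (HR 1)
    (HLoad rA (HR rQ |+| HR rQ) ;; HLoad rB (HR rQ |+| HR rQ |+| HC 1) ;;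
     HAssign rG (HC 1) ;;
     forcl rK rA rX
       (HIf (cle (HR rX) (HR rB))
          (forcl rJ rA rY
             (HIf (cle (HR rY) (HR rB) |*| noe (cle (HR rX) (HR rY)))
                (HAssign rG (HC 0)) HSkip))
          HSkip) ;;
     HStore aGood (HR rA |*| HR 0 |+| HR rB) (HR rG) ;;
     HStore aGood (HR rB |*| HR 0 |+| HR rA) (HR rG)).

Definition c_reset : hcmd :=
  forn rX (HR 0)
    (HStore aPar (HR rX) (HC 0) ;; HStore aHi (HR rX) (HC 0) ;;
     HStore aSt (HR rX) (HC 0)).

Definition c_bfs : hcmd :=
  HStore aPar (HR rB) (HR rB |+| HC 1) ;;
  HStore aQu (HC 0) (HR rB) ;;
  HAssign rHd (HC 0) ;; HAssign rTl (HC 1) ;;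
  HWhile (HR rHd |<| HR rTl)
    (HAssign rY (HA aQu (HR rHd)) ;;
     forcl rK rY rX
       (HIf (noe (HA aPar (HR rX)) |*| noe (inKe (HR rX) |*| inKe (HR rY)))
          (HStore aPar (HR rX) (HR rY |+| HC 1) ;;
           HStore aQu (HR rTl) (HR rX) ;;
           HAssign rTl (HR rTl |+| HC 1))
          HSkip) ;;
     HAssign rHd (HR rHd |+| HC 1)).

Definition c_next : hcmd := HAssign rV (HA aPar (HR rU) |-| HC 1).

Definition c_hi : hcmd :=
  HAssign rU (HR rA) ;; HAssign rI (HC 1) ;;
  HWhile (noe (HR rU |=| HR rB))
    (c_next ;;
     forcl rK rV rX
       (HIf (cle (HR rX) (HR rU)) (HStore aHi (HR rX) (HR rI)) HSkip) ;;
     HAssign rU (HR rV) ;; HAssign rI (HR rI |+| HC 1)).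

Definition c_size : hcmd :=
  HAssign rS (HC 0) ;;
  forcl rK rA rX
    (HIf (cle (HR rX) (HR rB)) (HAssign rS (HR rS |+| HC 1)) HSkip).

Definition c_visit (e : hexpr) : hcmd :=
  HIf (e |*| noe (HA aSt (HR rX)))
    (HStore aSt (HR rX) (HC 1) ;;
     HIf (HR rM |<| HA aHi (HR rX)) (HAssign rM (HA aHi (HR rX))) HSkip)
    HSkip ;;
  HIf ((HA aSt (HR rX) |=| HC 1) |*| noe (HR rI |<| HA aHi (HR rX)))
    (HStore aSt (HR rX) (HC 2) ;;
     HStore aQu (HR rTl) (HR rX) ;;
     HAssign rTl (HR rTl |+| HC 1))
    HSkip.

Definition grow_e : hexpr :=
  noe (inKe (HR rX) |*| inKe (HR rY)) |*| noe (inLe (HR rX) |*| inLe (HR rY)).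

Definition c_grow : hcmd :=
  HWhile (HR rHd |<| HR rTl)
    (HAssign rY (HA aQu (HR rHd)) ;;
     forcl rK rY rX (c_visit grow_e) ;;
     HAssign rHd (HR rHd |+| HC 1)).

Definition c_check : hcmd :=
  HAssign rC (HR rS) ;; HAssign rD (HC 0) ;; HAssign rE (HC 0) ;;
  forcl rK rV rX
    (HIf (cle (HR rX) (HR rU))
       (HIf (inKe (HR rX))
          (HIf (HR rD |<| HA aDeg (HR rX)) (HAssign rD (HA aDeg (HR rX))) HSkip ;;
           HIf (HA aSt (HR rX)) (HAssign rE (HC 1)) HSkip)
          (HAssign rC (HR rC |+| HC 1)))
       HSkip).

Definition ok_e : hexpr :=
  noe (HR rI |<| HR rM) |*| celle aGood (HR rU) (HR rV) |*|
  noe (inKe (HR rU)) |*| noe (inKe (HR rV)) |*|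
  noe (HR rC |<| HR rD) |*| noe (HR rE).

Definition seed_e : hexpr :=
  noe (noe (HR rX |=| HR rU) |*|
       noe ((HC 1 |<| HR rI) |*| cle (HR rX) (HR rW) |*|
            noe (inKe (HR rX) |*| inLe (HR rX)))).

(* Stage i first adds p_i and L_(i-1), except for vertices of K :&: L_i, which
   may belong to V0; then it enqueues the waiting vertices of L_i. *)
Definition c_stage : hcmd :=
  c_next ;;
  forcl rK rU rX (c_visit seed_e) ;;
  forcl rK rV rX (c_visit (HC 0)) ;;
  c_grow ;;
  c_check ;;
  HIf ok_e (HAssign rF (HC 1))
    (HAssign rW (HR rU) ;; HAssign rU (HR rV) ;; HAssign rI (HR rI |+| HC 1)).

Definition c_sweep : hcmd :=
  HAssign rU (HR rA) ;; HAssign rW (HR rA) ;; HAssign rI (HC 1) ;; HAssign rM (HC 0) ;;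
  HAssign rHd (HC 0) ;; HAssign rTl (HC 0) ;;
  HWhile (noe (HR rU |=| HR rB) |*| noe (HR rF)) c_stage.

Definition c_edge : hcmd :=
  HIf (celle aGood (HR rA) (HR rB))
    (c_reset ;; c_bfs ;;
     HIf (HA aPar (HR rA)) (c_hi ;; c_size ;; c_sweep) HSkip)
    HSkip.

Definition c_main : hcmd :=
  HAssign rF (HC 0) ;; HAssign rQ (HC 0) ;;
  HWhile ((HR rQ |<| HR 1) |*| noe (HR rF))
    (HLoad rA (HR rQ |+| HR rQ) ;; HLoad rB (HR rQ |+| HR rQ |+| HC 1) ;;
     c_edge ;;
     HAssign rQ (HR rQ |+| HC 1)).

Definition c_label : hcmd :=
  forn rX (HR 0)
    (HIf (HA aSt (HR rX))
       (HIf (inKe (HR rX)) (HOut (HR rX) (HC 1))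
          (HIf (inLe (HR rX)) (HOut (HR rX) (HC 2)) (HOut (HR rX) (HC 3))))
       (HIf (inKe (HR rX))
          (HIf (inLe (HR rX)) (HOut (HR rX) (HC 0)) (HOut (HR rX) (HC 4)))
          (HIf (inLe (HR rX)) (HOut (HR rX) (HC 5)) (HOut (HR rX) (HC 6))))).

Definition c_all : hcmd :=
  c_init ;; c_edges ;; c_good ;; c_main ;; HIf (HR rF) c_label HSkip.

Lemma c_all_wf : wf_cmd c_all. Proof. by vm_compute. Qed.
(** * Correctness *)

Section Correct.
Variables (n : nat) (G : graph 'I_n) (l : seq ('I_n * 'I_n)).
Hypothesis hl : edge_list G l.

Let m := size l.
Let D := (max_degree G).+1.

Definition other (x : 'I_n) (p : 'I_n * 'I_n) : seq 'I_n :=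
  (if p.1 == x then [:: p.2] else [::]) ++ (if p.2 == x then [:: p.1] else [::]).
Definition nbrs (l' : seq ('I_n * 'I_n)) (x : 'I_n) : seq 'I_n :=
  x :: flatten [seq other x p | p <- l'].
Notation cls := (nbrs l).

Lemma nbrs_rcons l' p x : nbrs (rcons l' p) x = nbrs l' x ++ other x p.
Proof. by rewrite /nbrs map_rcons flatten_rcons. Qed.

Lemma nbrs_prefix l1 l2 x : exists s, nbrs (l1 ++ l2) x = nbrs l1 x ++ s.
Proof. by exists (flatten [seq other x p | p <- l2]); rewrite /nbrs map_cat flatten_cat. Qed.

Lemma mem_edges p : p \in l -> G p.1 p.2.
Proof.
move=> pl; have : [set p.1; p.2] \in enum (edges G).
  rewrite -(perm_mem hl); exact: (map_f (fun p : 'I_n * 'I_n => [set p.1; p.2])).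
rewrite mem_enum => /imsetP[q]; rewrite inE /= => q12 e.
have ne : q.1 != q.2 by apply/eqP => E; rewrite E adj_irrefl in q12.
have : p.1 \in [set q.1; q.2] by rewrite -e !inE eqxx.
have : p.2 \in [set q.1; q.2] by rewrite -e !inE eqxx orbT.
have : q.1 \in [set p.1; p.2] by rewrite e !inE eqxx.
have : q.2 \in [set p.1; p.2] by rewrite e !inE eqxx orbT.
rewrite !inE => h1 h2 /orP[]/eqP h3 /orP[]/eqP h4; move: h1 h2; rewrite h3 h4 ?orbb //.
- by move=> /eqP E; rewrite E eqxx in ne.
- by rewrite adj_sym.
- by move=> _ /eqP E; rewrite E eqxx in ne.
Qed.

Lemma edges_mem x y : G x y -> exists2 p, p \in l & p = (x, y) \/ p = (y, x).
Proof.
move=> xy; have ne : x != y by apply/eqP => E; rewrite E adj_irrefl in xy.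
have : [set x; y] \in [seq [set p.1; p.2] | p <- l].
  by rewrite (perm_mem hl) mem_enum; apply/imsetP; exists (x, y).
case/mapP => -[u v] pl /= e; exists (u, v) => //.
have : x \in [set u; v] by rewrite -e !inE eqxx.
have : y \in [set u; v] by rewrite -e !inE eqxx orbT.
rewrite !inE => /orP[]/eqP E1 /orP[]/eqP E2; move: ne; rewrite E1 E2 ?eqxx; try by []; auto.
Qed.

Lemma mem_other x y p : (y \in other x p) = (p == (x, y)) || (p == (y, x)).
Proof.
case: p => u v; rewrite mem_cat /= !xpair_eqE.
by case: (u == x); case: (v == x); rewrite ?inE ?andbT ?andbF ?orbF // ?(eq_sym y) //= andbC.
Qed.

Lemma mem_nbrs l' x y :
  (y \in nbrs l' x) = (y == x) || has (fun p => (p == (x, y)) || (p == (y, x))) l'.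
Proof.
rewrite inE; congr (_ || _); elim: l' => //= p l' IH.
by rewrite mem_cat mem_other IH.
Qed.

Lemma mem_cls x y : (y \in cls x) = cl G y x.
Proof.
rewrite mem_nbrs /cl; congr (_ || _); apply/hasP/idP => [[p pl /orP[]/eqP e]|].
- by have := mem_edges pl; rewrite e adj_sym.
- by have := mem_edges pl; rewrite e.
by case/edges_mem=> p pl e; exists p => //; case: e => ->; rewrite eqxx ?orbT.
Qed.

Lemma uniq_cls x : uniq (cls x).
Proof.
have : uniq [seq [set p.1; p.2] | p <- l] by rewrite (perm_uniq hl) enum_uniq.
have : forall p, p \in l -> p.1 != p.2.
  by move=> p /mem_edges; apply: contraTneq => ->; rewrite adj_irrefl.
elim/last_ind: (l) => // s p IH ne; rewrite map_rcons rcons_uniq => /andP[np us].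
have pne : p.1 != p.2 by apply: ne; rewrite mem_rcons mem_head.
rewrite nbrs_rcons cat_uniq IH //= => [|q qs]; last by apply: ne; rewrite mem_rcons inE qs orbT.
apply/andP; split; last first.
  rewrite /other; case: eqP => [e|_]; case: eqP => [e'|_] //=.
  by rewrite -e in e'; rewrite e' eqxx in pne.
apply/hasPn => y; rewrite mem_other => yp; rewrite mem_nbrs negb_or; apply/andP; split.
  by apply: contraNneq pne => E; case/orP: yp => /eqP->; rewrite /= E.
apply/hasPn => q qs; apply: contraNN np => qe; apply/mapP; exists q => //.
by case/orP: yp => /eqP->; case/orP: qe => /eqP-> //=; rewrite setUC.
Qed.

Lemma size_cls_n x : size (cls x) <= n.
Proof. by rewrite -(card_uniqP (uniq_cls x)) -[X in _ <= X]card_ord max_card. Qed.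

Lemma size_nbrs_le l1 l2 x : l = l1 ++ l2 -> size (nbrs l1 x) <= n.
Proof.
by have := size_cls_n x; move=> + e; rewrite e; have [s ->] := nbrs_prefix l1 l2 x; rewrite size_cat; apply: leq_trans; apply: leq_addr.
Qed.

Lemma size_cls x : size (cls x) = #|nbhd G x|.
Proof. by rewrite -(card_uniqP (uniq_cls x)); apply: eq_card => y; rewrite mem_cls inE. Qed.

Lemma size_cls_D x : size (cls x) <= D.
Proof.
rewrite size_cls /D; have -> : nbhd G x = x |: [set y | G x y].
  by apply/setP => y; rewrite !inE /cl adj_sym.
rewrite cardsU1 -add1n leq_add ?leq_b1 //.
exact: (leq_bigmax (F := fun x => #|[set y | G x y]|) x).
Qed.

Lemma size_edges : m = num_edges G.
Proof. by rewrite /m /num_edges -(size_map (fun p : 'I_n * 'I_n => [set p.1; p.2])) (perm_size hl) cardE. Qed.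

Lemma idx_inj (x x' : nat) (y y' : nat) : y < n -> y' < n ->
  (x * n + y == x' * n + y') = (x == x') && (y == y').
Proof.
move=> yn yn'; apply/eqP/andP => [e|[/eqP-> /eqP->] //].
have n0 : 0 < n by apply: leq_ltn_trans yn.
have := congr1 (divn^~ n) e; have := congr1 (modn^~ n) e.
by rewrite !modnMDl !modn_small // !divnMDl // !divn_small // !addn0 => -> ->.
Qed.

Lemma eqoE (x y : 'I_n) : (nat_of_ord x == nat_of_ord y) = (x == y).
Proof. exact: val_eqE. Qed.
Definition ordE := (eqoE, idx_inj, ltn_ord).

Notation nths := (fun s k => nth 0 [seq val y | y <- s] k).

Record env (h : hstate) : Prop := Env {
  env_n : hreg h 0 = n;
  env_m : hreg h 1 = m;
  env_adj : forall x y : 'I_n, harr h aAdj (x * n + y) = cl G x y;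
  env_deg : forall x : 'I_n, harr h aDeg x = size (cls x);
  env_nbr : forall (x : 'I_n) k, k < size (cls x) -> harr h aNbr (x * n + k) = nths (cls x) k
}.

Definition keepenv c := [&& keepr c 0, keepr c 1, keepa c aAdj, keepa c aDeg & keepa c aNbr].

Lemma env_frame c h h' : env h -> frame c h h' -> keepenv c -> env h'.
Proof.
by case=> e1 e2 e3 e4 e5 [fr fa _] /and5P[k0 k1 k2 k3 k4]; split; rewrite ?fr ?fa.
Qed.

Definition okcl k z x body :=
  [&& keepr body k, keepr body z, keepr body 0, keepa body aDeg & keepa body aNbr]
  && [&& ~~ eqn z k, ~~ eqn z x, ~~ eqn k x, ~~ eqn 0 k & ~~ eqn 0 x].

Lemma run_within_forcl k z x body h (v : 'I_n) Y (I : seq 'I_n -> hstate -> Prop) :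
  okcl k z x body -> env h -> hreg h z = v ->
  I [::] (set_hreg h k 0) ->
  (forall s1 y s2 h1, cls v = s1 ++ y :: s2 -> frame (forcl k z x body) h h1 ->
     I s1 h1 ->
     run_within body (set_hreg h1 x (val y)) Y (fun h2 => I (rcons s1 y) (set_hreg h2 k (size s1).+1))) ->
  0 < Y ->
  run_within (forcl k z x body) h ((size (cls v)).+1 * Y)
    (fun h' => frame (forcl k z x body) h h' /\ I (cls v) h').
Proof.
case/andP=> /and5P[bk bz b0 bd bn] /and5P[zk zx kx k0 x0] en hz I0 step Y0.
have kx' : ~~ eqn x k by rewrite eqnE eq_sym -eqnE.
have fz h1 : frame (forcl k z x body) h h1 -> hreg h1 z = v.
  by case=> fr _ _; rewrite fr // /forcl /forn /= zk zx bz.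
have f0 h1 : frame (forcl k z x body) h h1 -> hreg h1 0 = n.
  by case=> fr _ _; rewrite fr ?env_n // /forcl /forn /= k0 x0 b0.
have := @run_within_forn k (HA aDeg (HR z)) (HAssign x (celle aNbr (HR z) (HR k)) ;; body)
  h (size (cls v)) Y (fun j h' => I (take j (cls v)) h').
rewrite take0 take_size; apply => //.
- by rewrite /= kx.
- by move=> h1 f1 /=; rewrite fz //; case: f1 => _ fa _; rewrite fa ?env_deg // /= bd.
move=> j h1 jn f1 kj Ij; apply: run_within_seq; apply: run_within_straight => //=.
have -> : harr h1 aNbr (hreg h1 z * hreg h1 0 + hreg h1 k) = nths (cls v) j.
  by rewrite fz // f0 // kj; case: f1 => _ fa _; rewrite fa ?env_nbr // /forcl /forn /= bn.
rewrite (nth_map v) //.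
have := step (take j (cls v)) (nth v (cls v) j) (drop j.+1 (cls v)) h1.
rewrite -drop_nth // cat_take_drop => /(_ erefl f1 Ij).
rewrite size_takel; last exact: ltnW.
by rewrite -take_nth.
Qed.

Record table (f : 'I_n -> seq 'I_n) (h : hstate) : Prop := Table {
  table_adj : forall x y : 'I_n, harr h aAdj (x * n + y) = (y \in f x);
  table_deg : forall x : 'I_n, harr h aDeg x = size (f x);
  table_nbr : forall (x : 'I_n) k, k < size (f x) -> harr h aNbr (x * n + k) = nths (f x) k
}.

Lemma table_ext f g h : f =1 g -> table f h -> table g h.
Proof. by move=> e [t1 t2 t3]; split=> *; rewrite -e //; apply: t3; rewrite e. Qed.

Definition linked (f : 'I_n -> seq 'I_n) u v x := if x == u then rcons (f x) v else f x.

Lemma table_link f h rx ry (u v : 'I_n) : table f h -> hreg h 0 = n ->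
  hreg h rx = u -> hreg h ry = v -> (forall x, size (f x) <= n) -> size (f u) < n ->
  table (linked f u v) (sexec (c_link rx ry) h).
Proof.
move=> [ta td tn] h0 hx hy fn fu; rewrite /linked; split=> /=.
- move=> x y; rewrite hx hy h0 !ordE //; case: (x =P u) => [->|_] /=; last exact: ta.
  by rewrite mem_rcons inE ta; case: (y == v).
- move=> x; rewrite hx td eqoE; case: (x =P u) => [->|_]; last exact: td.
  by rewrite size_rcons addn1.
move=> x k; rewrite hx hy h0 td => kx.
have kn : k < n by apply: leq_trans kx _; case: eqP => // ->; rewrite size_rcons.
rewrite !ordE //; move: kx; case: (x =P u) => [->|_] /=; last exact: tn.
rewrite size_rcons ltnS leq_eqVlt map_rcons nth_rcons size_map => /orP[/eqP->|kl].
  by rewrite eqxx ltnn.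
by rewrite kl (ltn_eqF kl) tn.
Qed.

Lemma linked_other l1 p x : p.1 != p.2 ->
  linked (linked (nbrs l1) p.1 p.2) p.2 p.1 x = nbrs (rcons l1 p) x.
Proof.
case: p => u v /= uv; rewrite nbrs_rcons /other /linked /= ![_ == x]eq_sym.
case: (x =P u) => [->|_]; first by rewrite (negPf uv) cats0 cats1.
by case: (x == v); rewrite ?cats0 //= cats1.
Qed.

Definition input_io (h : hstate) := forall l1 p l2, l = l1 ++ p :: l2 ->
  hio h (size l1 + size l1) = p.1 /\ hio h (size l1 + size l1 + 1) = p.2.

Lemma split_at (T : Type) (s : seq T) j : j < size s ->
  exists s1 y s2, s = s1 ++ y :: s2 /\ size s1 = j.
Proof.
move=> js; case: s js => // x0 s js.
exists (take j (x0 :: s)), (nth x0 (x0 :: s) j), (drop j.+1 (x0 :: s)).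
by rewrite -drop_nth // cat_take_drop size_takel // ltnW.
Qed.

Lemma take_split (T : Type) (s1 : seq T) y s2 : take (size s1).+1 (s1 ++ y :: s2) = rcons s1 y.
Proof. by rewrite -cat_rcons -(size_rcons s1 y) take_size_cat. Qed.

Lemma run_init h : hreg h 0 = n -> (forall a i, harr h a i = 0) ->
  run_within c_init h n.+1 (fun h' => frame c_init h h' /\ table (nbrs [::]) h').
Proof.
move=> h0 z.
have := @run_within_forn rX (HR 0) _ h n 1 (fun j h' =>
  [/\ forall x y : 'I_n, harr h' aAdj (x * n + y) = (x < j) && (x == y),
      forall x : 'I_n, x < j -> harr h' aDeg x = 1
    & forall x : 'I_n, x < j -> harr h' aNbr (x * n) = x]).
rewrite muln1 => H; apply: run_within_conseq (H _ _ _ _ _ _) => //= {H}.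
- move=> h' _ [f [ta td tn]]; split=> //; split.
  + by move=> x y; rewrite ta ltn_ord inE eq_sym.
  + by move=> x; rewrite td.
  + by move=> x [] // _; rewrite addn0 tn.
- by move=> h1 [fr _ _]; rewrite fr.
move=> j h1 jn [fr _ _] hj [ta td tn]; apply: run_within_straight => //=.
rewrite hj fr // h0; split.
- move=> x y; rewrite !ordE // ta [in RHS]ltnS [in RHS]leq_eqVlt.
  case: (x =P j :> nat) => [xj|_] //=; rewrite -xj eqoE eq_sym.
  by case: eqP; rewrite ?ltnn.
- by move=> x; rewrite ltnS leq_eqVlt; case: eqP => //= _ /td.
move=> x; rewrite ltnS leq_eqVlt -[x * n]addn0 -[j * n]addn0 idx_inj ?(leq_ltn_trans _ jn) //.
by case: eqP => [-> //|_] /= /tn; rewrite addn0.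
Qed.

Lemma run_edges h : hreg h 0 = n -> hreg h 1 = m -> input_io h ->
  table (nbrs [::]) h ->
  run_within c_edges h m.+1 (fun h' => frame c_edges h h' /\ env h').
Proof.
move=> h0 h1 io tb.
have := @run_within_forn rQ (HR 1) _ h m 1 (fun j h' => table (nbrs (take j l)) h').
rewrite muln1 => H; apply: run_within_conseq (H _ _ _ _ _ _) => //= {H}.
- move=> h' _ [f]; rewrite take_size => -[ta td tn]; split=> //; case: (f) => fr _ _.
  split=> //; rewrite ?fr //.
  by move=> x y; rewrite ta mem_cls cl_sym.
- by move=> h2 [fr _ _]; rewrite fr.
- by rewrite take0; case: tb => *; split.
move=> j h2 jm f hj tj; have [l1 [p [l2 [e1 e2]]]] := split_at jm.
have [io1 io2] := io _ _ _ e1; have [fr _ fio] := f.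
have hl2 : hlow h2 = n + (m + m) by rewrite /hlow !fr // h0 h1.
have pl : p \in l by rewrite e1 mem_cat mem_head orbT.
have pne : p.1 != p.2 by have := mem_edges pl; apply: contraTneq => ->; rewrite adj_irrefl.
have te : take j l = l1 by rewrite e1 -e2 take_size_cat.
have te' : take j.+1 l = rcons l1 p by rewrite e1 -e2 take_split.
apply: run_within_seq; apply: run_load; rewrite /= ?hj ?hl2; first by clear -jm; lia.
split=> //; apply: run_within_seq; apply: run_load; rewrite /= ?hj /hlow /= -/(hlow _) ?hl2; first by clear -jm; lia.
split=> //; rewrite fio // -e2 io1 io2.
rewrite te in tj; set h3 := set_hreg _ _ _.
have t3 : table (nbrs l1) h3 by case: tj => *; split.
have el : l = rcons l1 p ++ l2 by rewrite cat_rcons.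
have s2 x := size_nbrs_le x el.
have s1 x : size (nbrs l1 x) <= n by apply: size_nbrs_le e1.
apply: run_within_straight => //.
have t4 : table (linked (nbrs l1) p.1 p.2) (sexec (c_link rA rB) h3).
  apply: table_link => //; first by rewrite /= fr.
  by have := s2 p.1; rewrite nbrs_rcons /other eqxx eq_sym (negPf pne) cats0 size_cat addn1.
have ls x : size (linked (nbrs l1) p.1 p.2 x) <= n.
  rewrite /linked; case: eqP => // ->.
  by have := s2 p.1; rewrite nbrs_rcons /other eqxx eq_sym (negPf pne) cats0 size_cat addn1 size_rcons.
have : table (linked (linked (nbrs l1) p.1 p.2) p.2 p.1) (sexec (c_link rB rA) (sexec (c_link rA rB) h3)).
  apply: table_link => //; first by rewrite /= fr.
  have := s2 p.2; rewrite nbrs_rcons /other eqxx (negPf pne) /= size_cat addn1.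
  by rewrite /linked eq_sym (negPf pne).
move/(table_ext (fun x => linked_other l1 x pne)) => t5.
by case: t5 => *; rewrite e2 te'; split.
Qed.

Opaque nbrs.

Lemma env_set_hreg h r v : env h -> 1 < r -> env (set_hreg h r v).
Proof. by case: r => [|[|r]] // [*]; split. Qed.

Lemma cleE h rx ry (x y : 'I_n) : env h -> hreg h rx = x -> hreg h ry = y ->
  heval h (cle (HR rx) (HR ry)) = cl G x y.
Proof. by move=> e hx hy /=; rewrite hx hy (env_n e) (env_adj e). Qed.

Lemma noeE h e (b : bool) : heval h e = b -> heval h (noe e) = ~~ b.
Proof. by move=> /= ->; case: b. Qed.
Lemma mulE h e1 e2 (b1 b2 : bool) : heval h e1 = b1 -> heval h e2 = b2 ->
  heval h (e1 |*| e2) = b1 && b2.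
Proof. by move=> /= -> ->; rewrite mulnb. Qed.
Lemma boolE (b : bool) : ((b : nat) != 0) = b. Proof. by case: b. Qed.

Lemma all_good u v :
  all (fun x => cl G x v ==> all (fun y => cl G y v ==> cl G x y) (cls u)) (cls u) = good G u v.
Proof.
apply/allP/goodP => [H x y|H x].
  rewrite !inE => /andP[xu xv] /andP[yu yv].
  have := H x; rewrite mem_cls xu xv => /(_ isT) /allP /(_ y).
  by rewrite mem_cls yu yv => /(_ isT).
rewrite mem_cls => xu; apply/implyP => xv; apply/allP => y; rewrite mem_cls => yu.
by apply/implyP => yv; apply: H; rewrite inE ?xu ?yu.
Qed.

Lemma run_good h : env h -> input_io h ->
  run_within c_good h (m.+1 * (D.+1 * D.+1)) (fun h' => env h' /\
    forall x y, G x y -> harr h' aGood (x * n + y) = good G x y).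
Proof.
move=> en io.
have := @run_within_forn rQ (HR 1) _ h m (D.+1 * D.+1) (fun j h' => forall x y : 'I_n,
   has (fun p => (p == (x, y)) || (p == (y, x))) (take j l) -> harr h' aGood (x * n + y) = good G x y).
move=> H; apply: run_within_conseq (H _ _ _ _ _ _) => //= {H}.
- move=> h' f [_]; rewrite take_size => H; split=> [|x y xy]; first exact: env_frame f _.
  apply: H; case: (edges_mem xy) => p pl e; apply/hasP; exists p => //.
  by case: e => ->; rewrite eqxx ?orbT.
- by move=> h1 [fr _ _]; rewrite fr ?env_m.
- by rewrite take0.
move=> j h2 jm f hj tj; have [l1 [p [l2 [e1 e2]]]] := split_at jm.
have [io1 io2] := io _ _ _ e1; have [fr _ fio] := f.
have en2 : env h2 by apply: env_frame f _.
have hl2 : hlow h2 = n + (m + m) by rewrite /hlow !(env_n en2) !(env_m en2).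
have te' : take j.+1 l = rcons (take j l) p by rewrite e1 -e2 take_split take_size_cat.
apply: run_within_seq; apply: run_load; rewrite /= ?hj ?hl2; first by clear -jm; lia.
split=> //; apply: run_within_seq; apply: run_load; rewrite /= ?hj /hlow /= -/(hlow _) ?hl2; first by clear -jm; lia.
split=> //; rewrite fio // -e2 io1 io2 e2.
apply: run_within_seq; apply: run_within_straight => //; set h3 := sexec _ _.
have en3 : env h3 by rewrite /h3 /=; do !apply: env_set_hreg => //.
have a3 : hreg h3 rA = p.1 by []. have b3 : hreg h3 rB = p.2 by [].
have := @run_within_forcl rK rA rX _ h3 p.1 D.+1 (fun s1 h' => hreg h' rG =
  all (fun x => cl G x p.2 ==> all (fun y => cl G y p.2 ==> cl G x y) (cls p.1)) s1).
move=> H; apply: run_within_seq; apply: run_within_conseq (H _ _ _ _ _ _ _) => //= {H}.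
- by rewrite leq_mul2r ltnS size_cls_D.
- move=> h' _ [f3]; rewrite all_good => g; apply: run_within_straight => //= x y.
  have en4 : env h' by apply: env_frame f3 _.
  have [fr3 fa3 _] := f3.
  rewrite te' has_rcons g !fr3 // !(env_n en3) a3 b3 !ordE // fa3 //= => hxy.
  case: ifP => [/andP[/eqP-> /eqP->]|n1]; first by rewrite good_sym.
  case: ifP => [/andP[/eqP-> /eqP->] //|n2].
  apply: tj; move: hxy; case: (p) n1 n2 => u v /=.
  by rewrite !xpair_eqE ![_ == u]eq_sym ![_ == v]eq_sym => n1 n2; rewrite n2 [(u == y) && _]andbC n1 !orbF.
- move=> s1 x s2 h4 es f4 g4.
  have en4 : env h4 by apply: env_frame f4 _.
  have b4 : hreg h4 rB = p.2 by case: f4 => fr4 _ _; rewrite fr4.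
  have a4 : hreg h4 rA = p.1 by case: f4 => fr4 _ _; rewrite fr4.
  apply: run_within_if; rewrite (@cleE _ _ _ x p.2) ?boolE //; last exact: env_set_hreg.
  case: ifP => xb; last first.
    by apply: run_within_straight => //=; rewrite all_rcons xb g4.
  set g := all _ s1 in g4.
  have := @run_within_forcl rJ rA rY (HIf (cle (HR rY) (HR rB) |*| noe (cle (HR rX) (HR rY)))
                (HAssign rG (HC 0)) HSkip) (set_hreg h4 rX x) p.1 1 (fun s h' => hreg h' rG =
  g && all (fun y => cl G y p.2 ==> cl G x y) s).
  move=> H; apply: run_within_conseq (H _ _ _ _ _ _) => //= {H}.
  + by rewrite muln1 ltnS size_cls_D.
  + by move=> h5 f5 [_ ->]; rewrite all_rcons xb andbC.
  + exact: env_set_hreg.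
  + by rewrite andbT.
  move=> t1 y t2 h5 et f5 g5.
  have en5 : env (set_hreg h5 rY y) by apply: env_set_hreg => //; apply: env_frame f5 _ => //; apply: env_set_hreg.
  have [fr5 _ _] := f5.
  apply: run_within_if.
  have -> : heval (set_hreg h5 rY y) (cle (HR rY) (HR rB) |*| noe (cle (HR rX) (HR rY))) =
      cl G y p.2 && ~~ cl G x y.
    apply: mulE; first by apply: cleE => //=; rewrite fr5.
    by apply: noeE; apply: cleE => //=; rewrite fr5.
  rewrite boolE; case: ifP => c; apply: run_within_straight => //=; rewrite ?g5 all_rcons.
    by case/andP: c => -> /negPf-> /=; rewrite andbF.
  by move: c; case: (cl G y p.2) => //= /negbT/negPn->.
Qed.

Lemma inKeE h r (a b x : 'I_n) : env h -> hreg h rA = a -> hreg h rB = b -> hreg h r = x ->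
  heval h (inKe (HR r)) = (x \in K G a b).
Proof. by move=> en ha hb hr; rewrite inE; apply: mulE; apply: cleE. Qed.

Lemma inLeE h r (u v x : 'I_n) : env h -> hreg h rU = u -> hreg h rV = v -> hreg h r = x ->
  heval h (inLe (HR r)) = (x \in K G u v).
Proof. by move=> en ha hb hr; rewrite inE; apply: mulE; apply: cleE. Qed.

Lemma run_reset h : hreg h 0 = n ->
  run_within c_reset h n.+1 (fun h' => frame c_reset h h' /\
    forall x : 'I_n, [/\ harr h' aPar x = 0, harr h' aHi x = 0 & harr h' aSt x = 0]).
Proof.
move=> h0.
have := @run_within_forn rX (HR 0) _ h n 1 (fun j h' =>
  forall x : 'I_n, x < j -> [/\ harr h' aPar x = 0, harr h' aHi x = 0 & harr h' aSt x = 0]).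
rewrite muln1 => H; apply: run_within_conseq (H _ _ _ _ _ _) => //= {H}.
- by move=> h' _ [f H]; split=> // x; apply: H.
- by move=> h1 [fr _ _]; rewrite fr.
move=> j h1 jn [fr _ _] hj H; apply: run_within_straight => //= x.
rewrite ltnS leq_eqVlt hj; case: eqP => //= _; exact: H.
Qed.

Section Search.
Variables (a b : 'I_n).

(* A parent is the earliest possible one, hence parents trace chordless paths. *)
Definition first_parent (q : seq 'I_n) (x y : 'I_n) :=
  [/\ y \in q, index y q < index x q, gk G a b x y
    & forall z, z \in q -> index z q < index y q -> ~~ gk G a b x z].

Record search (q : seq 'I_n) (h : hstate) : Prop := Search {
  search_mem : forall x : 'I_n, (harr h aPar x != 0) = (x \in q);
  search_uniq : uniq q;
  search_root : b \in q /\ harr h aPar b = b.+1;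
  search_par : forall x, x \in q -> x != b ->
    exists2 y : 'I_n, harr h aPar x = y.+1 & first_parent q x y
}.

Definition searching hd (q : seq 'I_n) (h : hstate) :=
  [/\ search q h, hreg h rTl = size q,
      forall k, k < size q -> harr h aQu k = nths q k, hd <= size q
    & forall x y, index y q < hd -> gk G a b x y -> x \in q].

Lemma first_parent_rcons q x y z : x \in q -> first_parent q x y -> first_parent (rcons q z) x y.
Proof.
move=> xq [yq yx g H]; rewrite -cats1; split=> //; rewrite ?mem_cat ?yq //.
  by rewrite !index_cat xq yq.
move=> t; rewrite mem_cat !index_cat yq; case: ifP => [tq _|_ _ lt]; first exact: H.
by have := leq_trans (leq_addr _ _) (ltnW lt); rewrite leqNgt index_mem yq.
Qed.

Lemma run_bfs h : env h -> hreg h rA = a -> hreg h rB = b ->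
  (forall x : 'I_n, harr h aPar x = 0) ->
  run_within c_bfs h (n.+1 * D.+1) (fun h' => exists2 q, search q h' &
     forall x y, y \in q -> gk G a b x y -> x \in q).
Proof.
move=> en ha hb p0.
do 4!(apply: run_within_seq; apply: run_within_straight => //); set h1 := sexec _ _.
have en1 : env h1 by case: en => *; split.
have I1 : exists q, searching (hreg h1 rHd) q h1.
  exists [:: b]; split=> //=.
    split=> //=.
    - by move=> x; rewrite hb inE eqoE; case: (x =P b); rewrite ?addn1 ?p0.
    - by rewrite inE hb !eqxx addn1.
    - by move=> x; rewrite inE => /eqP->; rewrite eqxx.
  by case.
have H := @run_within_while (HR rHd |<| HR rTl) _ h1 (fun h' => exists q, searching (hreg h' rHd) q h')
  (fun h' => n - hreg h' rHd) D.+1 I1.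
apply: run_within_conseq (H _ _ _) => {H} //=; first by rewrite /= subn0.
  move=> h' _ [[q [s tl qu hq cl] e]]; exists q => // x y yq; apply: cl.
  by move: e; rewrite tl; case: ltnP => // sh _; rewrite (leq_trans _ sh) // index_mem.
move=> h2 [q [sq tl qu hq cq]] f2; rewrite boolE tl => hds.
have en2 : env h2 by apply: env_frame f2 _.
have qn : size q <= n.
  by rewrite -(card_uniqP (search_uniq sq)) -[X in _ <= X]card_ord max_card.
have [q1 [y [q2 [eq1 sq1]]]] := split_at hds.
have yE : nths q (hreg h2 rHd) = y.
  by rewrite eq1 map_cat nth_cat size_map sq1 ltnn subnn.
have yq : y \in q by rewrite eq1 mem_cat mem_head orbT.
have yi : index y q = hreg h2 rHd.
  rewrite eq1 index_cat; have := search_uniq sq; rewrite eq1 cat_uniq => /and3P[_ /hasPn /(_ y)].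
  by rewrite mem_head => /(_ isT) /= /negPf-> _; rewrite eqxx addn0.
have [fr2 _ _] := f2.
apply: run_within_seq; apply: run_within_straight => //=; rewrite qu // yE.
apply: run_within_seq.
have := @run_within_forcl rK rY rX _ (set_hreg h2 rY y) y 1 (fun s1 h' => exists q', 
   [/\ searching (hreg h2 rHd) q' h', index y q' = hreg h2 rHd, hreg h2 rHd < size q' &
     forall x, x \in s1 -> gk G a b x y -> x \in q']).
rewrite muln1 => H; apply: run_within_conseq (H _ _ _ _ _ _ _) => {H} //=.
- by rewrite ltnS size_cls_D.
- move=> h3 _ [f3 [q' [[s' tl' qu' hq' cq'] yi' hs' H]]].
  have [fr3 _ _] := f3; apply: run_within_straight => //=; rewrite fr3 //=.
  rewrite addn1; split; last by rewrite ltn_sub2l // (leq_trans hds).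
  exists q'; split=> //=; first by case: s' => *; split.
  move=> x z; rewrite ltnS leq_eqVlt => /orP[/eqP zi|zi]; last exact: cq'.
  have zq : z \in q' by rewrite -index_mem zi.
  have -> : z = y by rewrite -(nth_index b zq) zi -yi' nth_index // -index_mem yi'.
  by move=> g; apply: H => //; rewrite mem_cls; case/andP: g.
- exact: env_set_hreg.
- exists q; split=> //; split=> //; first by case: sq => *; split.
move=> s1 x s2 h3 es f3 [q' [[s' tl' qu' hq' cq'] yi' hs' H]].
have [fr3 fa3 _] := f3.
have en3 : env (set_hreg h3 rX x) by apply: env_set_hreg => //; apply: env_frame f3 _ => //; apply: env_set_hreg.
apply: run_within_if.
have -> : heval (set_hreg h3 rX x) (noe (HA aPar (HR rX)) |*| noe (inKe (HR rX) |*| inKe (HR rY)))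
   = (x \notin q') && ~~ ((x \in K G a b) && (y \in K G a b)).
  apply: mulE; first by rewrite /= -(search_mem s'); case: (harr _ _ _) => [|[]].
  by apply: noeE; apply: mulE; apply: inKeE => //=; rewrite fr3 //= fr2.
have cxy : cl G x y by rewrite -mem_cls es mem_cat mem_head orbT.
rewrite boolE; case: ifPn => [/andP[xq gx]|nths]; apply: run_within_straight => //=; last first.
  exists q'; split=> //.
    by split=> //; case: s' => *; split.
  move=> z; rewrite mem_rcons inE => /orP[/eqP-> /andP[_ g]|]; last exact: H.
  by move: nths; rewrite g andbT negbK.
have gxy : gk G a b x y by rewrite /gk cxy.
have yq' : y \in q' by rewrite -index_mem yi'.
have iy z : z \in q' -> index z (rcons q' x) = index z q'.
  by move=> zq; rewrite -cats1 index_cat zq.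
have ylt : (hreg h2 rHd < size (rcons q' x)) by rewrite size_rcons ltnS ltnW.
exists (rcons q' x); split=> //; last 2 first.
- by rewrite iy.
- by move=> z; rewrite !mem_rcons !inE => /orP[->//|zs] g; rewrite (H _ zs g) orbT.
split=> //=; last 3 first.
- move=> k; rewrite size_rcons ltnS leq_eqVlt tl' map_rcons nth_rcons size_map => /orP[/eqP->|kl].
    by rewrite eqxx ltnn.
  by rewrite kl (ltn_eqF kl) qu'.
- exact: ltnW.
- move=> u z; have [zq|zq] := boolP (z \in q').
    by rewrite iy // => zi g; rewrite mem_rcons inE (cq' _ _ zi g) orbT.
  rewrite -cats1 index_cat (negPf zq) => lt.
  by have := leq_trans (leq_addr _ _) (ltnW lt); rewrite leqNgt hs'.
split=> //=.
- move=> z; rewrite fr3 //= mem_rcons inE eqoE; case: (z =P x) => _ /=; first by rewrite addn1.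
  exact: search_mem.
- by rewrite rcons_uniq xq (search_uniq s').
- have [bq pb] := search_root s'; rewrite mem_rcons inE bq orbT eqoE; split=> //.
  by case: eqP => [e|_] //; rewrite -e bq in xq.
move=> z; rewrite mem_rcons inE eqoE => /orP[/eqP->|zq] zb.
  rewrite eqxx; exists y; first by rewrite fr3 //= addn1.
  split=> //; rewrite ?mem_rcons ?inE ?yq' ?orbT ?(iy _ yq') //.
    by rewrite -cats1 index_cat (negPf xq) /= eqxx addn0 yi'.
  move=> t; rewrite yi' mem_rcons inE => /orP[/eqP->|tq].
    rewrite -cats1 index_cat (negPf xq) /= eqxx addn0 => lt.
    by have := ltn_trans lt hs'; rewrite ltnn.
  rewrite iy // => ti; apply: contra xq; exact: cq'.
have [t pt ft] := search_par s' zq zb; exists t; last exact: first_parent_rcons.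
by case: eqP => [e|_] //; rewrite -e zq in xq.
by rewrite tl' size_rcons addn1.
Qed.

Lemma search_path q h : search q h -> a \in q -> exists p len,
  [/\ chordless G a b p len, len < n,
      forall i, i < len -> p i != b
    & forall i, i < len -> harr h aPar (p i) = (p i.+1).+1].
Proof.
move=> s aq; pose par (x : 'I_n) := odflt x (insub (harr h aPar x).-1).
have parP x : x \in q -> x != b -> harr h aPar x = (par x).+1 /\ first_parent q x (par x).
  move=> xq xb; have [y py fy] := search_par s xq xb.
  by rewrite /par py /= valK.
have H k x : x \in q -> index x q <= k -> exists len,
    [/\ iter len par x = b, len <= k & forall i, i < len -> iter i par x != b].
  elim: k x => [|k IH] x xq xk; have [xb|xb] := eqVneq x b.
  - by exists 0.
  - have [_ [_ lt _ _]] := parP x xq xb.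
    by rewrite leqn0 in xk; rewrite (eqP xk) in lt.
  - by exists 0.
  have [_ [pq lt _ _]] := parP x xq xb.
  have [|len [e1 e2 e3]] := IH (par x) pq; first by rewrite -ltnS (leq_trans lt).
  exists len.+1; rewrite iterSr; split=> // -[|i] //; rewrite ltnS iterSr; exact: e3.
have [len [e1 e2 e3]] := H _ a aq (leqnn _).
pose p i := iter i par a; exists p, len.
have pq i : i <= len -> p i \in q.
  elim: i => // i IH il; have [_ [pq _ _ _]] := parP _ (IH (ltnW il)) (e3 _ il).
  exact: pq.
have par_p i : i < len -> harr h aPar (p i) = (p i.+1).+1 /\ first_parent q (p i) (p i.+1).
  by move=> il; apply: (parP _ (pq _ (ltnW il)) (e3 _ il)).
have dec i j : i < j -> j <= len -> index (p j) q < index (p i) q.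
  elim: j => // j IH; rewrite ltnS leq_eqVlt => ij jl.
  have [_ [_ lt _ _]] := par_p _ jl.
  case/orP: ij => [/eqP->//|ij]; exact: ltn_trans lt (IH ij (ltnW jl)).
have qn : size q <= n.
  by rewrite -(card_uniqP (search_uniq s)) -[X in _ <= X]card_ord max_card.
split=> //; last by move=> i /par_p[].
  split=> //.
  - by move=> i /par_p[_ []].
  - move=> i il; have [_ [_ lt g _]] := par_p _ il; case/andP: g => g _.
    by apply: (cl_neq g); apply: contraTneq lt => <-; rewrite ltnn.
  move=> i j ij jl; have il : i < len by apply: leq_trans jl; apply: ltnW.
  have [_ [_ _ _ mn]] := par_p _ il; apply: mn; first exact: pq.
  exact: dec.
by apply: leq_ltn_trans e2 _; rewrite (leq_trans _ qn) // index_mem.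
Qed.

Section Walk.
Variables (p : nat -> 'I_n) (len : nat) (par : nat -> nat).
Hypothesis chd : chordless G a b p len.
Hypothesis len_n : len < n.
Hypothesis pb : forall i, i < len -> p i != b.
Hypothesis parP : forall i, i < len -> par (p i) = (p i.+1).+1.

Notation Li := (L G p).

Lemma p_len : p len = b. Proof. by case: chd. Qed.
Lemma p_0 : p 0 = a. Proof. by case: chd. Qed.

Lemma eq_pb i : i <= len -> (p i == b) = (i == len).
Proof.
rewrite leq_eqVlt => /orP[/eqP->|il]; first by rewrite p_len !eqxx.
by rewrite (negPf (pb il)) (ltn_eqF il).
Qed.

(* [hi x] is one more than the last [i < k] with [x] in [L_i], or [0]. *)
Definition last_clique k (hi : nat -> nat) := forall x : 'I_n,
  (forall j, j < k -> x \in Li j -> j < hi x) /\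
  (hi x != 0 -> (hi x).-1 < k /\ x \in Li (hi x).-1).

Lemma run_hi h : env h -> hreg h rA = a -> hreg h rB = b ->
  harr h aPar = par -> (forall x : 'I_n, harr h aHi x = 0) ->
  run_within c_hi h (n.+1 * D.+1) (fun h' => last_clique len (harr h' aHi)).
Proof.
move=> en ha hb hp hi0.
do 2!(apply: run_within_seq; apply: run_within_straight => //); set h1 := sexec _ _.
have en1 : env h1 by case: en => *; split.
pose I h' := exists2 i, i <= len &
   [/\ hreg h' rU = p i, hreg h' rI = i.+1 & last_clique i (harr h' aHi)].
have I1 : I h1.
  exists 0 => //; split=> //=; first by rewrite ha p_0.
  by move=> x; split=> //; rewrite hi0.
have H := @run_within_while (noe (HR rU |=| HR rB)) _ h1 I (fun h' => n - hreg h' rI) D.+1 I1.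
apply: run_within_conseq (H _ _ _) => {H} //=.
- by rewrite leq_mul2r ltnS leq_subr orbT.
- move=> h' f [[i il [hu _ lc]] e]; have [fr _ _] := f.
  suff -> : len = i by [].
  have hb' : hreg h' rB = b by rewrite fr.
  by apply/eqP; move: e; rewrite hu hb' eqoE eq_pb // [i == _]eq_sym; case: eqP.
move=> h2 [i il [hu hI lc]] f2; have [fr2 fa2 _] := f2.
have hb2 : hreg h2 rB = b by rewrite fr2.
rewrite hu hb2 eqoE eq_pb // => iL.
have {}il : i < len by rewrite ltn_neqAle il andbT; case: (i == len) iL.
have en2 : env h2 by apply: env_frame f2 _.
apply: run_within_seq; apply: run_within_straight => //=.
have -> : harr h2 aPar (hreg h2 rU) - 1 = p i.+1 by rewrite fa2 //= hp hu parP // subn1.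
apply: run_within_seq.
have := @run_within_forcl rK rV rX _ (set_hreg h2 rV (p i.+1)) (p i.+1) 1 (fun s1 h' =>
   forall x : 'I_n, harr h' aHi x = if (x \in s1) && cl G x (p i) then i.+1 else harr h2 aHi x).
rewrite muln1 => H; apply: run_within_conseq (H _ _ _ _ _ _ _) => {H} //=.
- by rewrite ltnS size_cls_D.
- move=> h3 _ [f3 H]; have [fr3 _ _] := f3; apply: run_within_straight => //=.
  rewrite /I /= !fr3 //= hI addn1; split; last first.
    by rewrite ltn_sub2l // (leq_ltn_trans il).
  exists i.+1 => //; split=> // x; rewrite !H mem_cls; have [lc1 lc2] := lc x.
  have -> : cl G x (p i.+1) && cl G x (p i) = (x \in Li i) by rewrite inE andbC.
  case: ifP => [xL|xL]; split=> //=.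
    by move=> j; rewrite ltnS leq_eqVlt => /orP[/eqP->|jl xj]; [rewrite xL|apply: lc1].
  by move=> h0; have [? ?] := lc2 h0; split=> //; apply: ltnW.
- exact: env_set_hreg.
move=> s1 x s2 h3 es f3 H; have [fr3 fa3 _] := f3.
have en3 : env (set_hreg h3 rX x) by apply: env_set_hreg => //; apply: env_frame f3 _ => //; apply: env_set_hreg.
apply: run_within_if.
rewrite (@cleE _ _ _ x (p i)) ?boolE //=; last by rewrite fr3.
case: ifP => c; apply: run_within_straight => //= y; rewrite mem_rcons inE.
  rewrite eqoE H; case: eqP => [->|_] //=; by rewrite c fr3.
by rewrite H; case: eqP => [->|_] //=; rewrite c andbF.
Qed.

Variable hi : nat -> nat.
Hypothesis hiP : last_clique len hi.

Notation st h x := (harr h aSt x).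

Record marked i (h : hstate) : Prop := Marked {
  mk_hi : harr h aHi = hi;
  mk_stage : hreg h rI = i.+1;
  mk_queue : forall k, k < hreg h rTl -> exists2 x : 'I_n, harr h aQu k = x & st h x = 2;
  mk_queued : forall x : 'I_n, st h x = 2 -> exists2 k, k < hreg h rTl & harr h aQu k = x;
  mk_early : forall x : 'I_n, st h x = 2 -> hi x <= i.+1;
  mk_max : forall x : 'I_n, st h x != 0 -> hi x <= hreg h rM;
  mk_attained : hreg h rM = 0 \/ exists2 x : 'I_n, st h x != 0 & hi x = hreg h rM;
  mk_sep : forall j V, i <= j -> sep G a b p len j V -> forall x : 'I_n, st h x != 0 -> x \in V;
  mk_st : forall x : 'I_n, st h x <= 2
}.

(* Constant while vertices are enqueued, so that [potential h - hreg h rHd]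
   bounds the number of vertices still to be scanned. *)
Definition potential (h : hstate) := #|[set x : 'I_n | st h x != 2]| + hreg h rTl.

Definition ext (h h' : hstate) :=
  [/\ forall x : 'I_n, st h x != 0 -> st h' x != 0,
      hreg h rTl <= hreg h' rTl,
      forall k, k < hreg h rTl -> harr h' aQu k = harr h aQu k
    & potential h' = potential h].

Lemma ext_trans h1 h2 h3 : ext h1 h2 -> ext h2 h3 -> ext h1 h3.
Proof.
case=> a1 a2 a3 a4 [b1 b2 b3 b4]; split=> [x|||].
- by move/a1/b1.
- exact: leq_trans a2 b2.
- by move=> k kl; rewrite b3 ?a3 // (leq_trans kl).
- by rewrite b4.
Qed.

Definition safe i (x : 'I_n) := forall j V, i <= j -> sep G a b p len j V -> x \in V.

Lemma mark_step i h (x : 'I_n) : marked i h -> safe i x -> st h x = 0 ->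
  let h1 := set_harr h aSt x 1 in
  let h' := if hreg h rM < hi x then set_hreg h1 rM (hi x) else h1 in
  marked i h' /\ ext h h'.
Proof.
move=> mk sx s0 h1 h'.
have stE (y : 'I_n) : st h' y = if y == x then 1 else st h y.
  by rewrite /h'; case: ifP => _ /=; rewrite eqoE.
have quE : harr h' aQu = harr h aQu by rewrite /h'; case: ifP.
have tlE : hreg h' rTl = hreg h rTl by rewrite /h'; case: ifP.
have st2 (y : 'I_n) : (st h' y == 2) = (st h y == 2).
  by rewrite stE; case: (y =P x) => [->|_] //; rewrite s0.
have mE : hreg h' rM = maxn (hreg h rM) (hi x) by rewrite /h' /maxn; case: ifP.
split; split; rewrite ?tlE ?quE //.
- by rewrite -(mk_hi mk) /h'; case: ifP.
- by rewrite -(mk_stage mk) /h'; case: ifP.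
- move=> k kt; have [y qy sy] := mk_queue mk kt; exists y => //.
  by apply/eqP; rewrite st2 sy.
- by move=> y /eqP; rewrite st2 => /eqP /(mk_queued mk).
- by move=> y /eqP; rewrite st2 => /eqP /(mk_early mk).
- move=> y; rewrite stE mE leq_max; case: (y =P x) => [->|_]; first by rewrite leqnn orbT.
  by move/(mk_max mk)->.
- right; have sx' : st h' x != 0 by rewrite stE eqxx.
  rewrite mE; case: (leqP (hi x) (hreg h rM)) => le; last by exists x.
  case: (mk_attained mk) => [e|[y sy e]]; first by exists x => //; move: le; rewrite e leqn0 => /eqP.
  by exists y => //; rewrite stE; case: (y == x).
- move=> j V ij sV y; rewrite stE; case: (y =P x) => [-> _|_]; first exact: sx ij sV.
  exact: (mk_sep mk ij sV).
- by move=> y; rewrite stE; case: (y == x) => //; apply: (mk_st mk).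
- by move=> y; rewrite stE; case: (y == x).
- rewrite /potential tlE; congr (_ + _); apply: eq_card => y; by rewrite !inE st2.
Qed.

Lemma push_step i h (x : 'I_n) : marked i h -> st h x = 1 -> hi x <= i.+1 ->
  let h' := set_hreg (set_harr (set_harr h aSt x 2) aQu (hreg h rTl) x) rTl (hreg h rTl + 1) in
  marked i h' /\ ext h h'.
Proof.
move=> mk s1 hx h'; have stE (y : 'I_n) : st h' y = if y == x then 2 else st h y.
  by rewrite /= eqoE.
have st0 (y : 'I_n) : (st h' y != 0) = (st h y != 0).
  by rewrite stE; case: (y =P x) => [->|_] //; rewrite s1.
split; split; rewrite //=.
- exact: mk_hi mk.
- exact: mk_stage mk.
- move=> k; rewrite addn1 ltnS leq_eqVlt; case: eqP => [_ _|_ /= kt].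
    by exists x => //; rewrite eqxx.
  have [y qy sy] := mk_queue mk kt; exists y => //.
  by rewrite eqoE sy; case: eqP.
- move=> y; rewrite eqoE; case: (y =P x) => [-> _|_ /(mk_queued mk)[k kt qk]].
    by exists (hreg h rTl); rewrite ?addn1 // eqxx.
  by exists k; rewrite ?addn1 ?(leqW kt) // (ltn_eqF kt).
- by move=> y; rewrite eqoE; case: (y =P x) => [->|_] // /(mk_early mk).
- by move=> y; rewrite eqoE => H; apply: (mk_max mk); rewrite -st0 stE.
- case: (mk_attained mk) => [|[y sy e]]; [by left|right; exists y => //].
  by have := st0 y; rewrite stE eqoE sy => ->.
- by move=> j V ij sV y; rewrite eqoE => H; apply: (mk_sep mk ij sV); rewrite -st0 stE.
- by move=> y; rewrite eqoE; case: eqP => // _; apply: (mk_st mk).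
- by move=> y; rewrite eqoE -stE st0.
- by rewrite leq_addr.
- by move=> k kt; rewrite (ltn_eqF kt).
rewrite /potential /= addn1 addnS -addSn; congr (_ + _).
rewrite [in RHS](cardsD1 x) inE s1 /= add1n; congr _.+1.
by apply: eq_card => y; rewrite !inE eqoE; case: (y =P x).
Qed.

Lemma visit_step i h e (c : bool) (x : 'I_n) : marked i h -> hreg h rX = x ->
  heval h e = c -> (c -> safe i x) ->
  let h' := sexec (c_visit e) h in
  [/\ marked i h', ext h h', (c -> st h' x != 0), (st h' x = 1 -> i.+1 < hi x)
    & forall y : 'I_n, y != x -> st h' y = st h y].
Proof.
move=> mk hx he sx; rewrite /c_visit [sexec _ _]/=.
set h1 := if _ then _ else h.
have [mk1 ex1 c1 o1 x1] : [/\ marked i h1, ext h h1, (c -> st h1 x != 0),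
    forall y : 'I_n, y != x -> st h1 y = st h y & hreg h1 rX = x].
  rewrite /h1 he hx; case: c he sx {h1} => he sx; last first.
    by rewrite mul0n /=; split.
  rewrite mul1n; case s0: (st h x) => [|k] /=; last by split=> //; rewrite s0.
  have := mark_step mk (sx isT) s0; rewrite /= (mk_hi mk).
  case: (_ < _) => /= -[mk1 ex1]; split=> //=; rewrite ?eqxx // => y; by rewrite eqoE => /negPf->.
rewrite x1 (mk_hi mk1) (mk_stage mk1).
have -> : ((st h1 x == 1) * (1 - (i.+1 < hi x)) != 0) = (st h1 x == 1) && (hi x <= i.+1).
  by rewrite [hi x <= _]leqNgt; case: (st h1 x == 1); case: (_ < _).
case: ifPn => [/andP[/eqP s1 hl']|n1].
  have [mk2 ex2] := push_step mk1 s1 hl'; split=> //=.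
  - exact: ext_trans ex1 ex2.
  - by rewrite eqxx.
  - by rewrite eqxx.
  - by move=> y yx; rewrite eqoE (negPf yx) o1.
split=> // s1; by move: n1; rewrite s1 /= -ltnNge.
Qed.

Lemma marked_set_hreg i h r v : r \in [:: rK; rX] -> marked i h -> marked i (set_hreg h r v).
Proof. by rewrite !inE => /orP[]/eqP-> [*]; split. Qed.

Lemma run_visits i h z e (cnd : 'I_n -> bool) (v : 'I_n) :
  okcl rK z rX (c_visit e) -> env h -> hreg h z = v -> marked i h ->
  (forall h1 (x : 'I_n), env h1 -> frame (forcl rK z rX (c_visit e)) h h1 -> hreg h1 rX = x ->
     x \in cls v -> heval h1 e = cnd x) ->
  (forall x, x \in cls v -> cnd x -> safe i x) ->
  run_within (forcl rK z rX (c_visit e)) h D.+1 (fun h' =>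
    [/\ frame (forcl rK z rX (c_visit e)) h h', marked i h', ext h h',
        forall x, x \in cls v -> (cnd x -> st h' x != 0) /\ (st h' x = 1 -> i.+1 < hi x)
      & forall x : 'I_n, st h' x = 1 -> i.+1 < hi x \/ st h x = 1]).
Proof.
move=> ok en hz mk ce cs.
have := @run_within_forcl rK z rX (c_visit e) h v 1 (fun s1 h' => [/\ marked i h', ext h h',
        forall x, x \in s1 -> (cnd x -> st h' x != 0) /\ (st h' x = 1 -> i.+1 < hi x)
      & forall x : 'I_n, st h' x = 1 -> i.+1 < hi x \/ st h x = 1]).
rewrite muln1 => H; apply: run_within_conseq (H _ _ _ _ _ _) => {H} //.
- by rewrite ltnS size_cls_D.
- by move=> h' _ [f []].
- by split=> //; [apply: marked_set_hreg|right].
move=> s1 x s2 h1 es f1 [mk1 ex1 v1 o1]; apply: run_within_straight => //.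
have xv : x \in cls v by rewrite es mem_cat mem_head orbT.
have fx : frame (forcl rK z rX (c_visit e)) h (set_hreg h1 rX x).
  case: f1 => fr fa fio; split=> // r kr; have [E|ne] := eqVneq r rX.
    by move: kr; rewrite E /forcl /forn /= ?andbF.
  by rewrite -(fr _ kr) /= eqnE (negPf ne).
have en1 : env (set_hreg h1 rX x).
  apply: env_frame fx _ => //; by case/andP: ok => /and5P[_ _ _ _ _].
have mk1' : marked i (set_hreg h1 rX x) by apply: marked_set_hreg.
have := visit_step mk1' (erefl (hreg (set_hreg h1 rX x) rX)) (ce _ _ en1 fx erefl xv) (cs _ xv).
set h2 := sexec _ _; case=> mk2 ex2 c2 p2 o2; split.
- exact: marked_set_hreg.
- exact: ext_trans ex1 ex2.
- move=> y; rewrite mem_rcons inE; have [->|yx] /= := eqVneq y x; first by [].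
  by rewrite o2 //; apply: v1.
- move=> y /=; have [->|yx] := eqVneq y x; first by move/p2; left.
  by rewrite o2 //; apply: o1.
Qed.

Definition closed_at i (h : hstate) (y : 'I_n) := forall x : 'I_n, gk G a b x y ->
  st h x != 0 \/ x \in Li i /\ (x \in K G a b \/ y \in Li i).

Definition closed_upto i hd h :=
  forall k (y : 'I_n), k < hd -> harr h aQu k = y -> closed_at i h y.

Definition pending i (h : hstate) := forall x : 'I_n, st h x = 1 -> i < hi x.

Lemma closed_ext i hd h h' : ext h h' -> hd <= hreg h rTl ->
  closed_upto i hd h -> closed_upto i hd h'.
Proof.
case=> e1 _ e3 _ hl' cl k y kh; rewrite e3 ?(leq_trans kh) // => qy x g.
by case: (cl k y kh qy x g) => [/e1|]; [left|right].
Qed.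

Definition at_stage i (h : hstate) := [/\ env h, hreg h rA = a, hreg h rB = b,
  hreg h rU = p i & hreg h rV = p i.+1].

Lemma run_grow i h : i < len -> at_stage i h -> marked i h -> pending i.+1 h ->
  hreg h rHd <= hreg h rTl -> closed_upto i (hreg h rHd) h ->
  run c_grow h (fun X h' => [/\ marked i h', pending i.+1 h', hreg h' rHd = hreg h' rTl,
     closed_upto i (hreg h' rHd) h' /\ ext h h'
     & X + (potential h' - hreg h' rHd) * D.+1 <= ((potential h - hreg h rHd) * D.+1).+1]).
Proof.
move=> il [en ha hb hu hv] mk pe hl' cl.
pose I h' := [/\ marked i h', pending i.+1 h', hreg h' rHd <= hreg h' rTl,
     closed_upto i (hreg h' rHd) h' & ext h h'].
have I0 : I h by split.
have H := @run_while (HR rHd |<| HR rTl) _ h I (fun h' => (potential h' - hreg h' rHd) * D.+1) I0.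
apply: run_conseq (H _ _) => {H}.
  move=> X h' [[i1 i2 i3 i4 i5] e le]; split=> //.
  by apply/eqP; rewrite eqn_leq i3 leqNgt; move: e => /=; case: (_ < _).
move=> h1 [mk1 pe1 hl1 cl1 ex1] f1 /=; rewrite boolE => lt.
have [fr1 _ _] := f1.
have en1 : env h1 by apply: env_frame f1 _.
have [y qy sy] := mk_queue mk1 lt.
have hy := mk_early mk1 sy.
apply: run_seq; apply: run_straight => //=; rewrite qy.
set h2 := set_hreg h1 rY y.
have en2 : env h2 by apply: env_set_hreg.
have mk2 : marked i h2 by case: mk1 => *; split.
pose cnd x := ~~ ((x \in K G a b) && (y \in K G a b)) && ~~ ((x \in Li i) && (y \in Li i)).
apply: run_seq; apply: run_conseq (@run_visits i h2 rY _ cnd y _ en2 _ mk2 _ _) => //=; last 2 first.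
- move=> h3 x en3 [fr3 _ _] hx _; have [hU hV] : hreg h3 rU = p i /\ hreg h3 rV = p i.+1.
    by rewrite !fr3 //= !fr1.
  have [hA hB] : hreg h3 rA = a /\ hreg h3 rB = b by rewrite !fr3 //= !fr1.
  have hY : hreg h3 rY = y by rewrite fr3.
  change (heval h3 grow_e = cnd x).
  by apply: mulE; apply: noeE; apply: mulE; first [exact: inKeE|exact: inLeE].
- move=> x; rewrite mem_cls => cxy /andP[nk nl] j V ij sV.
  have yV := mk_sep mk1 ij sV (_ : st h1 y != 0); rewrite sy in yV; move: (yV isT) => {}yV.
  case: (sV) => -[jl _ _ _] _ _ _ cl5.
  have g : gk G a b x y by rewrite /gk cxy nk.
  case: (cl5 x y yV g) => // -[xL yL].
  move: ij; rewrite leq_eqVlt => /orP[/eqP ij|ij]; first by rewrite ij xL yL in nl.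
  by have [/(_ j jl yL)] := hiP y; rewrite ltnNge (leq_trans hy).
move=> X1 h3 [X1D [f3 mk3 ex3 v3 o3]].
have ex13 : ext h1 h3 by case: ex3 => *; split.
have [fr3 fa3 _] := f3.
have hd3 : hreg h3 rHd = hreg h1 rHd by rewrite fr3.
have [_ tl3 qu3 pot3] := ex13.
have lt3 : hreg h3 rHd < hreg h3 rTl by rewrite hd3 (leq_trans lt).
apply: run_straight => //=; split; last first.
  rewrite /= hd3 addn1 -/(potential _); have -> : potential (set_hreg h3 rHd (hreg h1 rHd).+1) = potential h3 by [].
  rewrite pot3 (leq_trans (n := D.+1 + (potential h1 - (hreg h1 rHd).+1) * D.+1)) //.
    by rewrite leq_add2r !geq_max X1D.
  by rewrite -mulSn subnSK // -pot3 /potential (leq_trans (leq_trans lt tl3)) // leq_addl.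
split=> /=; rewrite ?addn1 //.
- by case: mk3 => *; split.
- by move=> x /o3 [] //; apply: pe1.
- move=> k z; rewrite ltnS leq_eqVlt hd3 => /orP[/eqP->|kl]; last first.
    by apply: (closed_ext ex13 (ltnW lt) cl1).
  rewrite qu3 // qy => /ord_inj <- x g.
  have xc : x \in cls y by rewrite mem_cls; case/andP: g.
  have [v31 _] := v3 x xc; have [c|] := boolP (cnd x); first by left; apply: v31.
  case/andP: g => _ nk; rewrite /cnd nk /= negbK => /andP[xL yL].
  by right; split=> //; right.
- by apply: ext_trans ex1 _; case: ex13 => *; split.
Qed.

Lemma run_size h : env h -> hreg h rA = a -> hreg h rB = b ->
  run_within c_size h D.+1 (fun h' => hreg h' rS = #|K G a b|).
Proof.
move=> en ha hb; apply: run_within_seq; apply: run_within_straight => //=.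
have := @run_within_forcl rK rA rX _ (set_hreg h rS 0) a 1 (fun s1 h' =>
   hreg h' rS = count (fun x => cl G x b) s1).
rewrite muln1 => H; apply: run_within_conseq (H _ _ _ _ _ _ _) => {H} //=.
- by rewrite ltnS size_cls_D.
- move=> h' _ [_ ->]; rewrite -size_filter -(card_uniqP (filter_uniq _ (uniq_cls a))).
  by apply: eq_card => x; rewrite mem_filter mem_cls inE andbC.
- exact: env_set_hreg.
move=> s1 x s2 h3 es f3 H; have [fr3 fa3 _] := f3.
have en3 : env (set_hreg h3 rX x) by apply: env_set_hreg => //; apply: env_frame f3 _ => //; apply: env_set_hreg.
apply: run_within_if.
rewrite (@cleE _ _ _ x b) ?boolE //=; last by rewrite fr3.
case: ifP => c; apply: run_within_straight => //=; rewrite -cats1 count_cat /= c H ?addn0 //.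
Qed.

Lemma run_check i h : at_stage i h -> hreg h rS = #|K G a b| ->
  run_within c_check h D.+1 (fun h' => frame c_check h h' /\
    (hreg h' rD <= hreg h' rC) && (hreg h' rE == 0) =
    [forall x in K G a b :&: Li i, (#|nbhd G x| <= #|K G a b :|: Li i|) && (st h x == 0)]).
Proof.
move=> [en ha hb hu hv] hs.
suff Hs : run_within c_check h D.+1 (fun h' => 
    [/\ hreg h' rC = #|K G a b| + count (fun x => cl G x (p i) && (x \notin K G a b)) (cls (p i.+1)),
       forall c, (hreg h' rD <= c) = all (fun x => [&& cl G x (p i) & x \in K G a b] ==> (size (cls x) <= c)) (cls (p i.+1))
    & (hreg h' rE == 0) = all (fun x => [&& cl G x (p i) & x \in K G a b] ==> (st h x == 0)) (cls (p i.+1))]).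
  apply: run_within_conseq Hs => // h' f [e1 e2 e3]; split=> //.
  have eC : hreg h' rC = #|K G a b :|: Li i|.
    rewrite e1 cardsU -addnBA ?subset_leq_card ?subsetIr //; congr (_ + _).
    rewrite setIC -cardsD -size_filter -(card_uniqP (filter_uniq _ (uniq_cls _))).
    apply: eq_card => x; rewrite mem_filter mem_cls !inE.
    by case: (cl G x (p i)); case: (cl G x (p i.+1)); rewrite ?andbT ?andbF.
  rewrite e2 e3 eC; apply/andP/forallP => [[/allP H1 /allP H2] x|H].
    apply/implyP; rewrite in_setI [x \in Li i]inE => /and3P[xK x1 x2].
    have := H1 x; have := H2 x; rewrite mem_cls x2 x1 xK size_cls /= => /(_ isT) H3 /(_ isT) H4.
    by rewrite H3 H4.
  have HH x : x \in cls (p i.+1) -> cl G x (p i) && (x \in K G a b) ->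
     (#|nbhd G x| <= #|K G a b :|: Li i|) && (st h x == 0).
    rewrite mem_cls => x2 /andP[x1 xK]; have /implyP := H x; apply.
    by rewrite in_setI xK inE x1.
  split; apply/allP => x xc; apply/implyP => /(HH x xc) /andP[].
    by rewrite size_cls.
  by [].
do 3!(apply: run_within_seq; apply: run_within_straight => //); set h1 := sexec _ _.
have en1 : env h1 by case: en => *; split.
have := @run_within_forcl rK rV rX _ h1 (p i.+1) 1 (fun s1 h' => 
    [/\ hreg h' rC = #|K G a b| + count (fun x => cl G x (p i) && (x \notin K G a b)) s1,
       forall c, (hreg h' rD <= c) = all (fun x => [&& cl G x (p i) & x \in K G a b] ==> (size (cls x) <= c)) s1
    & (hreg h' rE == 0) = all (fun x => [&& cl G x (p i) & x \in K G a b] ==> (st h x == 0)) s1]).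
rewrite muln1 => H; apply: run_within_conseq (H _ _ _ _ _ _ _) => {H} //=.
- by rewrite ltnS size_cls_D.
- by move=> h' _ [].
- by split=> //; rewrite hs addn0.
move=> s1 x s2 h3 es f3 [g1 g2 g3]; have [fr3 fa3 _] := f3.
have en3 : env (set_hreg h3 rX x) by apply: env_set_hreg => //; apply: env_frame f3 _.
apply: run_within_if.
rewrite (@cleE _ _ _ x (p i)) ?boolE //=; last by rewrite fr3.
case: ifP => c; last first.
  apply: run_within_straight => //=; rewrite -cats1 count_cat /= c /= !addn0; split=> //.
    by move=> d; rewrite g2 all_cat /= c /= andbT.
  by rewrite g3 all_cat /= c /= andbT.
apply: run_within_if; rewrite (@inKeE _ _ a b x) ?boolE //=; try by rewrite fr3.
case: ifP => cK; last first.
  apply: run_within_straight => //=; rewrite -cats1 count_cat /= c cK /= g1 -addnA; split=> //.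
    by move=> d; rewrite g2 all_cat /= c cK /= andbT.
  by rewrite g3 all_cat /= c cK /= andbT.
apply: run_within_straight => //.
have dE : harr h3 aDeg x = size (cls x) by rewrite fa3 // (env_deg en1).
have sE : st h3 x = st h x by rewrite fa3.
rewrite [sexec _ _]/= dE; set h4 := (X in if _ then _ else X).
have [r1 r2 r3 r4 r5] : [/\ harr h4 = harr h3, hreg h4 rC = hreg h3 rC, hreg h4 rE = hreg h3 rE,
     hreg h4 rX = x & hreg h4 rD = maxn (hreg h3 rD) (size (cls x))].
  by rewrite /h4 /= boolE /maxn; case: (hreg h3 rD < size (cls x)).
rewrite r4 r1 sE -cats1 count_cat /= c cK /= !addn0.
split=> /=; first by case: ifP => _ /=; rewrite r2 g1.
  move=> d; rewrite all_cat /= c cK /= andbT -g2 -geq_max -r5; by case: ifP.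
rewrite all_cat /= c cK /= andbT -g3; case: (st h x == 0) => /=; first by rewrite r3 andbT.
by rewrite andbF.
Qed.

Definition closed_before i hd (h : hstate) := forall k (y x : 'I_n),
  k < hd -> harr h aQu k = y -> gk G a b x y ->
  st h x != 0 \/ [/\ 0 < i, x \in Li i.-1 & x \in K G a b \/ y \in Li i.-1].

Definition stage_start i (h : hstate) :=
  [/\ hreg h rU = p i /\ (0 < i -> hreg h rW = p i.-1), marked i h, pending i h,
      hreg h rHd = hreg h rTl /\ closed_before i (hreg h rHd) h
    & (forall j, j < i -> st h (p j) != 0) /\ (forall j V, j < i -> ~ sep G a b p len j V)].

Definition found i (h : hstate) :=
  [/\ hreg h rU = p i, hreg h rV = p i.+1
    & accepts G a b p len i [set x : 'I_n | st h x != 0]].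

Record sweep_env (h : hstate) : Prop := SweepEnv {
  sw_env : env h;
  sw_a : hreg h rA = a;
  sw_b : hreg h rB = b;
  sw_size : hreg h rS = #|K G a b|;
  sw_good : forall x y, G x y -> harr h aGood (x * n + y) = good G x y;
  sw_par : harr h aPar = par
}.

Hypothesis gab : good G a b.

Lemma noe0 h e : heval h (noe e) = (heval h e == 0).
Proof. by rewrite /=; case: (heval h e) => // k; rewrite subSS sub0n. Qed.

Lemma seed_safe i (x : 'I_n) : x \in cls (p i) ->
  (x == p i) || ((0 < i) && cl G x (p i.-1) && ~~ ((x \in K G a b) && (x \in Li i))) ->
  safe i x.
Proof.
rewrite mem_cls => xc /orP[/eqP->|/andP[/andP[i0 xp] nths]] j V ij [_ [sv cl2] _ _ _].
  exact: sv.
have e : i.-1.+1 = i by rewrite prednK.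
by apply: (cl2 i.-1); rewrite ?e // inE e xp.
Qed.

Lemma sep_accepted i h V : sep G a b p len i V -> marked i h ->
  [&& hreg h rM <= i.+1, good G (p i) (p i.+1), p i \notin K G a b, p i.+1 \notin K G a b
    & [forall x in K G a b :&: Li i, (#|nbhd G x| <= #|K G a b :|: Li i|) && (st h x == 0)]].
Proof.
move=> sV mk; have inV := mk_sep mk (leqnn i) sV.
case: sV => -[il gi piK pi1K] _ cl3 [nV hub] _; rewrite gi piK pi1K /=; apply/andP; split.
  case: (mk_attained mk) => [->|[x sx <-]] //; rewrite leqNgt; apply/negP => lt.
  have [_ H] := hiP x; have h0 : hi x != 0 by case: (hi x) lt.
  have [H1 H2] := H h0; have := cl3 x (hi x).-1 (inV x sx) _ H1.
  by rewrite H2 -ltnS prednK ?lt0n // => /(_ lt).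
apply/forallP => x; apply/implyP; rewrite in_setI => /andP[xK xL]; rewrite hub //=.
by have := nV x xK xL; apply: contraNT => /inV.
Qed.

Lemma accepted i h : i < len -> marked i h -> pending i.+1 h ->
  hreg h rHd = hreg h rTl -> closed_upto i (hreg h rHd) h ->
  (forall j, j <= i -> st h (p j) != 0) ->
  [&& hreg h rM <= i.+1, good G (p i) (p i.+1), p i \notin K G a b, p i.+1 \notin K G a b
    & [forall x in K G a b :&: Li i, (#|nbhd G x| <= #|K G a b :|: Li i|) && (st h x == 0)]] ->
  accepts G a b p len i [set x : 'I_n | st h x != 0].
Proof.
move=> il mk pe hd cl sd /and5P[M gi piK pi1K /forallP ck]; split=> //.
- by move=> j ji; rewrite inE sd.
- move=> x j; rewrite inE => sx ij jl; apply/negP => xL.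
  have [H _] := hiP x; have := H j jl xL; rewrite ltnNge.
  by rewrite (leq_trans (mk_max mk sx)) // (leq_trans M).
- split=> x xK xL; have := ck x; rewrite in_setI xK xL /= => /andP[] // _.
  by rewrite inE negbK.
move=> x y; rewrite !inE => sy g.
have s2 : st h y = 2.
  have := mk_st mk y; case e : (st h y) sy => [|[|[|//]]] // _ _.
  by have := pe y e; rewrite ltnNge (leq_trans (mk_max mk _) M) // e.
have [k kt qk] := mk_queued mk s2; rewrite -hd in kt.
by have := cl k y kt qk x g; rewrite !inE.
Qed.

Lemma run_stage i h : i < len -> sweep_env h -> hreg h rF = 0 -> stage_start i h ->
  run c_stage h (fun X h' =>
    (hreg h' rF = 0 /\ stage_start i.+1 h' \/ hreg h' rF = 1 /\ found i h' /\ hreg h' rI = i.+1)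
    /\ X + (potential h' - hreg h' rHd) * D.+1 <= (potential h - hreg h rHd + 2) * D.+1).
Proof.
move=> il [en ha hb hs hg hp] hf [[hu hw] mk pe [hd clo] [sd rej]].
apply: run_seq; apply: run_straight => //=.
have -> : harr h aPar (hreg h rU) - 1 = p i.+1 by rewrite hp hu parP // subn1.
set h1 := set_hreg h rV (p i.+1).
have en1 : env h1 by apply: env_set_hreg.
have mk1 : marked i h1 by case: mk => *; split.
pose cnd x := (x == p i) || ((0 < i) && cl G x (p i.-1) && ~~ ((x \in K G a b) && (x \in Li i))).
apply: run_seq; apply: run_conseq (@run_visits i h1 rU seed_e cnd (p i) _ en1 _ mk1 _ _) => //; last 2 first.
- move=> h2 x en2 [fr2 _ _] hx xc.
  rewrite -[cnd x]negbK; apply: noeE; rewrite negb_or; apply: mulE.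
    by apply: noeE; rewrite /= hx fr2 //= hu eqoE.
  apply: noeE; apply: mulE.
    rewrite [LHS]/= fr2 // -[hreg h1 rI]/(hreg h rI) (mk_stage mk).
    case: (posnP i) => [->|i0]; first by rewrite mul0n.
    rewrite ltnS i0 mul1n; apply: cleE => //.
    by rewrite fr2 //=; apply: hw.
  have [A2 B2] : hreg h2 rA = a /\ hreg h2 rB = b by rewrite !fr2.
  have [U2 V2] : hreg h2 rU = p i /\ hreg h2 rV = p i.+1 by rewrite !fr2.
  by apply: noeE; apply: mulE; [apply: inKeE|apply: inLeE].
- by move=> x xc; apply: seed_safe xc.
move=> X2 h2 [X2D [f2 mk2 ex2 v2 o2]].
have [fr2 fa2 _] := f2.
have en2 : env h2 by apply: env_frame f2 _.
have pe2 : pending i h2.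
  by move=> x /o2[/ltnW //|]; apply: pe.
have cl2 : closed_upto i (hreg h2 rHd) h2.
  move=> k y kh qy x g; rewrite fr2 //= in kh; have [e1 _ e3 _] := ex2.
  have kt : k < hreg h1 rTl by rewrite -[hreg h1 rTl]/(hreg h rTl) -hd.
  have qy' : harr h aQu k = y by rewrite -qy e3.
  case: (clo k y x kh qy' g) => [/e1|[i0 xL xy]]; first by left.
  have [nK|/negPn/andP[xK xL']] := boolP (~~ ((x \in K G a b) && (x \in Li i))); last by right; split=> //; left.
  left; have xc : x \in cls (p i) by rewrite mem_cls; move: xL; rewrite inE prednK // => /andP[].
  have [v21 _] := v2 x xc; apply: v21; rewrite /cnd i0 nK andbT.
  by move: xL; rewrite inE => /andP[-> _]; rewrite orbT.
have sd2 j : j <= i -> st h2 (p j) != 0.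
  rewrite leq_eqVlt => /orP[/eqP->|ji].
    have pc : p i \in cls (p i) by rewrite mem_cls cl_refl.
    by have [v21 _] := v2 (p i) pc; apply: v21; rewrite /cnd eqxx.
  by have [e1 _ _ _] := ex2; apply: e1; apply: sd.
apply: run_seq; apply: run_conseq (@run_visits i h2 rV (HC 0) (fun _ => false) (p i.+1) _ en2 _ mk2 _ _) => //; last first.
  by rewrite fr2.
move=> X3 h3 [X3D [f3 mk3 ex3 v3 o3]].
have [fr3 fa3 _] := f3.
have en3 : env h3 by apply: env_frame f3 _.
have pe3 : pending i.+1 h3.
  move=> x s1; case: (o3 x s1) => // /pe2; rewrite leq_eqVlt => /orP[/eqP hx|//].
  have [_ H] := hiP x; have h0 : hi x != 0 by rewrite -hx.
  have [_] := H h0; rewrite -hx /= => xL.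
  have xc : x \in cls (p i.+1) by rewrite mem_cls; move: xL; rewrite inE => /andP[].
  by have [_ v31] := v3 x xc; have := v31 s1; rewrite -hx ltnn.
have hdE : hreg h3 rHd = hreg h rHd by rewrite fr3 // fr2.
have hd2 : hreg h2 rHd <= hreg h2 rTl by rewrite fr2 // -[hreg h1 rHd]/(hreg h rHd) hd; case: ex2.
have cl3 : closed_upto i (hreg h3 rHd) h3 by rewrite fr3 //; apply: closed_ext ex3 hd2 cl2.
have hd3 : hreg h3 rHd <= hreg h3 rTl by rewrite fr3 //; case: ex3 => _ t3 _ _; apply: leq_trans hd2 t3.
have as3 : at_stage i h3 by split=> //; rewrite fr3 // fr2.
apply: run_seq; apply: run_conseq (run_frame (run_grow il as3 mk3 pe3 hd3 cl3)).
move=> X4 h4 [f4 [mk4 pe4 hd4 [cl4 ex4] le4]].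
have [fr4 fa4 _] := f4.
have as4 : at_stage i h4.
  by split; [apply: env_frame f4 _|rewrite fr4 // fr3 // fr2..].
have hs4 : hreg h4 rS = #|K G a b| by rewrite fr4 // fr3 // fr2.
apply: run_seq; apply: run_conseq (run_check as4 hs4) => X5 h5 [X5D [f5 ck]].
have [fr5 fa5 _] := f5.
have en5 : env h5 by case: as4 => en4 _ _ _ _; apply: env_frame f5 _.
have [u5 v5 a5 b5] : [/\ hreg h5 rU = p i, hreg h5 rV = p i.+1, hreg h5 rA = a & hreg h5 rB = b].
  by case: as4 => *; split; rewrite fr5.
have mk5 : marked i h5.
  by case: mk4 => *; split; rewrite ?fa5 ?fr5.
have g5 : harr h5 aGood = harr h aGood by rewrite fa5 // fa4 // fa3 // fa2.
have pi_e : G (p i) (p i.+1) by case: chd => _ _ _ H _; apply: H.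
set ok := [&& hreg h5 rM <= i.+1, good G (p i) (p i.+1), p i \notin K G a b, p i.+1 \notin K G a b
    & [forall x in K G a b :&: Li i, (#|nbhd G x| <= #|K G a b :|: Li i|) && (st h5 x == 0)]].
have okE : heval h5 ok_e = ok.
  have -> : ok = [&& ~~ (i.+1 < hreg h5 rM), good G (p i) (p i.+1), p i \notin K G a b, p i.+1 \notin K G a b
    , ~~ (hreg h5 rC < hreg h5 rD) & hreg h5 rE == 0].
    by rewrite /ok -!leqNgt ck fa5.
  rewrite !andbA; apply: mulE; last exact: noe0.
  apply: mulE; last by apply: noeE.
  do 2!(apply: mulE; last by apply: noeE; apply: inKeE).
  by apply: mulE; [apply: noeE; rewrite /= (mk_stage mk5)|rewrite /= u5 v5 g5 (env_n en5) hg].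
have ex45 : ext h4 h5.
  by split; rewrite /potential ?fr5 // ?fa5 // => k; rewrite fa5.
have ex5 : ext h h5.
  apply: ext_trans ex45; apply: ext_trans ex4; apply: ext_trans ex3; case: ex2 => *; split=> //.
have sd5 j : j <= i -> st h5 (p j) != 0.
  by move=> ji; case: ex45 => e _ _ _; apply: e; case: ex4 => e _ _ _; apply: e; case: ex3 => e _ _ _; apply: e; apply: sd2.
have hd5 : hreg h5 rHd = hreg h5 rTl by rewrite !fr5.
have cl5 : closed_upto i (hreg h5 rHd) h5.
  by rewrite fr5 //; apply: closed_ext ex45 _ cl4; rewrite hd4.
have pe5 : pending i.+1 h5 by move=> x; rewrite fa5 //; apply: pe4.
have f5' : hreg h5 rF = 0 by rewrite fr5 // fr4 // fr3 // fr2.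
have pots : (potential h5 - hreg h5 rHd) * D.+1 + X4 <= (potential h - hreg h rHd) * D.+1 + 1.
  have -> : potential h5 = potential h4 by case: ex45.
  have <- : potential h3 = potential h.
    by case: ex3 => _ _ _ ->; case: ex2 => _ _ _ ->.
  by rewrite fr5 // -hdE addnC addn1.
have fin : maxn 1 (maxn X2 (maxn X3 (maxn X4 (maxn X5 1)))) + (potential h5 - hreg h5 rHd) * D.+1 <=
    (potential h - hreg h rHd + 2) * D.+1.
  rewrite mulnDl.
  have : maxn 1 (maxn X2 (maxn X3 (maxn X4 (maxn X5 1)))) <= D.+1 + X4.
    have l1 z : z <= D.+1 -> z <= D.+1 + X4 by move/leq_trans; apply; apply: leq_addr.
    by rewrite !geq_max (l1 1) // (l1 X2) // (l1 X3) // (l1 X5) // leq_addl.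
  by move: pots; rewrite mul2n -addnn; clear; lia.
apply: run_if; rewrite okE boolE; case: ifPn => okk; apply: run_straight => //=; split=> //.
  right; split=> //; split; last by rewrite -(mk_stage mk5).
  by split=> //=; apply: (accepted il mk5 pe5 hd5 cl5 sd5 okk).
left; split=> //; split=> /=; rewrite ?u5 //.
- case: mk5 => m1 m2 m3 m4 m5 m6 m7 m8 m9; split=> //=.
  + by rewrite m2 addn1.
  + by move=> x /m5 /leqW.
  + by move=> j V ij; apply: m8; apply: ltnW.
- split=> // k y x kh qy g; case: (cl5 k y kh qy x g) => [?|[xL xy]]; first by left.
  by right.
split; first by move=> j; rewrite ltnS => /sd5.
move=> j V; rewrite ltnS leq_eqVlt => /orP[/eqP->|]; last exact: rej.
by move=> sV; case/negP: okk; apply: sep_accepted sV mk5.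
Qed.

Lemma run_sweep h : sweep_env h -> hreg h rF = 0 -> harr h aHi = hi ->
  (forall x : 'I_n, st h x = 0) ->
  run_within c_sweep h ((3 * n).+1 * D.+1) (fun h' =>
    hreg h' rF = 0 /\ (forall j V, ~ sep G a b p len j V) \/
    hreg h' rF = 1 /\ exists2 i, i < len & found i h').
Proof.
move=> [en ha hb hs hg hp] hf hh s0.
do 6!(apply: run_within_seq; apply: run_within_straight => //); set h1 := sexec _ _.
have en1 : env h1 by case: en => *; split.
pose I h' := hreg h' rF = 0 /\ (exists2 i, i <= len & stage_start i h') \/
   hreg h' rF = 1 /\ (exists2 i, i < len & found i h').
pose phi h' := (potential h' - hreg h' rHd + 2 * (n.+1 - (hreg h' rI + hreg h' rF))) * D.+1.
have I1 : I h1.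
  left; split=> //; exists 0 => //; split=> //=; rewrite ?ha ?p_0 //.
  - split=> //=; try by move=> x; rewrite s0.
      by left.
    by move=> j V _ _ x; rewrite s0.
  - by move=> x; rewrite s0.
have phi1 : (phi h1).+1 <= (3 * n).+1 * D.+1.
  have -> : phi h1 = (potential h1 + 2 * n) * D.+1.
    by rewrite /phi -[hreg h1 rHd]/0 -[hreg h1 rI]/1 -[hreg h1 rF]/(hreg h rF) hf subn0 addn0 subSS subn0.
  have le : (potential h1 + 2 * n) * D.+1 <= (3 * n) * D.+1.
    rewrite leq_mul2r [potential h1]/potential -[hreg h1 rTl]/0 addn0.
    by have := max_card [set x : 'I_n | st h1 x != 2]; rewrite card_ord => H; clear -H; lia.
  by rewrite mulSn; clear -le; lia.
apply: run_conseq (run_frame (@run_while (noe (HR rU |=| HR rB) |*| noe (HR rF)) c_stage h1 I phi I1 _)).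
  move=> X h' [[fr _ _] [Ih e le]]; split; first by apply: leq_trans (leq_addr _ _) (leq_trans le phi1).
  have hb' : hreg h' rB = b by rewrite fr.
  case: Ih => [[f0 [i il [[hu _] _ _ _ [_ rej]]]]|]; [left|by right].
  split=> // j V sV; case: (sV) => -[jl _ _ _] _ _ _ _; apply: (rej j V) => //.
  suff -> : i = len by [].
  apply/eqP; rewrite -eq_pb // -eqoE -hu -hb'; move: e; rewrite /= f0 /=.
  by case: (_ == _).
move=> h2 Ih f2 e; have [fr fa _] := f2.
have se2 : sweep_env h2.
  by split; rewrite ?fr ?fa //; apply: env_frame en1 f2 _.
have hi2 : harr h2 aHi = hi by rewrite fa.
case: Ih => [[f0 [i il ss]]|[f0 _]]; last by move: e; rewrite /= f0 muln0.
have {}il : i < len.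
  rewrite ltn_neqAle il andbT -eq_pb // -eqoE; have [[<- _] _ _ _ _] := ss.
  by rewrite -(sw_b se2); move: e => /=; case: (hreg h2 rU == hreg h2 rB).
have iI : hreg h2 rI = i.+1 by case: ss => _ mk _ _ _; rewrite (mk_stage mk).
apply: run_conseq (run_stage il se2 f0 ss) => X h' [H le]; split.
  case: H => [[f1 s1]|[f1 [s1 _]]]; [left|right]; split=> //; first by exists i.+1.
  by exists i.
have E : hreg h' rI + hreg h' rF = i.+2.
  case: H => [[-> [_ mk _ _ _]]|[-> [_ ->]]]; last by rewrite addn1.
  by rewrite (mk_stage mk) addn0.
rewrite /phi E iI f0 addn0.
have -> : n.+1 - i.+1 = (n.+1 - i.+2).+1.
  have := ltn_trans il len_n; clear; lia.
move: le; rewrite mulnS !mulnDl; clear; lia.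
Qed.

End Walk.
End Search.

Definition goodtab h := forall x y, G x y -> harr h aGood (x * n + y) = good G x y.

Definition joinable (a b : 'I_n) := [/\ good G a b, connect (gk G a b) b a
  & forall p len, chordless G a b p len -> exists i V, sep G a b p len i V].

Definition found_join (h : hstate) := exists a b u v : 'I_n, exists S : {set 'I_n},
  [/\ [/\ hreg h rA = a, hreg h rB = b, hreg h rU = nat_of_ord u & hreg h rV = nat_of_ord v],
      S = [set x : 'I_n | harr h aSt x != 0],
      (forall x, x \in S -> x \in K G a b -> x \notin K G u v)
    & let V0 := K G a b :&: K G u v in let V2 := ~: (S :|: V0) in
      is_pseudo_2_join G V0 S V2 (S :&: K G a b) (S :&: K G u v) (V2 :&: K G a b) (V2 :&: K G u v)].

Definition edge_time := (3 * n).+1 * D.+1.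

Lemma connect_closed (e : rel 'I_n) (q : {pred 'I_n}) x y :
  (forall u v, u \in q -> e u v -> v \in q) -> x \in q -> connect e x y -> y \in q.
Proof.
move=> cq xq /connectP[s ps ->]; elim: s x xq ps => //= z s IH x xq /andP[xz ps].
exact: IH (cq _ _ xq xz) ps.
Qed.

Lemma run_edge h (a b : 'I_n) : env h -> goodtab h -> G a b ->
  hreg h rA = a -> hreg h rB = b -> hreg h rF = 0 ->
  run_within c_edge h edge_time (fun h' => hreg h' rF = 0 /\ ~ joinable a b \/
    hreg h' rF = 1 /\ found_join h').
Proof.
move=> en gt gab ha hb hf.
have n0 : 0 < n by apply: leq_ltn_trans (ltn_ord a).
have T0 : n.+1 * D.+1 <= edge_time by rewrite leq_mul2r ltnS leq_pmull.
have T1 : n.+1 <= edge_time by apply: leq_trans T0; rewrite leq_pmulr.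
have T2 : D.+1 <= edge_time by apply: leq_trans T0; rewrite leq_pmull.
have T3 : 0 < edge_time by [].
apply: run_within_if.
have -> : heval h (celle aGood (HR rA) (HR rB)) = good G a b.
  by rewrite /= ha hb (env_n en) gt.
rewrite boolE; case: ifP => gd; last first.
  by apply: run_within_straight => //; left; split=> // -[]; rewrite gd.
apply: run_within_seq; apply: (run_within_conseq T1 _ (run_reset (env_n en))) => h1 _ [f1 r1].
have [fr1 fa1 _] := f1; have en1 : env h1 by apply: env_frame f1 _.
have [ha1 hb1] : hreg h1 rA = a /\ hreg h1 rB = b by rewrite !fr1.
have p1 (x : 'I_n) : harr h1 aPar x = 0 by case: (r1 x).
apply: run_within_seq; apply: (run_within_conseq T0 _ (run_bfs en1 ha1 hb1 p1)) => h2 f2 [q sq cq].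
have [fr2 fa2 _] := f2; have en2 : env h2 by apply: env_frame f2 _.
have [ha2 hb2] : hreg h2 rA = a /\ hreg h2 rB = b by rewrite !fr2.
have hf2 : hreg h2 rF = 0 by rewrite fr2 // fr1.
apply: run_within_if; rewrite /= ha2 (search_mem sq); case: ifP => aq; last first.
  apply: run_within_straight => //; left; split=> // -[_ c _].
  have [bq _] := search_root sq; have := connect_closed _ bq c; rewrite aq => H.
  by suff : false by []; apply: H => u v uq uv; apply: (cq v u) => //; rewrite gk_sym.
have [p [len [ch ln pb pp]]] := search_path sq aq.
have h0 (x : 'I_n) : harr h2 aHi x = 0 by rewrite fa2 //; case: (r1 x).
apply: run_within_seq; apply: (run_within_conseq T0 _ (run_hi ch ln pb pp en2 ha2 hb2 erefl h0)) => h3 f3 lc.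
have [fr3 fa3 _] := f3; have en3 : env h3 by apply: env_frame f3 _.
have [ha3 hb3] : hreg h3 rA = a /\ hreg h3 rB = b by rewrite !fr3.
apply: run_within_seq; apply: (run_within_conseq T2 _ (run_size en3 ha3 hb3)) => h4 f4 hs.
have [fr4 fa4 _] := f4; have en4 : env h4 by apply: env_frame f4 _.
have [ha4 hb4] : hreg h4 rA = a /\ hreg h4 rB = b by rewrite !fr4.
have se : sweep_env a b (harr h2 aPar) h4.
  split=> //; last by rewrite fa4 // fa3.
  by move=> x y xy; rewrite fa4 // fa3 // fa2 // fa1 // gt.
have hf4 : hreg h4 rF = 0 by rewrite fr4 // fr3.
have s4 (x : 'I_n) : harr h4 aSt x = 0 by rewrite fa4 // fa3 // fa2 //; case: (r1 x).
have hi4 : harr h4 aHi = harr h3 aHi by rewrite fa4.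
apply: run_within_conseq (run_sweep ch ln pb pp lc gd se hf4 hi4 s4) => // h5 f5.
have [fr5 fa5 _] := f5.
case=> [[f0 no]|[f1' [i il [hu hv ac]]]]; [left|right]; split=> //.
  by case=> _ _ /(_ p len ch)[j [V sV]]; apply: no sV.
exists a, b, (p i), (p i.+1), [set x : 'I_n | harr h5 aSt x != 0]; split=> //.
- by split=> //; rewrite fr5.
- case: (ac) => _ _ _ [n0' _] _ x xS xK; apply/negP => xL.
  by have := n0' x xK xL; rewrite xS.
exact: accepts_pseudo_2_join gab ch ac.
Qed.

Lemma run_main h : env h -> goodtab h -> input_io h ->
  run_within c_main h (m.+1 * edge_time) (fun h' =>
    hreg h' rF = 0 /\ (forall p, p \in l -> ~ joinable p.1 p.2) \/
    hreg h' rF = 1 /\ found_join h').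
Proof.
move=> en gt io; do 2!(apply: run_within_seq; apply: run_within_straight => //); set h1 := sexec _ _.
have en1 : env h1 by case: en => *; split.
pose I h' := hreg h' rF = 0 /\ (hreg h' rQ <= m /\ forall p, p \in take (hreg h' rQ) l -> ~ joinable p.1 p.2) \/
    hreg h' rF = 1 /\ found_join h'.
have I1 : I h1 by left; rewrite /= take0.
set bd := (X in HWhile _ X).
have E : m.+1 * edge_time = (m - hreg h1 rQ).+1 * edge_time by rewrite subn0.
rewrite E; apply: run_within_conseq (@run_within_while _ bd h1 I (fun h' => m - hreg h' rQ) edge_time I1 _ _) => //.
  move=> h' [fr _ _] [[[f0 [qm H]]|H] e]; [left|by right]; split=> // p pl; apply: H.
  have em : hreg h' 1 = m by rewrite fr // (env_m en1).
  move: e; rewrite /= f0 em /= muln1; case: ltnP => // mq _.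
  by rewrite take_oversize.
move=> h2 Ih f2 /= e; have [fr2 fa2 fio2] := f2.
have en2 : env h2 by apply: env_frame f2 _.
have hl2 : hlow h2 = n + (m + m) by rewrite /hlow !(env_n en2) !(env_m en2).
case: Ih => [[f0 [qm H]]|[f0 _]]; last by rewrite f0 muln0 in e.
rewrite f0 (env_m en2) muln1 boolE in e.
have [l1 [p [l2 [e1 e2]]]] := split_at e.
have [io1 io2] := io _ _ _ e1.
have pl : p \in l by rewrite e1 mem_cat mem_head orbT.
have gp := mem_edges pl.
apply: run_within_seq; apply: run_load; rewrite /= ?hl2; first by clear -e; lia.
split=> //; apply: run_within_seq; apply: run_load; rewrite /= /hlow /= -/(hlow _) ?hl2; first by clear -e; lia.
split=> //; rewrite fio2 // -e2 io1 io2 e2; set h3 := set_hreg _ _ _.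
have en3 : env h3 by apply: env_set_hreg => //; apply: env_set_hreg.
have gt3 : goodtab h3 by move=> x y xy; rewrite /= fa2 // gt.
apply: run_within_seq; apply: run_within_conseq (run_edge en3 gt3 gp erefl erefl f0) => // h4 f4 H4.
have [fr4 _ _] := f4.
have q4 : hreg h4 rQ = hreg h2 rQ by rewrite fr4.
apply: run_within_straight => //=; rewrite q4 addn1; split; last first.
  by move: e; clear; lia.
case: H4 => [[f0' nj]|[f1 [a [b [u [v [S [[r1 r2 r3 r4] s1 s2 s3]]]]]]]]; [left|right]; split=> //=.
  split=> // p'; rewrite -e2 {1}e1 take_split mem_rcons inE => /orP[/eqP->|pt] //.
  by apply: H; rewrite -e2 e1 take_size_cat.
by exists a, b, u, v, S; split.
Qed.

Lemma run_label h : env h -> found_join h ->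
  run_within c_label h n.+1 (fun h' => frame c_label h h' /\
    labels_pseudo_2_join G (fun x : 'I_n => hio h' x)).
Proof.
move=> en [a [b [u [v [S [[ha hb hu hv] hS nS J]]]]]].
pose lab x := if x \in S then (if x \in K G a b then 1 else if x \in K G u v then 2 else 3)
  else if x \in K G a b then (if x \in K G u v then 0 else 4)
  else if x \in K G u v then 5 else 6.
have := @run_within_forn rX (HR 0) _ h n 1 (fun j h' =>
  forall x : 'I_n, x < j -> hio h' x = lab x).
rewrite muln1 => H; apply: run_within_conseq (H _ _ _ _ _ _) => //= {H}.
- move=> h' _ [f H]; split=> //.
  have E (x : 'I_n) : hio h' x = lab x by apply: H.
  rewrite /labels_pseudo_2_join; move: J; congr is_pseudo_2_join; apply/setP => x;
    rewrite ?in_setI ?in_setC ?in_setU ?in_setI inE E /lab; have := nS x;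
    by case: (x \in S); case: (x \in K G a b); case: (x \in K G u v) => // /(_ isT isT).
- by move=> h1 [fr _ _]; rewrite fr // (env_n en).
move=> j h1 jn f1 hj H; have [fr1 fa1 _] := f1.
pose x := Ordinal jn.
have en1 : env h1 by apply: env_frame f1 _.
have st1 : harr h1 aSt j != 0 = (x \in S) by rewrite hS inE fa1.
have [a1 b1 u1 v1] : [/\ hreg h1 rA = a, hreg h1 rB = b, hreg h1 rU = u & hreg h1 rV = v].
  by split; rewrite fr1.
have inK := inKeE en1 a1 b1 (hj : hreg h1 rX = x).
have inL := inLeE en1 u1 v1 (hj : hreg h1 rX = x).
have lw : j < hlow h1 by rewrite /hlow (env_n en1) (leq_trans jn) ?leq_addr.
have out c : lab x = c -> run_within (HOut (HR rX) (HC c)) h1 1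
    (fun h2 => forall x : 'I_n, x < j.+1 -> hio (set_hreg h2 rX j.+1) x = lab x).
  move=> lx; apply: run_out; rewrite /= hj //; split=> // y.
  rewrite ltnS leq_eqVlt; case: (y =P j :> nat) => [e _|_ /= yj]; last exact: H.
  by rewrite -lx; congr lab; apply: val_inj.
have fin : lab x = lab x by [].
rewrite [in LHS]/lab in fin.
apply: run_within_if; rewrite [heval _ _]/= hj st1; case: ifP => c1; rewrite c1 in fin.
  apply: run_within_if; rewrite inK boolE; case: ifP => c2; rewrite c2 in fin; first exact: out.
  by apply: run_within_if; rewrite inL boolE; case: ifP => c3; rewrite c3 in fin; apply: out.
apply: run_within_if; rewrite inK boolE; case: ifP => c2; rewrite c2 in fin.
  by apply: run_within_if; rewrite inL boolE; case: ifP => c3; rewrite c3 in fin; apply: out.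
by apply: run_within_if; rewrite inL boolE; case: ifP => c3; rewrite c3 in fin; apply: out.
Qed.

Lemma not_joinable_no_join : ~ has_pseudo_1_join G ->
  (forall p, p \in l -> ~ joinable p.1 p.2) -> ~ has_pseudo_2_join G.
Proof.
move=> no1 nj [V0 [V1 [V2 [A1 [B1 [A2 [B2 J]]]]]]]; have J' := pseudo_2_join_swap J.
have [a [b [aA bA gab c]]] := join_edge no1 J.
have symc : connect_sym (gk G a b) by apply: sym_connect_sym => x y; rewrite gk_sym.
have [p pl [e|e]] := edges_mem gab; case: (nj p pl); rewrite e /=; split.
- exact: (join_good J aA bA).
- exact: c.
- by move=> q len; apply: (sep_exists J aA bA).
- exact: (join_good J' bA aA).
- have e' : gk G b a =2 gk G a b by move=> x y; rewrite /gk K_sym.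
  by rewrite (eq_connect e') symc; exact: c.
- by move=> q len; apply: (sep_exists J' bA aA).
Qed.

Lemma run_all h : ~ has_pseudo_1_join G -> hreg h 0 = n -> hreg h 1 = m ->
  (forall a i, harr h a i = 0) -> input_io h -> 0 < n ->
  run_within c_all h (m.+1 * edge_time) (fun h' => frame c_all h h' /\
    (hreg h' rF = 1 /\ labels_pseudo_2_join G (fun x : 'I_n => hio h' x) \/
     hreg h' rF = 0 /\ ~ has_pseudo_2_join G)).
Proof.
move=> no1 h0 hm z io n0.
have T0 : n.+1 <= m.+1 * edge_time.
  rewrite /edge_time mulnA (leq_trans _ (leq_pmulr _ _)) // (leq_trans _ (leq_pmull _ _)) //.
  by rewrite ltnS leq_pmull.
have T1 : m.+1 <= m.+1 * edge_time by rewrite leq_pmulr.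
have T2 : m.+1 * (D.+1 * D.+1) <= m.+1 * edge_time.
  rewrite leq_mul2l /edge_time leq_mul2r /=.
  suff : max_degree G <= n by rewrite /D; clear -n0; lia.
  by apply/bigmax_leqP => x _; rewrite -[X in _ <= X](card_ord n) max_card.
suff H : run_within c_all h (m.+1 * edge_time) (fun h' =>
    hreg h' rF = 1 /\ labels_pseudo_2_join G (fun x : 'I_n => hio h' x) \/
     hreg h' rF = 0 /\ ~ has_pseudo_2_join G).
  exact: (run_within_conseq (leqnn _) _ H).
apply: run_within_seq; apply: (run_within_conseq T0 _ (run_init h0 z)) => h1 _ [[fr1 _ io1] t1].
have io1' : input_io h1 by rewrite /input_io io1.
have [h10 h1m] : hreg h1 0 = n /\ hreg h1 1 = m by rewrite !fr1.
apply: run_within_seq; apply: (run_within_conseq T1 _ (run_edges h10 h1m io1' t1)) => h2 _ [[_ _ io2] en2].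
have io2' : input_io h2 by rewrite /input_io io2.
apply: run_within_seq; apply: (run_within_conseq T2 _ (run_good en2 io2')) => h3 [_ _ io3] [en3 gt3].
have io3' : input_io h3 by rewrite /input_io io3.
apply: run_within_seq; apply: (run_within_conseq (leqnn _) _ (run_main en3 gt3 io3')) => h4 f4 H4.
have en4 : env h4 by apply: env_frame f4 _.
apply: run_within_if => /=; case: H4 => [[f0 nj]|[f1 fj]].
  rewrite f0; apply: run_within_straight => //; right; split; first exact: f0.
  exact: (not_joinable_no_join no1 nj).
by rewrite f1; apply: (run_within_conseq T0 _ (run_label en4 fj)) => h5 _ [[fr5 _ _] lb]; left; rewrite fr5.
Qed.

Lemma time_bound : connected G ->
  m.+1 * edge_time <= 24 * (n * m * max_degree G).+1.
Proof.
case; rewrite card_ord => n0 con; rewrite /edge_time /D.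
have [m0|m0] := posnP m.
  have n1 : n = 1.
    apply/eqP; rewrite eqn_leq n0 andbT leqNgt; apply/negP => n1.
    have /connectP[s ps e] := con (Ordinal n0) (Ordinal n1).
    case: s ps e => [_ /(congr1 val)//|x s /= /andP[/edges_mem[p pl _]]].
    by have := pl; rewrite (size0nil m0).
  have -> : max_degree G = 0.
    apply/eqP; rewrite -leqn0; apply/bigmax_leqP => x _; rewrite leqn0 cards_eq0.
    apply/eqP/setP => y; rewrite !inE; apply/negP => /edges_mem[p pl _].
    by have := pl; rewrite (size0nil m0).
  by rewrite m0 n1.
have D0 : 0 < max_degree G.
  rewrite /m in m0; have [l1 [p [l2 [e1 _]]]] := split_at m0.
  have /mem_edges gp : p \in l by rewrite e1 mem_cat mem_head orbT.
  apply: leq_trans (leq_bigmax (F := fun x => #|[set y | G x y]|) p.1).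
  by rewrite card_gt0; apply/set0Pn; exists p.2; rewrite inE.
apply: (@leq_trans (24 * (n * m * max_degree G))); last by rewrite leq_mul2l leqnSn.
apply: (@leq_trans ((2 * m) * ((4 * n) * (3 * max_degree G)))).
  apply: leq_mul; last apply: leq_mul.
  - by clear -m0; lia.
  - by clear -n0; lia.
  - by clear -D0; lia.
by apply/eq_leq; clear; lia.
Qed.

End Correct.

Lemma input_hio n (l l1 l2 : seq ('I_n * 'I_n)) p : l = l1 ++ p :: l2 ->
  let io := nth 0 (flatten [seq [:: val p.1; val p.2] | p <- l]) in
  io (size l1 + size l1) = p.1 /\ io (size l1 + size l1 + 1) = p.2.
Proof.
move=> -> /=; rewrite map_cat flatten_cat.
have sz : size (flatten [seq [:: val p.1; val p.2] | p <- l1]) = size l1 + size l1.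
  by elim: (l1) => //= q s ->; rewrite addnS.
move: (size l1 + size l1) sz => k sz.
have kk : (k + 1 < k) = false by rewrite addn1 ltnNge leqnSn.
by rewrite !nth_cat sz ltnn kk subnn addnC addnK.
Qed.

Lemma input_size n (l : seq ('I_n * 'I_n)) :
  size (flatten [seq [:: val p.1; val p.2] | p <- l]) = size l + size l.
Proof. by elim: l => //= q s ->; rewrite addnS. Qed.

Lemma input_le n (l : seq ('I_n * 'I_n)) i :
  nth 0 (flatten [seq [:: val p.1; val p.2] | p <- l]) i <= n.
Proof.
elim: l i => [|p l IH] [|[|i]] //=; try exact: ltnW; exact: IH.
Qed.

Lemma word_bound (c z n m d t : nat) : 0 < n -> d <= n -> t <= c * (24 * (n * m * d).+1) ->
  ((n + m).+1 + 16 + t) ^ z < (n + m).+1 ^ ((24 * c + 17 + 3) * z).+1.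
Proof.
move=> n0 dn tb; set N := (n + m).+1; have N1 : 1 < N by rewrite /N ltnS addn_gt0 n0.
apply: (@leq_ltn_trans (N ^ ((24 * c + 17 + 3) * z))); last by rewrite ltn_exp2l.
rewrite expnM; case: z => [|z]; first by rewrite !expn0.
rewrite leq_exp2r // expnD.
have nmd : (n * m * d).+1 <= N ^ 3.
  have le1 : n * m * d <= n * m * n by rewrite leq_mul2l dn orbT.
  by apply: leq_ltn_trans le1 _; rewrite /N !expnS expn0 muln1; clear; nia.
have N3 : N <= N ^ 3 by rewrite -[X in X <= _]expn1 leq_pexp2l // ltnW.
apply: (@leq_trans ((24 * c + 17) * N ^ 3)); last first.
  rewrite leq_mul2r; apply/orP; right.
  by apply: leq_trans (ltnW (ltn_expl _ (ltnSn 1))) _; rewrite leq_exp2r // addn_gt0 orbT.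
have tN : t <= 24 * c * N ^ 3.
  apply: leq_trans tb _; rewrite mulnA [c * 24]mulnC leq_mul2l nmd orbT //.
have N0 : 0 < N ^ 3 by rewrite expn_gt0 ltnW.
rewrite !mulnDl; move: tN N3 N0; clear; lia.
Qed.

Definition h_input n (l : seq ('I_n * 'I_n)) : hstate :=
  HState (nth 0 [:: n; size l]) (fun _ _ => 0)
    (nth 0 (flatten [seq [:: val p.1; val p.2] | p <- l])).

Lemma sim_input n (l : seq ('I_n * 'I_n)) : sim (h_input l) (input_state l).
Proof.
split=> //= a i _; rewrite nth_default // input_size /hlow /=.
by clear; lia.
Qed.

Lemma bounded_input n (l : seq ('I_n * 'I_n)) :
  bounded ((n + size l).+1 + 16) (h_input l).
Proof.
split=> //= [[|[|r]]|i _] /=.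
- by rewrite addSn -addnS -addnA leq_addr.
- by rewrite addSn -addnS addnAC leq_addl.
- by rewrite nth_default.
by apply: leq_trans (input_le _ _) _; rewrite addSn -addnS -addnA leq_addr.
Qed.

(* The hypothesis on w says that words have at least k log_2 (n + m + 1) bits,
   for a constant k. The successor in the time bound only matters for the
   one-vertex graph, where m = 0. *)
Theorem theorem21 :
  exists (p : cmd) (C k : nat),
    forall (n : nat) (G : graph 'I_n) (l : seq ('I_n * 'I_n)) (w : nat),
      connected G ->
      ~ has_pseudo_1_join G ->
      edge_list G l ->
      (n + num_edges G).+1 ^ k <= 2 ^ w ->
      exists (t : nat) (s : state),
        [/\ exec w p (input_state l) t s,
            t <= C * (n * num_edges G *
                      (max_degree G +
                       inv_ackermann (num_edges G) (max_degree G))).+1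
          & correct_output G s].
Proof.
exists (Seq (compile c_all) (Seq (Assign 0 (Reg 5)) (Assign 1 (Cst 0)))),
  (24 * pass_cost c_all + 4), ((24 * pass_cost c_all + 17 + 3) * cmd_size c_all).+1.
move=> n G l w con no1 hl; have := @run_all n G l hl (h_input l) no1 erefl erefl.
have wf := c_all_wf; have := @transfer w c_all (h_input l).
have keep : [/\ keepr c_all 0, keepr c_all 1 & true] by split.
have [kk kE] : exists kk, pass_cost c_all = kk by exists (pass_cost c_all).
have [z zE] : exists z, cmd_size c_all = z by exists (cmd_size c_all).
rewrite kE zE; move: c_all kE zE wf keep.
move=> c kE zE wf [k0 k1 _] tr /(_ (fun _ _ => erefl)).
have n0 : 0 < n by case: con; rewrite card_ord.
case=> [l1 p l2 e||t [h [X [ex tX X0 [XT [fr out]]]]]] //; first exact: input_hio e.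
rewrite -(size_edges hl) => wb.
have tb : t <= kk * (24 * (n * size l * max_degree G).+1).
  by apply: leq_trans tX _; rewrite kE leq_mul2l (leq_trans XT) ?orbT // (time_bound hl).
have dn : max_degree G <= n.
  by apply/bigmax_leqP => x _; rewrite -[X in _ <= X](card_ord n) max_card.
have := tr _ _ ex (input_state l) ((n + size l).+1 + 16) wf.
rewrite leq_addl => /(_ isT (leq_trans (word_bound z n0 dn tb) wb) (sim_input l) (bounded_input l)).
case=> s [es [sr sm si] _].
exists (t + (2 + 2)), (set_reg (set_reg s 0 (regs s 5)) 1 (0 %% 2 ^ w)); split.
- apply: exec_seq es _; apply: exec_seq; [exact: exec_assign|].
  exact: (@exec_assign _ (set_reg s 0 (regs s 5)) 1 (Cst 0)).
- rewrite mulnDl leq_add //.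
    apply: leq_trans tb _; rewrite mulnA [kk * 24]mulnC leq_mul2l ltnS leq_mul2l leq_addr !orbT //.
  by rewrite leq_pmulr.
have hl' : n <= hlow h by case: fr => fr' _ _; rewrite /hlow !fr' //= leq_addr.
rewrite /correct_output /= mod0n sr; case: out => [[-> lb]|[-> nj]]; [left|right]; split=> //.
move: lb; rewrite /labels_pseudo_2_join.
have E (x : 'I_n) : Defs.mem s (0 + x) = hio h x by rewrite add0n si // (leq_trans (ltn_ord x)).
by congr is_pseudo_2_join; apply/setP => x; rewrite !inE E.
Qed.
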